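(* Let $p>7$ be a prime. If $p\equiv 3,5,6\pmod 7$, then $$\sum_{k=0}^{p-1}\frac{\binom{2k}{k}\binom{3k}{k}\binom{6k}{3k}}{(-15)^{3k}}\equiv 0\pmod{p^2}.$$ If $p\equiv 1,2,4\pmod 7$ and so $p=C^2+7D^2$ with $C,D\in\mathbb{Z}$, then $$\sum_{k=0}^{p-1}\frac{\binom{2k}{k}\binom{3k}{k}\binom{6k}{3k}}{(-15)^{3k}}\equiv \left(\frac{p}{15}\right)4C^2\pmod p.$$
   Context: $\left(\frac{p}{15}\right)$ denotes the Jacobi symbol. Congruences modulo $p$ and $p^2$ are in the ring of rational numbers whose denominator is coprime to $p$. *)

(* Defs.v *)
From mathcomp Require Import all_boot all_order all_algebra.

Set Implicit Arguments.
Unset Strict Implicit.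
Unset Printing Implicit Defensive.

Import Order.TTheory GRing.Theory Num.Theory.
Local Open Scope ring_scope.

(* Meant for an odd prime q. *)
Definition legendre (a : int) (q : nat) : int :=
  if (q %| a)%Z then 0
  else if [exists x : 'I_q, ((x%:Z ^+ 2 == a %[mod q])%Z)] then 1
  else -1.

(* Meant for an odd positive n. *)
Definition jacobi (a : int) (n : nat) : int :=
  \prod_(f <- prime_decomp n) legendre a f.1 ^+ f.2.

Definition p_integral (p : nat) (x : rat) : bool := coprime `|denq x|%N p.

(* x = y (mod m) in the ring of p-integral rationals: x and y lie in the ring,
   and x - y lies in the ideal generated by m. *)
Definition eq_mod_p_integral (p m : nat) (x y : rat) : Prop :=
  [/\ p_integral p x, p_integral p y
    & exists2 z : rat, p_integral p z & x - y = m%:R * z].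

(* Main.v *)
Require Import Defs.
From mathcomp Require Import all_boot all_order all_algebra.
From HB Require Import structures.
From mathcomp Require Import all_field generic_quotient cyclic ring lra zify.

Set Implicit Arguments.
Unset Strict Implicit.
Unset Printing Implicit Defensive.

Import Order.TTheory GRing.Theory Num.Theory.
Local Open Scope ring_scope.

(** Let p = 2 m + 1, let a_k = (3k choose k) (6k choose 3k) be [hyp_a k] and
    c_k = (2k choose k) a_k be [hyp_c k], so that the sum of the theorem is that
    of c_k / (-15)^(3k). The proof turns it into the square of a Hasse invariant
    of an elliptic curve with complex multiplication by omega = (1 + s) / 2,
    where s^2 = -7.

    The sum is a square modulo p^2. Clausen's formula
    (sum a_k x^k)^2 = sum c_k (x (1 - 432 x))^k is a family of identities
    between coefficients (clausen_coef), and enough of the a_k and c_k are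
    divisible by p or p^2 for it to hold modulo p^2 when both series stop at
    k < p (truncated_clausen). At x = (25 - 3 r) / 21600 with r^2 = 105 the
    argument x (1 - 432 x) is -1 / 15^3.

    The root of that square is a Hasse invariant. In characteristic p, the sum
    of the a_k l^k for k < p is the coefficient of X^(p-1) in
    (4 X^3 + X^2 - 4 l)^m (hyp_a_hasse). For l = x this cubic is a twist of
    f = X^3 - 35 X - 98, whence the sum is 105^m H^2 modulo p, where H is the
    coefficient of X^(p-1) in f^m (hyp_a_cm).

    If p is 3, 5 or 6 modulo 7, then s^p = - s. Dividing the curve by the
    2-torsion point of abscissa (-7 + s) / 2 leads back to a conjugate model of
    the same curve, and compares H with itself: H = omega^(p-1) H. As
    omega^(p-1) is not 1, H = 0 (hasse_inert). The truncated series, an element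
    of the ring generated by r, thus vanishes at r and at - r in characteristic
    p. It is a + b r with a and b divisible by p, and its square is divisible by
    p^2 (p2_dvd_cm_num).

    If p = C^2 + 7 D^2, then - H is the sum over F_p of the f(x)^m, and this has
    to be 2 C up to sign (sum_legendre_split). Following Manin, let f(t) Y^2 = f(X)
    be the twist of the curve over F_p(t). Its points form a group on which the
    degree of the abscissa is a quadratic form (height_parallelogram,
    height_form), and on the multiples of P = (t, 1) under Z[omega] this form is
    the norm. The point (C + D s) P has height p. When s is chosen so that
    C + D s vanishes in F_p, its abscissa has derivative zero, and only the
    abscissa t^p of the Frobenius point (t^p, f(t)^m) is left (Pi_frob).
    Frobenius minus the identity therefore has the height p + 1 - 2 C or
    p + 1 + 2 C of C + D s - 1 or C + D s + 1. On the other hand its abscissa is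
    explicit, and counting the factors t - x that cancel gives the height
    1 + sum f(x)^m modulo p (frob_sub_height).

    The square roots s, r and the sign 105^m come from the quadratic Gauss sums
    of orders 7, 3 and 5 in a field with p^12 elements, on which Frobenius acts
    by the Legendre symbols. The representation p = C^2 + 7 D^2 is obtained by
    Thue's pigeonhole argument (sum_sq_7). *)

(** * Prerequisites *)

Lemma natr_neq0_ltp (R : nzRingType) (p n : nat) :
  p \in [pchar R] -> (0 < n < p)%N -> n%:R != 0 :> R.
Proof.
move=> charR /andP[n0 np]; rewrite -(dvdn_pcharf charR); apply/negP => /dvdn_leq.
by rewrite n0 leqNgt np => /(_ isT).
Qed.

Lemma natr_bin_left (R : comNzRingType) (k j : nat) :
  j.+1%:R * 'C(k, j.+1)%:R = (k%:R - j%:R) * 'C(k, j)%:R :> R.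
Proof.
have [h|h] := leqP j k; last by rewrite !bin_small ?mulr0 // ltnW.
by rewrite -natrB // -!natrM mul_bin_left.
Qed.

Lemma coef_exp_linear (R : comNzRingType) (c d : R) (n i : nat) :
  ((c *: 'X + d%:P) ^+ n)`_i = c ^+ i * d ^+ (n - i) * 'C(n, i)%:R.
Proof.
rewrite addrC exprDn coef_sum.
have termE (j : nat) : ((d%:P ^+ (n - j) * (c *: 'X) ^+ j) *+ 'C(n, j))`_i =
    c ^+ j * d ^+ (n - j) * (i == j)%:R * 'C(n, j)%:R.
  rewrite coefMn -polyC_exp mul_polyC coefZ exprZn coefZ coefXn -mulr_natr.
  by ring.
under eq_bigr do rewrite termE.
have [h|h] := leqP i n; last first.
  rewrite bin_small // mulr0 big1 // => j _.
  by rewrite (_ : (i == j)%N = false) ?mulr0 ?mul0r //; apply/gtn_eqF/(leq_trans (ltn_ord j)).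
rewrite (bigD1 (Ordinal (n := n.+1) h)) //= eqxx mulr1 big1 ?addr0 // => j ne.
by rewrite (_ : (i == j)%N = false) ?mulr0 ?mul0r //; apply/negbTE; rewrite eq_sym.
Qed.

(** * The group law on a twisted Weierstrass cubic *)

Section ChordIdentity.
Variables (L : fieldType) (D x y l m p q : L).
Hypothesis r0 : p + q != 0.
Let e := D * (l * (2%:R * y + l * p) - m * (2%:R * y - m * q)) / (p + q).
Let x4 := D * l ^+ 2 - e + (x - q).
Let y4 := l * (x - x4) - y.
Let x5 := D * m ^+ 2 - e + (x + p).
Let y5 := m * (x - x5) - y.
Hypotheses (d43 : x4 - (x - q) != 0) (d15 : x + p - x5 != 0).
Let l43 := (y4 - (y - m * q)) / (x4 - (x - q)).
Let l15 := (y + l * p - y5) / (x + p - x5).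

Let num_neq0 (n d r : L) : r != 0 -> n = r * d -> d != 0 -> n != 0.
Proof. by move=> hr -> hd; rewrite mulf_neq0. Qed.

(** Associativity in general position, as a rational identity in free
    parameters. The middle point is (x, y); the outer ones are (x + p, y + l p)
    and (x - q, y - m q), reached along lines of slopes [l] and [m]. The three
    points lie on a common curve D y^2 = x^3 + a x + b exactly when [e] is the
    sum of their abscissas, which eliminates a and b. *)
Lemma chord_assoc_x :
  D * l43 ^+ 2 - x4 - (x - q) = D * l15 ^+ 2 - (x + p) - x5.
Proof.
move: d43 d15; rewrite /l43 /l15 /y4 /y5 /x4 /x5 /e => h43 h15.
field; rewrite r0 /=; apply/andP; split;
  by [apply: (num_neq0 h15 (d := p + q)) => //; field
     |apply: (num_neq0 h43 (d := p + q)) => //; field].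
Qed.

Lemma chord_assoc_y (x6 := D * l43 ^+ 2 - e + (x + p) + x - x4) :
  l43 * (x4 - x6) - y4 = l15 * (x + p - x6) - (y + l * p).
Proof.
move: d43 d15; rewrite /x6 /l43 /l15 /y4 /y5 /x4 /x5 /e => h43 h15.
field; rewrite r0 /=; apply/andP; split;
  by [apply: (num_neq0 h15 (d := p + q)) => //; field
     |apply: (num_neq0 h43 (d := p + q)) => //; field].
Qed.
End ChordIdentity.

Section KummerForms.
Variables (R : comNzRingType) (a b : R).
(** Forms of the Kummer line: for P and Q with abscissas X1 / Z1 and X2 / Z2,
    the abscissas of P + Q and P - Q are the roots of
    kum0 T^2 - kum1 T + kum2. Over a ring, they also make sense for the
    numerators and denominators of rational functions. *)
Definition kum0 (X1 Z1 X2 Z2 : R) := (X1 * Z2 - X2 * Z1) ^+ 2.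
Definition kum1 (X1 Z1 X2 Z2 : R) :=
  2%:R * ((X1 * Z2 + X2 * Z1) * (a * (Z1 * Z2) + X1 * X2) + 2%:R * b * (Z1 * Z2) ^+ 2).
Definition kum2 (X1 Z1 X2 Z2 : R) :=
  (X1 * X2 - a * (Z1 * Z2)) ^+ 2 - 4%:R * b * (Z1 * Z2) * (X1 * Z2 + X2 * Z1).
End KummerForms.

Section GroupLaw.
Variables (L : fieldType) (D a b : L).
Hypotheses (two_neq0 : 2%:R != 0 :> L) (D_neq0 : D != 0)
  (disc_neq0 : 4%:R * a ^+ 3 + 27%:R * b ^+ 2 != 0).

(** The twist D y^2 = x^3 + a x + b, with None as its origin. *)
Definition on_curve (P : option (L * L)) : bool :=
  if P is Some (x, y) then D * y ^+ 2 == x ^+ 3 + a * x + b else true.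

Definition opp_pt (P : option (L * L)) : option (L * L) :=
  if P is Some (x, y) then Some (x, - y) else None.

Definition slope (x1 y1 x2 y2 : L) : L :=
  if x1 == x2 then (3%:R * x1 ^+ 2 + a) / (2%:R * D * y1)
  else (y1 - y2) / (x1 - x2).

Definition add_pt (P Q : option (L * L)) : option (L * L) :=
  match P, Q with
  | None, _ => Q
  | _, None => P
  | Some (x1, y1), Some (x2, y2) =>
    if (x1 == x2) && (y1 == - y2) then None else
    let l := slope x1 y1 x2 y2 in
    let x3 := D * l ^+ 2 - x1 - x2 in
    Some (x3, l * (x1 - x3) - y1)
  end.

(** Vieta's relations for the intersections of y = l x + n with the curve,
    which treat chords and tangents alike. *)
Definition line_cut (l n x1 x2 x3 : L) : Prop :=
  [/\ x1 + x2 + x3 = D * l ^+ 2,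
      x1 * x2 + x1 * x3 + x2 * x3 = a - 2%:R * D * l * n
    & x1 * x2 * x3 = D * n ^+ 2 - b].

Lemma line_cutP l n x1 x2 x3 : line_cut l n x1 x2 x3 ->
  forall X, X ^+ 3 + a * X + b - D * (l * X + n) ^+ 2
     = (X - x1) * (X - x2) * (X - x3).
Proof.
case=> h1 h2 h3 X.
have -> : b = D * n ^+ 2 - x1 * x2 * x3 by rewrite h3; ring.
have -> : a = x1 * x2 + x1 * x3 + x2 * x3 + 2%:R * D * l * n by rewrite h2; ring.
by symmetry in h1; ring: h1.
Qed.

Lemma line_cut_curve l n x1 x2 x3 : line_cut l n x1 x2 x3 ->
  on_curve (Some (x1, l * x1 + n)).
Proof.
move=> h; apply/eqP; have := line_cutP h x1; rewrite subrr !mul0r.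
by move/eqP; rewrite subr_eq0 => /eqP <-.
Qed.

Lemma line_cut12 l n x1 x2 x3 : line_cut l n x1 x2 x3 -> line_cut l n x2 x1 x3.
Proof. by case=> h1 h2 h3; split; [rewrite -h1|rewrite -h2|rewrite -h3]; ring. Qed.

Lemma line_cut13 l n x1 x2 x3 : line_cut l n x1 x2 x3 -> line_cut l n x3 x2 x1.
Proof. by case=> h1 h2 h3; split; [rewrite -h1|rewrite -h2|rewrite -h3]; ring. Qed.

Lemma nonsingular x : x ^+ 3 + a * x + b = 0 -> 3%:R * x ^+ 2 + a = 0 -> False.
Proof.
move=> h1 h2; move/eqP: disc_neq0; apply.
have ea : a = - (3%:R * x ^+ 2) by apply/eqP; rewrite -addr_eq0 addrC h2.
have -> : b = 2%:R * x ^+ 3 by apply/eqP; rewrite -subr_eq0 -h1 ea; apply/eqP; ring.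
by rewrite ea; ring.
Qed.

Lemma double_root x y : D * y ^+ 2 = x ^+ 3 + a * x + b -> 3%:R * x ^+ 2 + a = 0 -> y != 0.
Proof.
move=> h1 h2; apply/eqP => y0; apply: (nonsingular _ h2 (x := x)).
by rewrite -h1 y0 expr0n mulr0.
Qed.

Lemma add_line l n x1 x2 x3 : line_cut l n x1 x2 x3 ->
  add_pt (Some (x1, l * x1 + n)) (Some (x2, l * x2 + n)) =
  Some (x3, - (l * x3 + n)).
Proof.
move=> h; have [h1 h2 h3] := h; rewrite /add_pt /slope.
have [e|x12 /=] := eqVneq x1 x2; last first.
  have -> : (l * x1 + n - (l * x2 + n)) / (x1 - x2) = l.
    by field; rewrite subr_eq0.
  have -> : D * l ^+ 2 - x1 - x2 = x3 by rewrite -h1; ring.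
  by congr (Some (_, _)); ring.
subst x2; set y := l * x1 + n.
have tgt : 3%:R * x1 ^+ 2 + a = 2%:R * D * l * y.
  rewrite /y.
  have -> : a = x1 * x1 + x1 * x3 + x1 * x3 + 2%:R * D * l * n by rewrite h2; ring.
  by symmetry in h1; have -> : x3 = (x1 + x1 + x3) - x1 - x1; [ring | rewrite -h1; ring].
have y0 : y != 0.
  apply/eqP => y0; have /eqP := line_cut_curve h; rewrite -/y y0 => hc.
  by apply: (nonsingular (x := x1)); [rewrite -hc expr0n mulr0|rewrite tgt y0 mulr0].
have -> /= : (y == - y) = false.
  apply/negbTE; rewrite -subr_eq0 opprK -mulr2n -mulr_natl mulf_eq0 negb_or.
  by rewrite two_neq0.
have -> : (3%:R * x1 ^+ 2 + a) / (2%:R * D * y) = l.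
  by rewrite tgt; field; rewrite y0 D_neq0.
have -> : D * l ^+ 2 - x1 - x1 = x3 by rewrite -h1; ring.
by congr (Some (_, _)); rewrite /y; ring.
Qed.

Lemma add_opp P : add_pt P (opp_pt P) = None.
Proof. by case: P => [[x y]|] //=; rewrite eqxx opprK eqxx. Qed.

Lemma opp_ptK : involutive opp_pt.
Proof. by case=> [[x y]|] //=; rewrite opprK. Qed.

Lemma add_pt0 P : add_pt P None = P. Proof. by case: P => [[]|]. Qed.

Lemma on_curve_opp P : on_curve P -> on_curve (opp_pt P).
Proof. by case: P => [[x y]|] //=; rewrite sqrrN. Qed.

Lemma line_exists x1 y1 x2 y2 :
  on_curve (Some (x1, y1)) -> on_curve (Some (x2, y2)) ->
  Some (x1, y1) != opp_pt (Some (x2, y2)) ->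
  exists l n x3, [/\ line_cut l n x1 x2 x3, y1 = l * x1 + n & y2 = l * x2 + n].
Proof.
move=> /= /eqP h1 /eqP h2 h12.
have [e|x12] := eqVneq x1 x2; last first.
  have d12 : x1 - x2 != 0 by rewrite subr_eq0.
  set l := (y1 - y2) / (x1 - x2); pose n := y1 - l * x1.
  have ey2 : y2 = l * x2 + n by rewrite /n /l; field.
  have ey1 : y1 = l * x1 + n by rewrite /n; ring.
  exists l, n, (D * l ^+ 2 - x1 - x2); split=> //.
  have key : x1 ^+ 2 + x1 * x2 + x2 ^+ 2 + a = D * l * (l * (x1 + x2) + 2%:R * n).
    apply: (mulfI d12).
    have -> : (x1 - x2) * (D * l * (l * (x1 + x2) + 2%:R * n))
      = D * (l * x1 + n) ^+ 2 - D * (l * x2 + n) ^+ 2 by ring.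
    by rewrite -ey1 -ey2 h1 h2; ring.
  rewrite /line_cut; have -> : b = D * (l * x1 + n) ^+ 2 - x1 ^+ 3 - a * x1 by rewrite -ey1 h1; ring.
  have -> : a = D * l * (l * (x1 + x2) + 2%:R * n) - (x1 ^+ 2 + x1 * x2 + x2 ^+ 2).
    by rewrite -key; ring.
  by split; ring.
subst x2.
have ey : y2 = y1.
  have : (y1 - y2) * (y1 + y2) == 0.
    rewrite -subr_sqr -(inj_eq (mulfI D_neq0)) mulr0 mulrBr h1 h2 subrr; exact/eqP.
  rewrite mulf_eq0 => /orP[|]; rewrite ?subr_eq0 ?addr_eq0 => /eqP // e.
  by move: h12; rewrite e eqxx.
subst y2.
have y0 : y1 != 0.
  by apply: contraNneq h12 => ->; rewrite oppr0 eqxx.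
set l := (3%:R * x1 ^+ 2 + a) / (2%:R * D * y1); pose n := y1 - l * x1.
have tgt : 2%:R * D * l * y1 = 3%:R * x1 ^+ 2 + a.
  by rewrite /l; field; rewrite y0 D_neq0.
exists l, n, (D * l ^+ 2 - x1 - x1); split; rewrite /n; try ring.
rewrite /line_cut; have -> : b = D * y1 ^+ 2 - x1 ^+ 3 - a * x1 by rewrite h1; ring.
have -> : a = 2%:R * D * l * y1 - 3%:R * x1 ^+ 2 by rewrite tgt; ring.
by split; ring.
Qed.

(** Case analysis on a sum in which chord and tangent are one case. *)
Variant add_spec : option (L * L) -> option (L * L) -> option (L * L) -> Prop :=
| Add0l P : on_curve P -> add_spec None P P
| Add0r P : on_curve P -> add_spec P None P
| AddN P : on_curve P -> add_spec P (opp_pt P) None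
| AddLine l n x1 x2 x3 : line_cut l n x1 x2 x3 ->
    add_spec (Some (x1, l * x1 + n)) (Some (x2, l * x2 + n))
      (Some (x3, - (l * x3 + n))).

Lemma addP P Q : on_curve P -> on_curve Q -> add_spec P Q (add_pt P Q).
Proof.
case: P => [[x1 y1]|]; last by move=> _ h; exact: Add0l.
case: Q => [[x2 y2]|]; last by move=> h _; exact: Add0r.
move=> hP hQ; have [e|ne] := eqVneq (Some (x1, y1)) (opp_pt (Some (x2, y2))).
  have e2 : Some (x2, y2) = opp_pt (Some (x1, y1)) by rewrite e opp_ptK.
  by rewrite e2 add_opp; exact: AddN.
have [l [n [x3 [hc -> ->]]]] := line_exists hP hQ ne.
by rewrite (add_line hc); exact: AddLine.
Qed.

Lemma on_curve_add P Q : on_curve P -> on_curve Q -> on_curve (add_pt P Q).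
Proof.
move=> hP hQ; case: (addP hP hQ) => // l n x1 x2 x3 h /=.
by rewrite sqrrN; exact: (line_cut_curve (line_cut13 h)).
Qed.

Lemma add_ptC P Q : on_curve P -> on_curve Q -> add_pt P Q = add_pt Q P.
Proof.
move=> hP hQ; case: (addP hP hQ) => [R _|R _|R _|l n x1 x2 x3 h].
- by rewrite add_pt0.
- by [].
- by rewrite -{2}(opp_ptK R) add_opp.
- by rewrite (add_line (line_cut12 h)).
Qed.

Lemma line_cutN l n x1 x2 x3 : line_cut l n x1 x2 x3 -> line_cut (- l) (- n) x1 x2 x3.
Proof. by case=> h1 h2 h3; split; rewrite ?h1 ?h2 ?h3; ring. Qed.

Lemma opp_add P Q : on_curve P -> on_curve Q ->
  opp_pt (add_pt P Q) = add_pt (opp_pt P) (opp_pt Q).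
Proof.
move=> hP hQ; case: (addP hP hQ) => [R _|R _|R _|l n x1 x2 x3 h] //.
- by rewrite add_pt0.
- by rewrite add_opp.
have := add_line (line_cutN h); rewrite !mulNr -!opprD => e.
by rewrite /opp_pt e.
Qed.

Lemma add_ptK P Q : on_curve P -> on_curve Q ->
  add_pt (add_pt P Q) (opp_pt Q) = P.
Proof.
move=> hP hQ; case: (addP hP hQ) => [R _|R _|R _|l n x1 x2 x3 h].
- exact: add_opp.
- by rewrite add_pt0.
- by rewrite opp_ptK.
have := add_line (line_cut13 h) => e.
have hS := line_cut_curve (line_cut13 h).
have hQ2 := line_cut_curve (line_cut12 h).
have := opp_add hS hQ2; rewrite e /= opprK => <- //.
Qed.

Lemma add_ptI Q P1 P2 : on_curve Q -> on_curve P1 -> on_curve P2 ->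
  add_pt P1 Q = add_pt P2 Q -> P1 = P2.
Proof. by move=> hQ h1 h2 e; rewrite -(add_ptK h1 hQ) e add_ptK. Qed.

Lemma add_chord x1 y1 x2 y2 : x1 != x2 ->
  let l := (y1 - y2) / (x1 - x2) in
  let x3 := D * l ^+ 2 - x1 - x2 in
  add_pt (Some (x1, y1)) (Some (x2, y2)) = Some (x3, l * (x1 - x3) - y1).
Proof. by move=> h; rewrite /add_pt /slope (negbTE h). Qed.

Lemma same_x x y1 y2 : on_curve (Some (x, y1)) -> on_curve (Some (x, y2)) ->
  Some (x, y1) = Some (x, y2) \/ Some (x, y1) = opp_pt (Some (x, y2)).
Proof.
move=> /= /eqP h1 /eqP h2.
have : (y1 - y2) * (y1 + y2) == 0.
  rewrite -subr_sqr -(inj_eq (mulfI D_neq0)) mulr0 mulrBr h1 h2 subrr; exact/eqP.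
by rewrite mulf_eq0 subr_eq0 addr_eq0 => /orP[] /eqP ->; [left|right].
Qed.

Lemma neq_x x1 y1 x2 y2 : on_curve (Some (x1, y1)) -> on_curve (Some (x2, y2)) ->
  Some (x1, y1) != Some (x2, y2) -> Some (x1, y1) != opp_pt (Some (x2, y2)) ->
  x1 != x2.
Proof.
move=> h1 h2 n1 n2; apply/eqP => e; subst x2.
by case: (same_x h1 h2) => e; move: n1 n2; rewrite e eqxx.
Qed.

(** The identity needs only the slope of the line through P1 and P2, so that
    P1 = P2 is allowed. *)
Lemma chord_assoc x1 y1 x2 y2 x3 y3 :
  let P1 := Some (x1, y1) in let P2 := Some (x2, y2) in let P3 := Some (x3, y3) in
  on_curve P1 -> on_curve P2 -> on_curve P3 ->
  P1 != opp_pt P2 -> x2 != x3 -> x1 != x3 ->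
  (forall y, add_pt P1 P2 <> Some (x3, y)) ->
  (forall y, add_pt P2 P3 <> Some (x1, y)) ->
  add_pt (add_pt P1 P2) P3 = add_pt P1 (add_pt P2 P3).
Proof.
move=> P1 P2 P3 c1 c2 c3 h12 h23 h13.
have [l [n [x4 [hl ey1 ey2]]]] := line_exists c1 c2 h12.
have h23' : P2 != opp_pt P3 by apply: contraNneq h23 => -[->].
have [m [k [x5 [hm ey2' ey3]]]] := line_exists c2 c3 h23'.
have [hl1 _ _] := hl; have [hm1 _ _] := hm.
have e4 : add_pt P1 P2 = Some (x4, l * (x2 - x4) - y2).
  rewrite /P1 /P2 {1}ey1 ey2 (add_line hl); congr (Some (_, _)); ring.
have e5 : add_pt P2 P3 = Some (x5, m * (x2 - x5) - y2).
  rewrite /P2 /P3 {1}ey2' ey3 (add_line hm) ey2'; congr (Some (_, _)); ring.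
move=> n43 n15.
have {n43} h43 : x4 != x3.
  by apply/eqP => e; apply: (n43 (l * (x2 - x4) - y2)); rewrite e4 -e.
have {n15} h15 : x1 != x5.
  by apply/eqP => e; apply: (n15 (m * (x2 - x5) - y2)); rewrite e5 -e.
rewrite e4 e5 (add_chord _ _ h43) (add_chord _ _ h15).
pose p := x1 - x2; pose q := x2 - x3.
have d13 : p + q != 0 by rewrite /p /q addrA subrK subr_eq0.
have hx1 : x1 = x2 + p by rewrite /p addrC subrK.
have hx3 : x3 = x2 - q by rewrite /q opprB addrC subrK.
have hy1 : y1 = y2 + l * p by rewrite ey1 ey2 /p; ring.
have hy3 : y3 = y2 - m * q by rewrite ey3 ey2' /q; ring.
pose e := D * (l * (2%:R * y2 + l * p) - m * (2%:R * y2 - m * q)) / (p + q).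
have he : e = x1 + x2 + x3.
  have hc := line_cutP hl x3; move/eqP: c3 => c3.
  rewrite -c3 hy3 hx3 in hc.
  have en : n = y2 - l * x2 by rewrite ey2; ring.
  have ex4 : x4 = D * l ^+ 2 - x1 - x2 by rewrite -hl1; ring.
  have hq : q != 0 by rewrite subr_eq0.
  rewrite en ex4 hx1 in hc.
  rewrite /e; apply: (mulIf d13); rewrite mulfVK //; apply: (mulIf hq).
  rewrite hx1 hx3.
  apply/eqP; rewrite -subr_eq0; move/eqP: hc; rewrite -subr_eq0 => /eqP hc.
  by apply/eqP; rewrite -hc; ring.
have e4' : x4 = D * l ^+ 2 - e + (x2 - q) by rewrite -hl1 he hx3; ring.
have e5' : x5 = D * m ^+ 2 - e + (x2 + p) by rewrite -hm1 he hx1; ring.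
move: h43 h15; rewrite -[x4 == _]subr_eq0 -[x1 == _]subr_eq0 hx1 hx3 hy1 hy3 e4' e5' => h43 h15.
have ex := chord_assoc_x d13 h43 h15; have ey := chord_assoc_y d13 h43 h15.
rewrite -ex; congr (Some (_, _)); move: ey.
have -> : forall u, u - e + (x2 + p) + x2 - (D * l ^+ 2 - e + (x2 - q)) =
    u - (D * l ^+ 2 - e + (x2 - q)) - (x2 - q); last exact.
by move=> u; rewrite he hx1 hx3; ring.
Qed.

(** The values of G for which some addition in (P + Q) + G = P + (Q + G)
    may fail to be a chord. *)
Definition collisions (P Q : option (L * L)) :=
  [:: None; P; opp_pt P; Q; opp_pt Q; add_pt P Q; opp_pt (add_pt P Q);
     add_pt P (opp_pt Q); add_pt (opp_pt P) (opp_pt Q)].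

Lemma add_translate P Q G : on_curve P -> on_curve Q -> on_curve G ->
  G \notin collisions P Q ->
  add_pt (add_pt P Q) G = add_pt P (add_pt Q G).
Proof.
move=> cP cQ cG; rewrite !inE !negb_or => /and5P[nO nP nP' nQ /and5P[nQ' nS nS' nD nD']].
case: P => [[x1 y1]|] // in cP nP nP' nS nS' nD nD' *.
case: Q => [[x2 y2]|] // in cQ nQ nQ' nS nS' nD nD' *.
case: G => [[x3 y3]|] // in cG nO nP nP' nQ nQ' nS nS' nD nD' *.
set P1 := Some (x1, y1); set P2 := Some (x2, y2); set P3 := Some (x3, y3).
have [e|ne] := eqVneq P1 (opp_pt P2).
  rewrite -/P1 -/P2 -/P3 e [add_pt (opp_pt P2) P2]add_ptC ?on_curve_opp // add_opp.
  rewrite [RHS]add_ptC ?on_curve_opp ?on_curve_add // (add_ptC cQ cG).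
  by rewrite add_ptK.
apply: chord_assoc => //.
- by rewrite eq_sym; apply: (neq_x cG cQ).
- by rewrite eq_sym; apply: (neq_x cG cP).
- move=> y e; have := on_curve_add cP cQ; rewrite e => cS.
  by case: (same_x cG cS) => e'; move: nS nS'; rewrite e e' eqxx.
move=> y e; have := on_curve_add cQ cG; rewrite e => cS.
case: (same_x cS cP) => e'.
  by move: nD; rewrite -e' -e [add_pt P2 P3]add_ptC // add_ptK ?eqxx.
by move: nD'; rewrite -e' -e [add_pt P2 P3]add_ptC // add_ptK ?eqxx.
Qed.


(** A homogeneous abscissa, [1 : 0] at the origin. *)
Definition proj_x (P : option (L * L)) (X Z : L) : Prop :=
  if P is Some (x, _) then Z != 0 /\ X = x * Z else X != 0 /\ Z = 0.

(** Both triples list the symmetric functions of the abscissas of P + Q and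
    P - Q, up to a factor. As any entry may vanish, proportionality is stated
    by cross products. *)
Lemma kummer_aux P Q X1 Z1 X2 Z2 Xp Zp Xm Zm :
  on_curve P -> on_curve Q -> proj_x P X1 Z1 -> proj_x Q X2 Z2 ->
  proj_x (add_pt P Q) Xp Zp -> proj_x (add_pt P (opp_pt Q)) Xm Zm ->
  [/\ Zp * Zm * kum1 a b X1 Z1 X2 Z2 = (Xp * Zm + Xm * Zp) * kum0 X1 Z1 X2 Z2,
      Zp * Zm * kum2 a b X1 Z1 X2 Z2 = Xp * Xm * kum0 X1 Z1 X2 Z2
    & (Xp * Zm + Xm * Zp) * kum2 a b X1 Z1 X2 Z2 = Xp * Xm * kum1 a b X1 Z1 X2 Z2].
Proof.
case: P => [[x1 y1]|]; last first.
  case: Q => [[x2 y2]|] _ _ [h1 ->] [h2 ->] [h3 ->] [h4 ->];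
    by rewrite /kum0 /kum1 /kum2; split; ring.
case: Q => [[x2 y2]|]; last first.
  move=> _ _ [h1 ->] [h2 ->] [h3 ->] [h4 ->].
  by rewrite /kum0 /kum1 /kum2; split; ring.
move=> cP cQ [h1 ->] [h2 ->].
have [e|x12] := eqVneq x1 x2; last first.
  rewrite [opp_pt _]/= (add_chord y1 y2 x12) (add_chord y1 (- y2) x12).
  move=> [h3 ->] [h4 ->]; rewrite /kum0 /kum1 /kum2.
  move: cP cQ => /eqP cP /eqP cQ.
  have d12 : x1 - x2 != 0 by rewrite subr_eq0.
  have ea : a = (D * y1 ^+ 2 - D * y2 ^+ 2 - (x1 ^+ 3 - x2 ^+ 3)) / (x1 - x2).
    by apply: (mulIf d12); rewrite mulfVK // mulrBr cP cQ; ring.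
  have eb : b = D * y1 ^+ 2 - x1 ^+ 3 - a * x1 by rewrite cP; ring.
  by rewrite eb ea; split; field.
subst x2.
have eD : D * y1 ^+ 2 = x1 ^+ 3 + a * x1 + b by apply/eqP.
have dbl X Z X' Z' : proj_x (add_pt (Some (x1, y1)) (Some (x1, y1))) X Z ->
  proj_x None X' Z' ->
  [/\ Z * Z' * kum1 a b (x1 * Z1) Z1 (x1 * Z2) Z2 = (X * Z' + X' * Z) * kum0 (x1 * Z1) Z1 (x1 * Z2) Z2,
      Z * Z' * kum2 a b (x1 * Z1) Z1 (x1 * Z2) Z2 = X * X' * kum0 (x1 * Z1) Z1 (x1 * Z2) Z2
    & (X * Z' + X' * Z) * kum2 a b (x1 * Z1) Z1 (x1 * Z2) Z2 = X * X' * kum1 a b (x1 * Z1) Z1 (x1 * Z2) Z2].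
  move=> h [n ->].
  have -> : kum0 (x1 * Z1) Z1 (x1 * Z2) Z2 = 0 by rewrite /kum0; ring.
  rewrite !mulr0 !mul0r add0r; split=> //.
  have eqN : (y1 == - y1) = (y1 == 0).
    by rewrite -addr_eq0 -mulr2n -(mulr_natl y1) mulf_eq0 (negbTE two_neq0).
  move: h; rewrite /add_pt /slope eqxx eqN /=.
  have -> : kum1 a b (x1 * Z1) Z1 (x1 * Z2) Z2 = (Z1 * Z2) ^+ 2 * (4%:R * (D * y1 ^+ 2)).
    by rewrite eD /kum1; ring.
  have [->|y0] := eqVneq y1 0; first by case=> _ ->; ring.
  case=> _ ->.
  have eb : b = D * y1 ^+ 2 - x1 ^+ 3 - a * x1 by rewrite eD; ring.
  by rewrite /kum2 eb; field; rewrite y0 D_neq0 two_neq0.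
case: (same_x cP cQ) => e hp hm.
  apply: dbl; first by move: hp; rewrite -e.
  by move: hm; rewrite -e add_opp.
rewrite [Xp * Zm + _]addrC ![Xp * Xm]mulrC ![Zp * Zm]mulrC; apply: dbl.
  by move: hm; rewrite -e.
by move: hp; rewrite -[Some (x1, y2)]opp_ptK -e add_opp.
Qed.

Section Derivation.
Variable der : L -> L.
Hypotheses (derD : forall x y, der (x + y) = der x + der y)
  (derM : forall x y, der (x * y) = der x * y + x * der y)
  (der_a : der a = 0) (der_b : der b = 0).

(** The value c of the invariant differential dx / y along the point. Where
    y = 0 the first equation does not determine c, and the second one does; it
    is the derivative of the equation of the curve, divided by y. *)
Definition has_rate (P : option (L * L)) (c : L) : Prop :=
  if P is Some (x, y) then
    der x = c * y /\ 2%:R * D * der y = (3%:R * x ^+ 2 + a) * c - der D * y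
  else c = 0.

Lemma der0 : der 0 = 0.
Proof. by apply: (addrI (der 0)); rewrite -derD !addr0. Qed.
Lemma derN x : der (- x) = - der x.
Proof. by apply: (addrI (der x)); rewrite -derD !subrr der0. Qed.
Lemma derX2 x : der (x ^+ 2) = 2%:R * x * der x.
Proof. by rewrite expr2 derM; ring. Qed.
Lemma derX3 x : der (x ^+ 3) = 3%:R * x ^+ 2 * der x.
Proof. by rewrite exprS derM derX2; ring. Qed.
Lemma der_nat n : der n%:R = 0.
Proof.
have d1 : der 1 = 0.
  have := derM 1 1; rewrite !mulr1 mul1r => e.
  by apply: (addrI (der 1)); rewrite -e addr0.
by elim: n => [|n IH]; rewrite ?der0 // -natr1 derD IH d1 addr0.
Qed.
Lemma der_div x y : y != 0 -> der (x / y) = (der x * y - x * der y) / y ^+ 2.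
Proof.
move=> y0; have : der (x / y * y) = der x by rewrite mulfVK.
by rewrite derM => h; apply: (mulIf y0); rewrite -h; field.
Qed.

Lemma has_rate_uniq P c c' : on_curve P -> has_rate P c -> has_rate P c' -> c = c'.
Proof.
case: P => [[x y]|] cP /=; last by move=> -> ->.
move=> [h1 h2] [h1' h2'].
have [y0|y0] := eqVneq y 0; last first.
  by apply: (mulIf y0); rewrite -h1 -h1'.
have : (3%:R * x ^+ 2 + a) * c = (3%:R * x ^+ 2 + a) * c'.
  by apply/(addIr (- (der D * y))); rewrite -h2 -h2'.
apply: mulfI; apply/eqP => e; move/eqP: cP => cP.
by have /eqP[] := double_root cP e.
Qed.

Lemma has_rate_opp P c : has_rate P c -> has_rate (opp_pt P) (- c).
Proof.
case: P => [[x y]|] /=; last by move=> ->; rewrite oppr0.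
by move=> [h1 h2]; rewrite derN mulrNN; split=> //; rewrite mulrN h2; ring.
Qed.

(** The differential dx / y is invariant under translations. The computation
    starts with the derivative of the slope: for a chord it comes from the two
    ordinates, for a tangent from differentiating the equation of the slope. *)
Lemma has_rate_add P Q c d : on_curve P -> on_curve Q ->
  has_rate P c -> has_rate Q d -> has_rate (add_pt P Q) (c + d).
Proof.
move=> cP cQ; case: (addP cP cQ) => [R hR|R hR|R hR|l n x1 x2 x3 h].
- by move=> /= ->; rewrite add0r.
- by move=> hc /= ->; rewrite addr0.
- move=> hc hd /=; have := has_rate_opp hc => hc'.
  by rewrite -(has_rate_uniq (on_curve_opp hR) hc' hd) subrr.
move=> hP hQ; have [hx1 hy1] := hP; have [hx2 hy2] := hQ.
set y1 := l * x1 + n in hP hx1 hy1; set y2 := l * x2 + n in hQ hx2 hy2.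
have [h1 h2 h3] := h.
have ea : a = x1 * x2 + x1 * x3 + x2 * x3 + 2%:R * D * l * n by rewrite h2; ring.
have ex3 : x3 = D * l ^+ 2 - x1 - x2 by rewrite -h1; ring.
have f1 : 3%:R * x1 ^+ 2 + a = 2%:R * D * l * y1 + (x1 - x2) * (x1 - x3).
  by rewrite ea ex3 /y1; ring.
have f2 : 3%:R * x2 ^+ 2 + a = 2%:R * D * l * y2 + (x2 - x1) * (x2 - x3).
  by rewrite ea ex3 /y2; ring.
have f3 : 3%:R * x3 ^+ 2 + a = 2%:R * D * l * (l * x3 + n) + (x3 - x1) * (x3 - x2).
  by rewrite ea ex3; ring.
have dl : 2%:R * D * der l = c * (x1 - x3) + d * (x2 - x3) - der D * l.
  have [e|x12] := eqVneq x1 x2; last first.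
    have d12 : x1 - x2 != 0 by rewrite subr_eq0.
    have el : l * (x1 - x2) = y1 - y2 by rewrite /y1 /y2; ring.
    have e1 : der l * (x1 - x2) + l * (der x1 - der x2) = der y1 - der y2.
      by rewrite -(derN x2) -(derN y2) -(derD x1) -derM el -derD.
    rewrite hx1 hx2 in e1.
    apply: (mulIf d12).
    have -> : 2%:R * D * der l * (x1 - x2) = 2%:R * D * (der l * (x1 - x2)) by ring.
    have -> : der l * (x1 - x2) = der y1 - der y2 - l * (c * y1 - d * y2) by rewrite -e1; ring.
    rewrite mulrBr [2%:R * D * (_ - der y2)]mulrBr hy1 hy2 f1 f2.
    have -> : y1 = y2 + l * (x1 - x2) by rewrite el; ring.
    by ring.
  subst x2.
  have <- : c = d by exact: (has_rate_uniq (line_cut_curve h) hP hQ).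
  have y0 : y1 != 0.
    apply/eqP => y0; have /eqP c1 := line_cut_curve h.
    have e0 : 3%:R * x1 ^+ 2 + a = 0 by rewrite f1 y0; ring.
    by have /eqP[] := double_root c1 e0.
  have := f1; rewrite subrr mul0r addr0 => f1'.
  have := congr1 der f1'; rewrite derD der_a addr0 derM derX2 hx1 [RHS]derM (derM _ l) (derM _ D).
  rewrite (der_nat 2) (der_nat 3) => e1.
  apply: (mulIf y0).
  have -> : 2%:R * D * der l * y1 = 6%:R * x1 * (c * y1) - 2%:R * l * der D * y1
      - l * (2%:R * D * der y1).
    have -> : 6%:R * x1 * (c * y1) = 0 * x1 ^+ 2 + 3%:R * (2%:R * x1 * (c * y1)) by ring.
    by rewrite e1; ring.
  by rewrite hy1 f1' ex3; ring.
have dx3 : der x3 = - (c + d) * (l * x3 + n).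
  rewrite ex3 !derD !derN derM derX2 hx1 hx2.
  have -> : D * (2%:R * l * der l) = l * (2%:R * D * der l) by ring.
  by rewrite dl ex3 /y1 /y2; ring.
split; first by rewrite dx3; ring.
have -> : l * x3 + n = y1 + l * (x3 - x1) by rewrite /y1; ring.
rewrite derN derD derM derD derN hx1 dx3.
have -> : 2%:R * D * - (der y1 + (der l * (x3 - x1) + l * (- (c + d) * (l * x3 + n) - c * y1)))
  = - (2%:R * D * der y1) - 2%:R * D * der l * (x3 - x1)
    - 2%:R * D * l * (- (c + d) * (l * x3 + n) - c * y1) by ring.
by rewrite hy1 dl f1 f3 /y1; ring.
Qed.
End Derivation.

Hypothesis many_points : forall s : seq (option (L * L)),
  exists2 G, on_curve G & G \notin s.

(** Some G avoids the collisions of all the sums that occur, and then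
    P + Q + R + G can be rebracketed one generic step at a time. *)
Lemma add_ptA P Q R : on_curve P -> on_curve Q -> on_curve R ->
  add_pt (add_pt P Q) R = add_pt P (add_pt Q R).
Proof.
move=> cP cQ cR.
have [G cG] := many_points (collisions (add_pt P Q) R ++ collisions Q R ++ collisions P (add_pt Q R)
   ++ [seq add_pt T (opp_pt R) | T <- collisions P Q]).
rewrite !mem_cat 3!negb_or => /and4P[n1 n2 n3 n4].
have nRG : add_pt R G \notin collisions P Q.
  apply/negP => h; move/negP: n4; apply; apply/mapP; exists (add_pt R G) => //.
  by rewrite (add_ptC cR cG) add_ptK.
have cPQ := on_curve_add cP cQ; have cQR := on_curve_add cQ cR.
apply: (add_ptI cG); rewrite ?on_curve_add //.
rewrite add_translate // add_translate ?on_curve_add //.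
by rewrite -(add_translate cQ cR cG n2) -add_translate.
Qed.

End GroupLaw.

(** * Coprime triples of polynomials *)

Section Triples.
Variable F : fieldType.
Implicit Types (p q r g v w : {poly F}).

Definition prim3 p q r := forall g, g %| p -> g %| q -> g %| r -> size g = 1%N.

Lemma prim3_prop_aux v0 v1 v2 w0 w1 w2 : prim3 v0 v1 v2 -> prim3 w0 w1 w2 ->
  v0 != 0 -> v0 * w1 = v1 * w0 -> v0 * w2 = v2 * w0 ->
  exists2 c, c != 0 & [/\ w0 = c *: v0, w1 = c *: v1 & w2 = c *: v2].
Proof.
move=> hv hw v00 e1 e2.
have w00 : w0 != 0.
  apply/eqP => w00; move: e1 e2; rewrite w00 !mulr0 => /eqP e1 /eqP e2.
  move: e1 e2; rewrite !mulf_eq0 (negbTE v00) /= => /eqP e1 /eqP e2.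
  by have := hw 0; rewrite w00 e1 e2 dvdpp size_poly0 => /(_ isT isT isT).
pose d := gcdp v0 w0; pose v' := v0 %/ d; pose w' := w0 %/ d.
have ev : v0 = v' * d by rewrite divpK ?dvdp_gcdl.
have ew : w0 = w' * d by rewrite divpK ?dvdp_gcdr.
have cvw : coprimep v' w' by rewrite coprimep_div_gcd ?v00.
have cwv : coprimep w' v' by rewrite coprimep_sym.
have d0 : d != 0 by apply: contraNneq v00 => d0; rewrite ev d0 mulr0.
have e1' : v' * w1 = v1 * w' by apply: (mulIf d0); rewrite mulrAC -ev e1 ew mulrA.
have e2' : v' * w2 = v2 * w' by apply: (mulIf d0); rewrite mulrAC -ev e2 ew mulrA.
have sw : size w' = 1%N.
  apply: hw; first by rewrite ew dvdp_mulr.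
    by rewrite -(Gauss_dvdpr _ cwv) e1' dvdp_mulIr.
  by rewrite -(Gauss_dvdpr _ cwv) e2' dvdp_mulIr.
have sv : size v' = 1%N.
  apply: hv; first by rewrite ev dvdp_mulr.
    by rewrite -(Gauss_dvdpl _ cvw) -e1' dvdp_mulr.
  by rewrite -(Gauss_dvdpl _ cvw) -e2' dvdp_mulr.
have /size_poly1P[cv cv0 evc] : size v' == 1%N by rewrite sv.
have /size_poly1P[cw cw0 ewc] : size w' == 1%N by rewrite sw.
exists (cw / cv); first by rewrite mulf_neq0 ?invr_neq0.
have key u : cv%:P * u = cw%:P * (cv / cw *: u).
  by rewrite !mul_polyC scalerA mulrCA divff ?mulr1.
split.
- rewrite ew ev ewc evc !mul_polyC scalerA mulfVK //.
- apply: (mulfI (_ : v' != 0)); first by rewrite -size_poly_eq0 sv.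
  by rewrite e1' evc ewc mulrC !mul_polyC scalerA mulrCA divff ?mulr1.
- apply: (mulfI (_ : v' != 0)); first by rewrite -size_poly_eq0 sv.
  by rewrite e2' evc ewc mulrC !mul_polyC scalerA mulrCA divff ?mulr1.
Qed.

(** A projective point over F(t) has only one coprime polynomial
    representative up to constants. *)
Lemma prim3_prop v0 v1 v2 w0 w1 w2 : prim3 v0 v1 v2 -> prim3 w0 w1 w2 ->
  v0 * w1 = v1 * w0 -> v0 * w2 = v2 * w0 -> v1 * w2 = v2 * w1 ->
  exists2 c, c != 0 & [/\ w0 = c *: v0, w1 = c *: v1 & w2 = c *: v2].
Proof.
move=> hv hw e01 e02 e12.
have [v00|n0] := eqVneq v0 0; last exact: prim3_prop_aux.
have perm p q r : prim3 p q r -> prim3 q p r by move=> h g g1 g2 g3; apply: h.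
have rot p q r : prim3 p q r -> prim3 r p q by move=> h g g1 g2 g3; apply: h.
have [v10|n1] := eqVneq v1 0; last first.
  have [c c0 [h1 h2 h3]] :=
    prim3_prop_aux (perm _ _ _ hv) (perm _ _ _ hw) n1 (esym e01) e12.
  by exists c.
have n2 : v2 != 0.
  apply/eqP => v20; have := hv 0; rewrite v00 v10 v20 dvdpp size_poly0.
  by move=> /(_ isT isT isT).
have [c c0 [h1 h2 h3]] :=
  prim3_prop_aux (rot _ _ _ hv) (rot _ _ _ hw) n2 (esym e02) (esym e12).
by exists c.
Qed.

(** The formal degree n may exceed the actual one: of the polynomials that
    represent a projective point, only one has to reach the common degree. *)
Definition top n p (c : F) := (size p <= n.+1)%N /\ p`_n = c.

Lemma topM n m p q c d : top n p c -> top m q d -> top (n + m)%N (p * q) (c * d).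
Proof.
move=> [hp <-] [hq <-]; split.
  rewrite (leq_trans (size_polyMleq _ _)) // -subn1 leq_subLR add1n -addnS -addSn.
  exact: leq_add.
rewrite coefM (bigD1 (inord n)) //= inordK ?ltnS ?leq_addr // addKn.
rewrite big1 ?addr0 // => i ne.
have [lt|gt|e] := ltngtP i n; last by case/eqP: ne; apply/val_inj; rewrite /= inordK ?ltnS ?leq_addr.
  rewrite [q`__]nth_default ?mulr0 // (leq_trans hq) // ltn_subRL addnC.
  by rewrite addnC ltn_add2r.
by rewrite nth_default ?mul0r // (leq_trans hp).
Qed.
Lemma topD n p q c d : top n p c -> top n q d -> top n (p + q) (c + d).
Proof.
move=> [hp <-] [hq <-]; split; last by rewrite coefD.
by rewrite (leq_trans (size_polyD _ _)) // geq_max hp.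
Qed.
Lemma topN n p c : top n p c -> top n (- p) (- c).
Proof. by move=> [hp <-]; rewrite /top size_polyN coefN. Qed.
Lemma topC c : top 0 c%:P c.
Proof. by rewrite /top coefC size_polyC; split=> //; case: (c != 0). Qed.
Lemma topX n m p c : top n p c -> top (n * m)%N (p ^+ m) (c ^+ m).
Proof.
move=> h; elim: m => [|m IH]; first by rewrite muln0 !expr0; exact: topC 1.
by rewrite mulnS !exprS; exact: topM.
Qed.

(** The top coefficient is multiplicative, hence commutes with the forms. *)
Lemma top_kum a b n1 n2 X1 Z1 X2 Z2 x1 z1 x2 z2 :
  top n1 X1 x1 -> top n1 Z1 z1 -> top n2 X2 x2 -> top n2 Z2 z2 ->
  [/\ top ((n1 + n2) * 2)%N (kum0 X1 Z1 X2 Z2) (kum0 x1 z1 x2 z2),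
      top ((n1 + n2) * 2)%N (kum1 a%:P b%:P X1 Z1 X2 Z2) (kum1 a b x1 z1 x2 z2)
    & top ((n1 + n2) * 2)%N (kum2 a%:P b%:P X1 Z1 X2 Z2) (kum2 a b x1 z1 x2 z2)].
Proof.
move=> hX1 hZ1 hX2 hZ2.
have XZ := topM hX1 hZ2; have ZX := topM hX2 hZ1; have ZZ := topM hZ1 hZ2.
have XX := topM hX1 hX2; rewrite [(n2 + n1)%N]addnC in ZX.
have tC (m : nat) : top 0 (m%:R : {poly F}) m%:R by rewrite -polyC_natr; exact: topC.
have S1 := topD XZ ZX; have Z2' := topX 2 ZZ.
have aZ := topM (topC a) ZZ; have bC c (m : nat) := topM (tC m) (topC c).
have sq : ((n1 + n2) + (n1 + n2) = (n1 + n2) * 2)%N by rewrite muln2 addnn.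
have M1 := topM S1 (topD aZ XX); rewrite sq in M1.
have M2 := topM (topM (bC b 4) ZZ) S1; rewrite add0n sq in M2.
split.
- exact: (topX 2 (topD XZ (topN ZX))).
- exact: (topM (tC 2) (topD M1 (topM (bC b 2) Z2'))).
- exact: (topD (topX 2 (topD XX (topN aZ))) (topN M2)).
Qed.

Variables a b : F.
Hypotheses (two_neq0 : 2%:R != 0 :> F)
  (disc_neq0 : 4%:R * a ^+ 3 + 27%:R * b ^+ 2 != 0).

Let four_neq0 : 4%:R != 0 :> F.
Proof. by rewrite (natrM _ 2 2) mulf_neq0. Qed.

(** If kum0 vanishes, the two points of the projective line are equal, and
    then kum1 and kum2 are the denominator and the numerator of the duplication
    formula, whose resultant involves only the discriminant. *)
Lemma kum_neq0 (x1 z1 x2 z2 : F) :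
  (x1 != 0) || (z1 != 0) -> (x2 != 0) || (z2 != 0) ->
  kum0 x1 z1 x2 z2 = 0 -> kum1 a b x1 z1 x2 z2 = 0 -> kum2 a b x1 z1 x2 z2 = 0 -> False.
Proof.
move=> h1 h2 /eqP; rewrite expf_eq0 /= subr_eq0 => /eqP e0 e1 e2.
have [z10|z1n] := eqVneq z1 0.
  have x1n : x1 != 0 by move: h1; rewrite z10 eqxx orbF.
  have z20 : z2 = 0 by apply: (mulfI x1n); rewrite e0 z10 !mulr0.
  have x2n : x2 != 0 by move: h2; rewrite z20 eqxx orbF.
  move: e2; rewrite /kum2 z10 z20 !(mul0r, mulr0) !subr0 => /eqP.
  by rewrite expf_eq0 /= mulf_eq0 (negbTE x1n) (negbTE x2n).
pose k := z2 / z1.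
have ez : z2 = k * z1 by rewrite /k; field.
have ex : x2 = k * x1 by apply: (mulIf z1n); rewrite -e0 /k; field.
have kn : k != 0 by apply: contraTneq h2 => k0; rewrite ex ez k0 !mul0r eqxx.
pose f1 := x1 ^+ 3 + a * x1 * z1 ^+ 2 + b * z1 ^+ 3.
pose g1 := (x1 ^+ 2 - a * z1 ^+ 2) ^+ 2 - 8%:R * b * x1 * z1 ^+ 3.
have f10 : f1 = 0.
  have n0 : 4%:R * k ^+ 2 * z1 != 0 by rewrite mulf_neq0 ?z1n // mulf_neq0 ?four_neq0 // expf_neq0.
  by apply: (mulfI n0); rewrite mulr0 -e1 ex ez /kum1 /f1; ring.
have g10 : g1 = 0.
  apply: (mulfI (expf_neq0 2 kn)); rewrite mulr0 -e2 ex ez /kum2 /g1; ring.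
have : (4%:R * a ^+ 3 + 27%:R * b ^+ 2) * z1 ^+ 6 == 0.
  have -> : (4%:R * a ^+ 3 + 27%:R * b ^+ 2) * z1 ^+ 6 =
    (3%:R * x1 ^+ 2 + 4%:R * a * z1 ^+ 2) * g1
     - (3%:R * x1 ^+ 3 - 5%:R * a * x1 * z1 ^+ 2 - 27%:R * b * z1 ^+ 3) * f1.
    by rewrite /f1 /g1; ring.
  by rewrite f10 g10 !mulr0 subrr.
by rewrite mulf_eq0 (negbTE disc_neq0) expf_eq0 (negbTE z1n).
Qed.

(** The argument of kum_neq0, carried out modulo a common divisor. *)
Lemma prim3_kum (X1 Z1 X2 Z2 : {poly F}) : coprimep X1 Z1 -> coprimep X2 Z2 ->
  prim3 (kum0 X1 Z1 X2 Z2) (kum1 a%:P b%:P X1 Z1 X2 Z2) (kum2 a%:P b%:P X1 Z1 X2 Z2).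
Proof.
move=> c1 c2 r r0 r1 r2.
pose w := X1 * Z2 - X2 * Z1.
suff cw : coprimep r w.
  have : r %| 1 by rewrite -(Gauss_dvdpr 1 (coprimep_expr 2 cw)) mulr1.
  by rewrite dvdp1 => /eqP.
rewrite coprimep_def; set g := gcdp r w.
have gw : g %| w := dvdp_gcdr _ _.
have g1 : g %| kum1 a%:P b%:P X1 Z1 X2 Z2 by apply: dvdp_trans r1; exact: dvdp_gcdl.
have g2 : g %| kum2 a%:P b%:P X1 Z1 X2 Z2 by apply: dvdp_trans r2; exact: dvdp_gcdl.
pose f1 := X1 ^+ 3 + a%:P * X1 * Z1 ^+ 2 + b%:P * Z1 ^+ 3.
pose h1 := (X1 ^+ 2 - a%:P * Z1 ^+ 2) ^+ 2 - 8%:R * b%:P * X1 * Z1 ^+ 3.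
have coprime2 y : g %| X2 ^+ 2 * y -> g %| Z2 ^+ 2 * y -> g %| y.
  move=> hx hz.
  have : coprimep (X2 ^+ 2) (Z2 ^+ 2) by rewrite coprimep_expl ?coprimep_expr.
  case/Bezout_eq1_coprimepP => -[u v] /= e; rewrite -[y]mul1r -e mulrDl.
  by rewrite dvdp_add // -mulrA dvdp_mull.
(* modulo w the two points have the same x, so the forms become those of a doubling *)
have gf : g %| Z1 * f1.
  have four : g %| 4%:R * (Z1 * f1) -> g %| Z1 * f1.
    by rewrite -polyC_natr mul_polyC dvdpZr.
  apply: four; apply: coprime2.
  - have -> : X2 ^+ 2 * (4%:R * (Z1 * f1)) = X1 ^+ 2 * kum1 a%:P b%:P X1 Z1 X2 Z2 -
      2%:R * (X1 * (a%:P * Z1 * (X2 * Z1) + X1 * (X1 * X2))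
        + (X1 * (X2 * Z1) + X1 * X2 * Z1) * a%:P * Z1
        + X1 * a%:P * Z1 * w + 2%:R * b%:P * Z1 ^+ 2 * (2%:R * X2 * Z1 + w)) * w.
      by rewrite /kum1 /f1 /w; ring.
    by rewrite dvdp_sub // dvdp_mull.
  - have -> : Z2 ^+ 2 * (4%:R * (Z1 * f1)) = Z1 ^+ 2 * kum1 a%:P b%:P X1 Z1 X2 Z2 +
      2%:R * (Z1 * (a%:P * Z1 * (Z1 * Z2) + X1 * (X1 * Z2))
        + (X1 * (Z1 * Z2) + X1 * Z2 * Z1) * X1 - Z1 * X1 * w) * w.
      by rewrite /kum1 /f1 /w; ring.
    by rewrite dvdp_add // dvdp_mull.
have gh : g %| h1.
  apply: coprime2.
  - have -> : X2 ^+ 2 * h1 = X1 ^+ 2 * kum2 a%:P b%:P X1 Z1 X2 Z2 -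
      (- a%:P * Z1 * (2%:R * (X1 * (X1 * X2) - a%:P * Z1 * (X2 * Z1)) - a%:P * Z1 * w)
       - 4%:R * b%:P * Z1 * (2%:R * X1 * (X2 * Z1) + X1 * X2 * Z1 + X1 * w)) * w.
      by rewrite /kum2 /h1 /w; ring.
    by rewrite dvdp_sub // dvdp_mull.
  - have -> : Z2 ^+ 2 * h1 = Z1 ^+ 2 * kum2 a%:P b%:P X1 Z1 X2 Z2 +
      (X1 * (2%:R * (X1 * (X1 * Z2) - a%:P * Z1 * (Z1 * Z2)) - X1 * w)
        - 4%:R * b%:P * Z1 * (Z1 * Z2) * Z1) * w.
      by rewrite /kum2 /h1 /w; ring.
    by rewrite dvdp_add // dvdp_mull.
have gz : g %| Z1 ^+ 7.
  have : g %| (4%:R * a ^+ 3 + 27%:R * b ^+ 2)%:P * Z1 ^+ 7.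
    have -> : (4%:R * a ^+ 3 + 27%:R * b ^+ 2)%:P * Z1 ^+ 7 =
      (3%:R * X1 ^+ 2 * Z1 + 4%:R * a%:P * Z1 ^+ 3) * h1
       - (3%:R * X1 ^+ 3 - 5%:R * a%:P * X1 * Z1 ^+ 2 - 27%:R * b%:P * Z1 ^+ 3) * (Z1 * f1).
      by rewrite /f1 /h1 polyCD (polyCM 4%:R) (polyCM 27%:R) !polyC_exp !polyC_natr; ring.
    by rewrite dvdp_sub // dvdp_mull.
  by rewrite mul_polyC dvdpZr.
have cgz : coprimep g Z1.
  apply/coprimepP => d dg dz.
  have d4 : d %| X1 ^+ 4.
    have -> : X1 ^+ 4 = h1 + Z1 * (2%:R * X1 ^+ 2 * a%:P * Z1 - a%:P ^+ 2 * Z1 ^+ 3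
      + 8%:R * b%:P * X1 * Z1 ^+ 2) by rewrite /h1; ring.
    by apply: dvdp_add; [exact: dvdp_trans gh|rewrite dvdp_mulr].
  have cd : coprimep d (X1 ^+ 4).
    by rewrite coprimep_expr // coprimep_sym (coprimep_dvdl dz).
  by rewrite -size_poly_eq1 -dvdp1 -(Gauss_dvdpr 1 cd) mulr1.
by rewrite -dvdp1 -(Gauss_dvdpr 1 (coprimep_expr 7 cgz)) mulr1.
Qed.

(** Gauss's lemma for the product of Z1 T + X1 and Z2 T + X2. *)
Lemma prim3_conv (X1 Z1 X2 Z2 : {poly F}) : coprimep X1 Z1 -> coprimep X2 Z2 ->
  prim3 (Z1 * Z2) (X1 * Z2 + X2 * Z1) (X1 * X2).
Proof.
move=> c1 c2 r r0 r1 r2.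
have crz : coprimep r Z1.
  apply/coprimepP => g gr gz.
  have g1 : g %| X1 * Z2.
    by rewrite -(dvdp_addl _ (dvdp_mull X2 gz)) (dvdp_trans gr).
  have cgx : coprimep g X1 by rewrite coprimep_sym (coprimep_dvdl gz).
  have gz2 : g %| Z2 by rewrite -(Gauss_dvdpr _ cgx).
  have gx2 : g %| X2 by rewrite -(Gauss_dvdpr _ cgx) (dvdp_trans gr).
  by have/coprimepP := c2; apply.
have rz2 : r %| Z2 by rewrite -(Gauss_dvdpr _ crz).
have rx2 : r %| X2.
  by rewrite -(Gauss_dvdpl _ crz) -(dvdp_addr _ (dvdp_mull X1 rz2)).
have/coprimepP := c2 => /(_ r rx2 rz2).
by rewrite -size_poly_eq1 => /eqP.
Qed.

Lemma top_conv n1 n2 (X1 Z1 X2 Z2 : {poly F}) x1 z1 x2 z2 :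
  top n1 X1 x1 -> top n1 Z1 z1 -> top n2 X2 x2 -> top n2 Z2 z2 ->
  [/\ top (n1 + n2)%N (Z1 * Z2) (z1 * z2),
      top (n1 + n2)%N (X1 * Z2 + X2 * Z1) (x1 * z2 + x2 * z1)
    & top (n1 + n2)%N (X1 * X2) (x1 * x2)].
Proof.
move=> hX1 hZ1 hX2 hZ2; split; try exact: topM.
by apply: topD; [|rewrite addnC]; apply: topM.
Qed.

Lemma conv_neq0 (x1 z1 x2 z2 : F) : (x1 != 0) || (z1 != 0) -> (x2 != 0) || (z2 != 0) ->
  z1 * z2 = 0 -> x1 * z2 + x2 * z1 = 0 -> x1 * x2 = 0 -> False.
Proof.
move=> h1 h2 /eqP; rewrite mulf_eq0.
case/orP=> /eqP e; move: h1 h2; rewrite e eqxx ?orbF => h1 h2.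
  rewrite mulr0 addr0 => /eqP; rewrite mulf_eq0 (negbTE h1) /= => /eqP e2.
  move=> /eqP; rewrite mulf_eq0 (negbTE h1) /= => e3; move: h2; rewrite e2 e3 eqxx //.
rewrite mulr0 add0r => /eqP; rewrite mulf_eq0 (negbTE h2) /= => /eqP e2.
move=> /eqP; rewrite mulf_eq0 (negbTE h2) orbF => e3; move: h1; rewrite e2 e3 eqxx //.
Qed.

(** The degree of a projective point is well defined. *)
Lemma top_unique n m p0 p1 p2 c0 c1 c2 d0 d1 d2 :
  top n p0 c0 -> top n p1 c1 -> top n p2 c2 -> (c0 = 0 -> c1 = 0 -> c2 = 0 -> False) ->
  top m p0 d0 -> top m p1 d1 -> top m p2 d2 -> (d0 = 0 -> d1 = 0 -> d2 = 0 -> False) ->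
  n = m.
Proof.
move=> [a0 <-] [a1 <-] [a2 <-] h [b0 <-] [b1 <-] [b2 <-] h'.
case: (ltngtP n m) => // lt.
  by case: h'; rewrite nth_default //; apply: leq_trans lt.
by case: h; rewrite nth_default //; apply: leq_trans lt.
Qed.

Lemma top_exists (X Z : {poly F}) : coprimep X Z ->
  exists n, (maxn (size X) (size Z) = n.+1) /\ exists x z, [/\ top n X x, top n Z z & (x != 0) || (z != 0)].
Proof.
move=> c; have nz : (X != 0) || (Z != 0).
  rewrite -negb_and; apply/negP => /andP[/eqP x0 /eqP z0]; move: c.
  by rewrite x0 z0 coprimep0 -size_poly_eq1 size_poly0.
have : (0 < maxn (size X) (size Z))%N by rewrite leq_max !lt0n !size_poly_eq0.
case e : (maxn (size X) (size Z)) => [|n] // _; exists n; split=> //.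
exists X`_n, Z`_n; split; rewrite /top -?e ?leq_maxl ?leq_maxr //.
move: nz; case: (leqP (size Z) (size X)) => h nz; rewrite ?(maxn_idPl h) in e.
  have x0 : X != 0 by apply: contraTneq h => x0; rewrite -ltnNge x0 size_poly0 lt0n size_poly_eq0; move: nz; rewrite x0 eqxx.
  by move: x0; rewrite -lead_coef_eq0 lead_coefE e /= => ->.
rewrite (maxn_idPr (ltnW h)) in e.
have z0 : Z != 0 by rewrite -size_poly_eq0 -lt0n (leq_ltn_trans _ h).
by move: z0; rewrite -lead_coef_eq0 lead_coefE e /= => ->; rewrite orbT.
Qed.

End Triples.

(** * Heights over a rational function field *)

Section Heights.
(* L plays the field of fractions of {poly F} *)
Variables (F L : fieldType) (frac : {rmorphism {poly F} -> L}).
Hypothesis frac_inj : injective frac.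
Hypothesis fracP : forall x : L, exists nd : {poly F} * {poly F},
  (nd.2 != 0) && (x * frac nd.2 == frac nd.1).
Local Notation "x %:F" := (frac x).

Lemma frac_eq p q : (p%:F == q%:F) = (p == q). Proof. exact: inj_eq. Qed.
Lemma frac_eq0 p : (p%:F == 0) = (p == 0).
Proof. by rewrite -(rmorph0 frac) frac_eq. Qed.

Definition lowest_terms (x : L) : {poly F} * {poly F} :=
  let n := (xchoose (fracP x)).1 in let d := (xchoose (fracP x)).2 in
  (n %/ gcdp n d, d %/ gcdp n d).

Lemma lowest_termsP x : [/\ coprimep (lowest_terms x).1 (lowest_terms x).2,
  (lowest_terms x).2 != 0 & x * ((lowest_terms x).2)%:F = ((lowest_terms x).1)%:F].
Proof.
rewrite /lowest_terms; have /andP[d0 /eqP e] := xchooseP (fracP x).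
move: (xchoose _).1 (xchoose _).2 d0 e => n d d0 e /=.
set g := gcdp n d.
have en : n = n %/ g * g by rewrite divpK ?dvdp_gcdl.
have ed : d = d %/ g * g by rewrite divpK ?dvdp_gcdr.
have g0 : g != 0 by rewrite gcdp_eq0 (negbTE d0) andbF.
split; first by rewrite coprimep_div_gcd ?d0 ?orbT.
  by apply: contraNneq d0 => e'; rewrite ed e' mul0r.
apply: (mulIf (_ : g%:F != 0)); first by rewrite frac_eq0.
by rewrite -mulrA -!rmorphM -en -ed.
Qed.

Definition x_rep (P : option (L * L)) (X Z : {poly F}) : Prop :=
  coprimep X Z /\ proj_x P X%:F Z%:F.

Definition x_pair (P : option (L * L)) : {poly F} * {poly F} :=
  if P is Some (x, _) then lowest_terms x else (1, 0).

(** The degree of the abscissa as a rational function of t. *)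
Definition height (P : option (L * L)) : nat :=
  (maxn (size (x_pair P).1) (size (x_pair P).2)).-1.

Lemma x_pairP P : x_rep P (x_pair P).1 (x_pair P).2.
Proof.
case: P => [[x y]|]; rewrite /x_rep /=.
  by have [? ? ?] := lowest_termsP x; rewrite frac_eq0.
by rewrite coprime1p frac_eq0 oner_neq0 rmorph0.
Qed.

Lemma x_rep_size P X Z X' Z' : x_rep P X Z -> x_rep P X' Z' ->
  size X = size X' /\ size Z = size Z'.
Proof.
move=> [c h] [c' h'].
have e : X * Z' = X' * Z.
  apply/eqP; rewrite -frac_eq !(rmorphM frac); apply/eqP.
  case: P h h' => [[x y]|] /=; last by move=> [_ ->] [_ ->]; rewrite !mulr0.
  by move=> [_ ->] [_ ->]; rewrite mulrAC.
have hX : X %= X'.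
  rewrite /eqp -(Gauss_dvdpl X' c) -e dvdp_mulr //=.
  by rewrite -(Gauss_dvdpl X c') e dvdp_mulr.
have hZ : Z %= Z'.
  rewrite coprimep_sym in c; rewrite coprimep_sym in c'.
  rewrite /eqp -(Gauss_dvdpr Z' c) e dvdp_mull //=.
  by rewrite -(Gauss_dvdpr Z c') -e dvdp_mull.
by split; apply: eqp_size.
Qed.

Lemma height_rep P X Z : x_rep P X Z -> height P = (maxn (size X) (size Z)).-1.
Proof. by move=> h; have [e1 e2] := x_rep_size (x_pairP P) h; rewrite /height e1 e2. Qed.

Variables (D : L) (a b : F).
Hypotheses (two_neq0 : 2%:R != 0 :> F) (D_neq0 : D != 0)
  (disc_neq0 : 4%:R * a ^+ 3 + 27%:R * b ^+ 2 != 0).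
Local Notation aL := (a%:P%:F).
Local Notation bL := (b%:P%:F).

Lemma two_neq0_frac : 2%:R != 0 :> L.
Proof. by rewrite -(rmorph_nat frac) frac_eq0 -polyC_natr polyC_eq0. Qed.

Lemma disc_neq0_frac : 4%:R * aL ^+ 3 + 27%:R * bL ^+ 2 != 0.
Proof.
rewrite -!(rmorph_nat frac) -!(rmorphXn frac) -!(rmorphM frac) -(rmorphD frac) frac_eq0.
by rewrite -!polyC_natr -!polyC_exp -!polyCM -polyCD polyC_eq0.
Qed.

Lemma tofrac_kum X1 Z1 X2 Z2 :
  [/\ (kum0 X1 Z1 X2 Z2)%:F = kum0 X1%:F Z1%:F X2%:F Z2%:F,
      (kum1 a%:P b%:P X1 Z1 X2 Z2)%:F = kum1 aL bL X1%:F Z1%:F X2%:F Z2%:F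
    & (kum2 a%:P b%:P X1 Z1 X2 Z2)%:F = kum2 aL bL X1%:F Z1%:F X2%:F Z2%:F].
Proof.
by rewrite /kum0 /kum1 /kum2; split;
  rewrite ?(rmorph_nat, rmorphXn, rmorphM, rmorphB, rmorphD).
Qed.

Local Notation on_curve := (on_curve D aL bL).
Local Notation add_pt := (add_pt D aL).

Lemma kummer_rep P Q X1 Z1 X2 Z2 Xp Zp Xm Zm :
  on_curve P -> on_curve Q -> x_rep P X1 Z1 -> x_rep Q X2 Z2 ->
  x_rep (add_pt P Q) Xp Zp -> x_rep (add_pt P (opp_pt Q)) Xm Zm ->
  exists2 c, c != 0 &
  [/\ kum0 X1 Z1 X2 Z2 = c *: (Zp * Zm),
      kum1 a%:P b%:P X1 Z1 X2 Z2 = c *: (Xp * Zm + Xm * Zp)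
    & kum2 a%:P b%:P X1 Z1 X2 Z2 = c *: (Xp * Xm)].
Proof.
move=> cP cQ [c1 h1] [c2 h2] [cp hp] [cm hm].
have [t0 t1 t2] := tofrac_kum X1 Z1 X2 Z2.
have [k0 k1 k2] := kummer_aux two_neq0_frac D_neq0 cP cQ h1 h2 hp hm.
have pk := prim3_kum two_neq0 disc_neq0 c1 c2.
move: (kum0 X1 Z1 X2 Z2) (kum1 _ _ X1 Z1 X2 Z2) (kum2 _ _ X1 Z1 X2 Z2) pk t0 t1 t2.
move=> w0 w1 w2 pk t0 t1 t2.
apply: prim3_prop; [exact: prim3_conv|exact: pk|..];
  by apply/eqP; rewrite -frac_eq !((rmorphM frac), (rmorphD frac)) ?t0 ?t1 ?t2; apply/eqP.
Qed.

Lemma top_scale n (p : {poly F}) c d : top n p d -> top n (c *: p) (c * d).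
Proof. by move=> h; rewrite -mul_polyC; exact: (topM (topC c) h). Qed.

(** The Kummer forms of P and Q and the symmetric functions of the abscissas
    of P + Q and P - Q are coprime representatives of the same projective
    point, so they have the same degree. *)
Lemma height_parallelogram P Q : on_curve P -> on_curve Q ->
  (height (add_pt P Q) + height (add_pt P (opp_pt Q)) = (height P + height Q) * 2)%N.
Proof.
move=> cP cQ.
have [[c1 h1] [c2 h2]] := (x_pairP P, x_pairP Q).
have [[cp hp] [cm hm]] := (x_pairP (add_pt P Q), x_pairP (add_pt P (opp_pt Q))).
have [c c0 [e0 e1 e2]] := kummer_rep cP cQ (conj c1 h1) (conj c2 h2) (conj cp hp) (conj cm hm).
rewrite /height.
have [n1 [-> [x1 [z1 [X1 Z1 nz1]]]]] := top_exists c1.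
have [n2 [-> [x2 [z2 [X2 Z2 nz2]]]]] := top_exists c2.
have [np [-> [xp [zp [Xp Zp nzp]]]]] := top_exists cp.
have [nm [-> [xm [zm [Xm Zm nzm]]]]] := top_exists cm.
have [t0 t1 t2] := top_kum a b X1 Z1 X2 Z2.
have [v0 v1 v2] := top_conv Xp Zp Xm Zm.
rewrite e0 in t0; rewrite e1 in t1; rewrite e2 in t2.
apply/esym; apply: (top_unique t0 t1 t2 _ (top_scale c v0) (top_scale c v1) (top_scale c v2)).
  by apply: kum_neq0.
move=> /eqP; rewrite mulf_eq0 (negbTE c0) => /eqP i0.
move=> /eqP; rewrite mulf_eq0 (negbTE c0) => /eqP i1.
move=> /eqP; rewrite mulf_eq0 (negbTE c0) => /eqP i2.
exact: (conv_neq0 nzp nzm i0 i1 i2).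
Qed.

(** The point specialises to the origin at t = infinity, which is why this
    property is stable under addition. *)
Definition pole_at_inf P := (size (x_pair P).2 < size (x_pair P).1)%N.

Lemma pole_at_infP P X Z : x_rep P X Z -> pole_at_inf P = (size Z < size X)%N.
Proof. by move=> h; have [e1 e2] := x_rep_size (x_pairP P) h; rewrite /pole_at_inf e1 e2. Qed.

Lemma pole_at_inf_top P n x z : top n (x_pair P).1 x -> top n (x_pair P).2 z ->
  (x != 0) || (z != 0) -> pole_at_inf P = (z == 0).
Proof.
rewrite /pole_at_inf; move: (x_pair P) => [X Z] /= [sX <-] [sZ <-] nz.
have [z0|z0] := eqVneq Z`_n 0.
  rewrite z0 eqxx orbF in nz.
  have lX : (n < size X)%N by rewrite ltnNge; apply: contra nz => h; rewrite nth_default.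
  apply: leq_trans lX; rewrite ltnS leqNgt; apply/negP => h.
  have e : size Z = n.+1 by apply/eqP; rewrite eqn_leq sZ.
  have Z0 : Z != 0 by rewrite -size_poly_eq0 e.
  by move: Z0; rewrite -lead_coef_eq0 lead_coefE e /= z0 eqxx.
apply/negbTE; rewrite -leqNgt (leq_trans sX) // ltnNge.
by apply: contra z0 => h; rewrite nth_default.
Qed.

(** When both top denominators vanish, kum0 and kum1 drop below the top
    degree, so both roots of the Kummer quadratic are infinite there. *)
Lemma pole_at_inf_add P Q : on_curve P -> on_curve Q ->
  pole_at_inf P -> pole_at_inf Q -> pole_at_inf (add_pt P Q).
Proof.
move=> cP cQ.
have [[c1 h1] [c2 h2]] := (x_pairP P, x_pairP Q).
have [[cp hp] [cm hm]] := (x_pairP (add_pt P Q), x_pairP (add_pt P (opp_pt Q))).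
have [c c0 [e0 e1 e2]] := kummer_rep cP cQ (conj c1 h1) (conj c2 h2) (conj cp hp) (conj cm hm).
have [n1 [E1 [x1 [z1 [X1 Z1 nz1]]]]] := top_exists c1.
have [n2 [E2 [x2 [z2 [X2 Z2 nz2]]]]] := top_exists c2.
have [np [Ep [xp [zp [Xp Zp nzp]]]]] := top_exists cp.
have [nm [Em [xm [zm [Xm Zm nzm]]]]] := top_exists cm.
rewrite (pole_at_inf_top X1 Z1 nz1) (pole_at_inf_top X2 Z2 nz2) (pole_at_inf_top Xp Zp nzp).
move=> /eqP z10 /eqP z20; subst z1 z2.
have hpar := height_parallelogram cP cQ.
rewrite /height E1 E2 Ep Em /= in hpar.
have [[_ t0] [_ t1] _] := top_kum a b X1 Z1 X2 Z2.
have [v0 v1 v2] := top_conv Xp Zp Xm Zm.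
rewrite e0 -hpar (top_scale c v0).2 in t0.
rewrite e1 -hpar (top_scale c v1).2 in t1.
have {}t0 : c * (zp * zm) == 0 by rewrite t0 /kum0; apply/eqP; ring.
have {}t1 : c * (xp * zm + xm * zp) == 0 by rewrite t1 /kum1; apply/eqP; ring.
move: t0 t1; rewrite !mulf_eq0 (negbTE c0) /= => t0.
case/orP: t0 => // /eqP z0.
rewrite z0 mulr0 add0r mulf_eq0 => /orP[|] // /eqP xm0.
by move: nzm; rewrite z0 xm0 eqxx.
Qed.

End Heights.

(** * The quadratic form on the group of points *)

Section QuadraticForm.

Lemma second_difference (g : int -> int) (c : int) :
  (forall n, g (n + 1) + g (n - 1) = 2 * (g n + c)) ->
  forall n, g n = g 0 + n * (g 1 - g 0 - c) + n ^+ 2 * c.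
Proof.
move=> hg n; pose h n := g n - (g 0 + n * (g 1 - g 0 - c) + n ^+ 2 * c).
have hh k : h (k + 1) + h (k - 1) = 2 * h k.
  rewrite /h [LHS](_ : _ = g (k + 1) + g (k - 1) - 2 * (g 0 + k * (g 1 - g 0 - c) + k ^+ 2 * c + c)); last by ring.
  by rewrite hg; ring.
have h0 : h 0 = 0 by rewrite /h; ring.
have h1 : h 1 = 0 by rewrite /h; ring.
have hp k : h (k%:Z) = 0 /\ h (k%:Z + 1) = 0.
  elim: k => [|k [i0 i1]]; first by rewrite h0 add0r h1.
  have e := hh (k%:Z + 1); rewrite i1 addrK i0 in e.
  have -> : (k.+1%:Z = k%:Z + 1) by rewrite -addn1 PoszD.
  by split=> //; rewrite addr0 mulr0 in e.
have hn k : h (- k%:Z) = 0 /\ h (- k%:Z - 1) = 0.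
  elim: k => [|k [i0 i1]].
    by rewrite oppr0; split => //; have e := hh 0; rewrite add0r h1 h0 mulr0 !add0r in e; rewrite add0r.
  have e := hh (- k%:Z - 1); rewrite i1 subrK i0 add0r mulr0 in e.
  have -> : (- k.+1%:Z = - k%:Z - 1) by rewrite -addn1 PoszD opprD.
  by split.
have : h n = 0.
  case: n => n; first by have [] := hp n.
  by rewrite NegzE; have [] := hn n.+1.
by move/eqP; rewrite subr_eq0 => /eqP.
Qed.

(** Along each line u + n y the parallelogram law is a recurrence of order two
    in n with constant second difference. *)
Lemma quadratic_form (V : zmodType) (d : V -> int) :
  (forall x y, d (x + y) + d (x - y) = 2 * (d x + d y)) ->
  forall x y m n, d (x *~ m + y *~ n) =
    m ^+ 2 * d x + m * n * (d (x + y) - d x - d y) + n ^+ 2 * d y.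
Proof.
move=> hd.
have d0 : d 0 = 0 by have := hd 0 0; rewrite subrr addr0; lia.
have line u y n : d (u + y *~ n) = d u + n * (d (u + y) - d u - d y) + n ^+ 2 * d y.
  have := @second_difference (fun n => d (u + y *~ n)) (d y).
  rewrite mulr0z mulr1z addr0 => -> // k.
  by rewrite mulrzDr mulrzBr mulr1z !addrA hd.
move=> x y m n; rewrite line.
have e0 : d (x *~ m) = m ^+ 2 * d x.
  by have := line 0 x m; rewrite !add0r d0 => ->; ring.
by rewrite e0 [x *~ m + y]addrC line [y + x]addrC; ring.
Qed.
End QuadraticForm.

Lemma quotient_der_eq (K : fieldType) (x d D n' N' d' D' : K) : d != 0 -> D != 0 ->
  n' * D + x * d * D' = N' * d + x * D * d' -> (N' - x * D') / D = (n' - x * d') / d.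
Proof.
move=> d0 D0 e; apply: (mulIf d0); apply: (mulIf D0).
have -> : (N' - x * D') / D * d * D = N' * d + x * D * d' - x * D * d' - x * D' * d by field.
by rewrite -e; field.
Qed.

Section FractionDerivation.
Variables (F L : fieldType) (frac : {rmorphism {poly F} -> L}).
Hypothesis frac_inj : injective frac.
Hypothesis fracP : forall x : L, exists nd : {poly F} * {poly F},
  (nd.2 != 0) && (x * frac nd.2 == frac nd.1).
Local Notation "x %:F" := (frac x).

Definition frac_der (x : L) : L :=
  let nd := lowest_terms fracP x in (nd.1^`()%:F - x * nd.2^`()%:F) / nd.2%:F.

Lemma frac_derE (x : L) (n d : {poly F}) : d != 0 -> x * d%:F = n%:F ->
  frac_der x = (n^`()%:F - x * d^`()%:F) / d%:F.
Proof.
move=> d0 e; rewrite /frac_der; have [_ D0 E] := lowest_termsP frac_inj fracP x.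
move: (lowest_terms fracP x) D0 E => [N D] /= D0 E.
have e1 : n * D = N * d.
  by apply: frac_inj; rewrite !rmorphM -e -E mulrAC.
apply: quotient_der_eq; rewrite ?(frac_eq0 frac_inj) //.
by rewrite e E -!rmorphM -!rmorphD -!derivM e1.
Qed.

Lemma frac_der_tofrac (q : {poly F}) : frac_der q%:F = q^`()%:F.
Proof.
rewrite (@frac_derE _ q 1) ?oner_neq0 ?rmorph1 ?mulr1 //.
by rewrite derivC rmorph0 mulr0 subr0 divr1.
Qed.

Lemma frac_derD x y : frac_der (x + y) = frac_der x + frac_der y.
Proof.
have [_ dx ex] := lowest_termsP frac_inj fracP x; have [_ dy ey] := lowest_termsP frac_inj fracP y.
move: (lowest_terms fracP x) (lowest_terms fracP y) dx ex dy ey => [n d] [n' d'] /= dx ex dy ey.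
rewrite (frac_derE dx ex) (frac_derE dy ey).
rewrite (@frac_derE _ (n * d' + n' * d) (d * d')) ?mulf_neq0 //; last first.
  by rewrite rmorphD !rmorphM -ex -ey; ring.
rewrite derivD !derivM !rmorphD !rmorphM -ex -ey; field.
by rewrite !(frac_eq0 frac_inj) dx dy.
Qed.

Lemma frac_derM x y : frac_der (x * y) = frac_der x * y + x * frac_der y.
Proof.
have [_ dx ex] := lowest_termsP frac_inj fracP x; have [_ dy ey] := lowest_termsP frac_inj fracP y.
move: (lowest_terms fracP x) (lowest_terms fracP y) dx ex dy ey => [n d] [n' d'] /= dx ex dy ey.
rewrite (frac_derE dx ex) (frac_derE dy ey).
rewrite (@frac_derE _ (n * n') (d * d')) ?mulf_neq0 //; last first.
  by rewrite !rmorphM -ex -ey; ring.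
rewrite !derivM !rmorphD !rmorphM -ex -ey; field.
by rewrite !(frac_eq0 frac_inj) dx dy.
Qed.

End FractionDerivation.

Section Points.
Variables (F L : fieldType) (frac : {rmorphism {poly F} -> L}).
Hypothesis frac_inj : injective frac.
Hypothesis fracP : forall x : L, exists nd : {poly F} * {poly F},
  (nd.2 != 0) && (x * frac nd.2 == frac nd.1).
Local Notation "x %:F" := (frac x).
Variables a b : F.
Hypotheses (two_neq0 : 2%:R != 0 :> F)
  (disc_neq0 : 4%:R * a ^+ 3 + 27%:R * b ^+ 2 != 0).
Definition weierstrass (R : nzRingType) (a b : R) : {poly R} := 'X^3 + a *: 'X + b%:P.
Local Notation f := (weierstrass a b).
Local Notation aL := (a%:P%:F).
Local Notation bL := (b%:P%:F).

Lemma size_weierstrass : size f = 4%N.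
Proof.
rewrite /weierstrass -addrA size_polyDl size_polyXn //.
rewrite (leq_ltn_trans (size_polyD _ _)) // gtn_max.
rewrite (leq_ltn_trans (size_scale_leq _ _)) ?size_polyX //=.
by rewrite (leq_ltn_trans (size_polyC_leq1 _)).
Qed.

Lemma weierstrass_neq0 : f != 0.
Proof. by rewrite -size_poly_eq0 size_weierstrass. Qed.

Lemma D_neq0 : f%:F != 0.
Proof. by rewrite (frac_eq0 frac_inj) weierstrass_neq0. Qed.

Local Notation on_curve := (on_curve f%:F aL bL).
Local Notation add_pt := (add_pt f%:F aL).

(** On the twist f(t) Y^2 = f(X) of a curve by its own equation, this is the
    identity map of the curve. Endomorphisms become points. *)
Definition generic_pt : option (L * L) := Some ('X%:F, 1).

Lemma generic_on_curve : on_curve generic_pt.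
Proof.
by rewrite /= expr1n mulr1 -rmorphXn -rmorphM -!rmorphD (frac_eq frac_inj) /weierstrass mul_polyC.
Qed.

Lemma generic_rep : x_rep frac generic_pt 'X 1.
Proof. by split; rewrite ?coprimep1 //= rmorph1 oner_neq0 mulr1. Qed.

Lemma generic_height : height fracP generic_pt = 1%N.
Proof. by rewrite (height_rep frac_inj fracP generic_rep) size_polyX size_poly1. Qed.

Lemma height_None : height fracP (None : option (L * L)) = 0%N.
Proof. by rewrite /height /= size_poly1 size_poly0. Qed.

Let h2 := two_neq0_frac frac_inj two_neq0.
Let h3 := disc_neq0_frac frac_inj disc_neq0.

Definition mult_generic n := iter n (fun Q => add_pt Q generic_pt) None.

Lemma mult_generic_on_curve n : on_curve (mult_generic n).
Proof. by elim: n => //= n IH; apply: on_curve_add => //; [exact: D_neq0|exact: generic_on_curve]. Qed.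

Lemma mult_generic_height n : height fracP (mult_generic n) = (n ^ 2)%N.
Proof.
suff: height fracP (mult_generic n) = (n ^ 2)%N /\ height fracP (mult_generic n.+1) = (n.+1 ^ 2)%N by case.
elim: n => [|n [IH1 IH2]]; first by rewrite height_None generic_height.
split=> //; have c := mult_generic_on_curve.
have := height_parallelogram frac_inj fracP two_neq0 D_neq0 disc_neq0 (c n.+1) generic_on_curve.
rewrite {2}/mult_generic iterS -/(mult_generic n) (add_ptK h2 D_neq0 h3 (c n) generic_on_curve) IH1 IH2.
by rewrite -[add_pt _ _]/(mult_generic n.+2) generic_height; lia.
Qed.

(** The multiples of the generic point have distinct heights n^2. The
    parallelogram law gives them without associativity, which in turn rests on
    the present lemma. *)
Lemma many_points (s : seq (option (L * L))) : exists2 G, on_curve G & G \notin s.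
Proof.
pose t := [seq mult_generic i | i <- iota 0 (size s).+1].
have ut : uniq t.
  rewrite map_inj_uniq ?iota_uniq // => i j e.
  by have := congr1 (height fracP) e; rewrite !mult_generic_height => /eqP; rewrite eqn_exp2r // => /eqP.
have [h|] := boolP (all (mem s) t).
  have := uniq_leq_size ut (allP h).
  by rewrite size_map size_iota ltnn.
case/allPn => x /mapP[i _ ->] hx; exists (mult_generic i) => //.
exact: mult_generic_on_curve.
Qed.

(** The hypotheses are arguments of the type because the group axioms of its
    canonical structure depend on them. *)
Definition curve_pt of injective frac & (forall x : L, exists nd : {poly F} * {poly F},
    (nd.2 != 0) && (x * frac nd.2 == frac nd.1)) & 2%:R != 0 :> F & 4%:R * a ^+ 3 + 27%:R * b ^+ 2 != 0 :=
  {P : option (L * L) | on_curve P}.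

Local Notation pt := (curve_pt frac_inj fracP two_neq0 disc_neq0).

Lemma pt_inj (P Q : pt) : sval P = sval Q -> P = Q.
Proof.
case: P Q => [P hP] [Q hQ] /= e; move: hP hQ; rewrite e => hP hQ.
by congr (exist _ _ _); exact: bool_irrelevance.
Qed.

Let addp (P Q : pt) : pt := exist (fun R => is_true (on_curve R)) _
  (on_curve_add h2 D_neq0 h3 (svalP P) (svalP Q)).
Let oppp (P : pt) : pt := exist (fun R => is_true (on_curve R)) _ (on_curve_opp (svalP P)).
Let zerop : pt := exist (fun R => is_true (on_curve R)) None isT.

Fact addpA : associative addp.
Proof.
move=> P Q R; apply: pt_inj; apply/esym; exact: (add_ptA h2 D_neq0 h3 many_points (svalP P) (svalP Q) (svalP R)).
Qed.
Fact addpC : commutative addp.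
Proof. by move=> P Q; apply: pt_inj; exact: (add_ptC h2 D_neq0 h3 (svalP P) (svalP Q)). Qed.
Fact add0p : left_id zerop addp.
Proof. by move=> P; apply: pt_inj. Qed.
Fact addNp : left_inverse zerop oppp addp.
Proof. by move=> P; rewrite addpC; apply: pt_inj; rewrite /= add_opp. Qed.

HB.instance Definition _ := Choice.copy pt {P : option (L * L) | on_curve P}.
HB.instance Definition _ := GRing.isZmodule.Build pt addpA addpC add0p addNp.

Lemma val_ptD (P Q : pt) : sval (P + Q) = add_pt (sval P) (sval Q). Proof. by []. Qed.
Lemma val_ptN (P : pt) : sval (- P) = opp_pt (sval P). Proof. by []. Qed.

Lemma height_form (P Q : pt) (m n : int) :
  let d (R : pt) := (height fracP (sval R))%:Z in
  d (P *~ m + Q *~ n) = m ^+ 2 * d P + m * n * (d (P + Q) - d P - d Q) + n ^+ 2 * d Q.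
Proof.
apply: quadratic_form => x y.
rewrite !val_ptD val_ptN -!PoszD.
rewrite (height_parallelogram frac_inj fracP two_neq0 D_neq0 disc_neq0 (svalP x) (svalP y)).
by rewrite mulnC PoszM.
Qed.

Lemma pole_add (P Q : pt) : pole_at_inf fracP (sval P) -> pole_at_inf fracP (sval Q) ->
  pole_at_inf fracP (sval (P + Q)).
Proof.
exact: (pole_at_inf_add frac_inj (fracP := fracP) two_neq0 D_neq0 disc_neq0
  (svalP P) (svalP Q)).
Qed.

Lemma pole_mulz (P : pt) n : pole_at_inf fracP (sval P) -> pole_at_inf fracP (sval (P *~ n)).
Proof.
move=> hP.
have hn k : pole_at_inf fracP (sval (P *+ k)).
  elim: k => [|k IH]; first by rewrite mulr0n /pole_at_inf /= size_poly0 size_poly1.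
  by rewrite mulrS; apply: pole_add.
case: n => n; first exact: hn.
have := hn n.+1; rewrite -[P *~ Negz n]/(- (P *+ n.+1)) val_ptN.
by case: (sval _) => [[]|].
Qed.

Definition rate (P : pt) (c : F) :=
  has_rate f%:F aL (frac_der fracP) (sval P) (c%:P%:F).

Let dconst (c : F) : frac_der fracP (c%:P%:F) = 0.
Proof. by rewrite (frac_der_tofrac frac_inj) derivC rmorph0. Qed.

Lemma rateD P Q c d : rate P c -> rate Q d -> rate (P + Q) (c + d).
Proof.
move=> hP hQ; rewrite /rate (_ : (c + d)%:P%:F = c%:P%:F + d%:P%:F); last by rewrite polyCD rmorphD.
exact: (has_rate_add h2 D_neq0 h3 (frac_derD frac_inj fracP) (frac_derM frac_inj fracP) (dconst a)
    (svalP P) (svalP Q) hP hQ).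
Qed.

Lemma rateN P c : rate P c -> rate (- P) (- c).
Proof.
move=> hP; rewrite /rate (_ : (- c)%:P%:F = - c%:P%:F); last by rewrite polyCN rmorphN.
exact: (has_rate_opp (frac_derD frac_inj fracP)).
Qed.

Lemma rate_mulz P c n : rate P c -> rate (P *~ n) (n%:~R * c).
Proof.
move=> hP; have hn k : rate (P *+ k) (k%:R * c).
  elim: k => [|k IH]; first by rewrite mul0r /rate /= rmorph0.
  by rewrite mulrS -natr1 mulrDl mul1r addrC; apply: rateD.
case: n => n; first exact: hn.
by rewrite NegzE mulrNz mulrNz mulNr; apply: rateN; exact: hn.
Qed.

(** Where y is invertible the second equation of has_rate is the derivative of
    the equation of the curve. *)
Lemma has_rate_intro x y c : on_curve (Some (x, y)) -> y != 0 ->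
  frac_der fracP x = c * y -> has_rate f%:F aL (frac_der fracP) (Some (x, y)) c.
Proof.
move=> /eqP e y0 hx; split=> //; apply: (mulIf y0).
have dx2 := derX2 (frac_derM frac_inj fracP); have dx3 := derX3 (frac_derM frac_inj fracP).
have := congr1 (frac_der fracP) e.
rewrite (frac_derM frac_inj fracP f%:F) dx2 (frac_derD frac_inj fracP _ bL).
rewrite (frac_derD frac_inj fracP _ (aL * x)) dx3 (frac_derM frac_inj fracP aL).
rewrite !dconst hx => e1.
have -> : 2%:R * f%:F * frac_der fracP y * y =
  (frac_der fracP f%:F * y ^+ 2 + f%:F * (2%:R * y * frac_der fracP y)) - frac_der fracP f%:F * y ^+ 2 by ring.
by rewrite e1; ring.
Qed.

End Points.

(** * Frobenius as a complex multiplication *)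

Section OmegaFormulas.
Variable K : fieldType.
(** For s^2 = -7, the zeros of x^3 - 35 x - 98 are 7, [tors s] and
    [tors (- s)]. The formulas [om_x] and [om_y] are the quotient by the
    2-torsion point of abscissa [tors s] (coefficients [om_A] and [om_B] after
    moving it to the origin), scaled back to the same curve. The factor
    [om_scale s] is the inverse of omega = (1 + s) / 2, so that this
    endomorphism is multiplication by omega, of norm 2. *)
Definition tors (s : K) : K := (- 7%:R + s) / 2%:R.
Definition om_scale (s : K) : K := (1 - s) / 4%:R.
Definition om_A (s : K) := - (7%:R - tors s) - (tors (- s) - tors s).
Definition om_B (s : K) := (7%:R - tors s) * (tors (- s) - tors s).
Definition om_x (s t : K) :=
  tors (- s) + om_scale s ^+ 2 * (t - tors s + om_A s + om_B s / (t - tors s)).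
Definition om_y (s t : K) := om_scale s ^+ 3 * (1 - om_B s / (t - tors s) ^+ 2).

Hypothesis two_neq0 : 2%:R != 0 :> K.
Variable s t : K.
Hypothesis hs : s ^+ 2 = - 7%:R.

Lemma om_curve : t - tors s != 0 ->
  (t ^+ 3 - 35%:R * t - 98%:R) * om_y s t ^+ 2 = om_x s t ^+ 3 - 35%:R * om_x s t - 98%:R.
Proof.
have n4 : 4%:R != 0 :> K by rewrite (natrM _ 2 2) mulf_neq0.
set u := t - tors s => u0.
have -> : t = u + tors s by rewrite /u; ring.
rewrite /om_x /om_y /om_A /om_B /om_scale /tors addrK in u0 *.
by field: hs; rewrite u0 two_neq0 n4.
Qed.

(** Since omega - 1 is the opposite of the conjugate of omega, omega P - P has
    the abscissa of omega P with - s in place of s. *)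
Lemma om_chord : t - tors s != 0 -> t - tors (- s) != 0 -> om_x s t - t != 0 ->
  (t ^+ 3 - 35%:R * t - 98%:R) * ((om_y s t + 1) / (om_x s t - t)) ^+ 2 - om_x s t - t
  = om_x (- s) t.
Proof.
have n4 : 4%:R != 0 :> K by rewrite (natrM _ 2 2) mulf_neq0.
set u := t - tors s => u0.
have -> : t = u + tors s by rewrite /u; ring.
rewrite /om_x /om_y /om_A /om_B /om_scale /tors addrK opprK => u1 v0.
field: hs; rewrite two_neq0 n4 u0 /=; apply/andP; split.
  apply: contraNneq u1 => e; apply/eqP; apply: (mulIf two_neq0); rewrite mul0r -e.
  by field.
have m0 : 128%:R * u != 0 by rewrite (natrX _ 2 7) mulf_neq0 ?expf_neq0.
apply: contraNneq v0 => e; apply/eqP; apply: (mulIf m0); rewrite mul0r -e.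
by field; rewrite u0 two_neq0 n4.
Qed.

End OmegaFormulas.

Section FrobeniusPoint.
Variables (F : finFieldType) (L : fieldType) (frac : {rmorphism {poly F} -> L}).
Hypothesis frac_inj : injective frac.
Hypothesis fracP : forall x : L, exists nd : {poly F} * {poly F},
  (nd.2 != 0) && (x * frac nd.2 == frac nd.1).
Local Notation "x %:F" := (frac x).
Variable p : nat.
Hypotheses (p_prime : prime p) (p_gt7 : (7 < p)%N) (cardF : #|F| = p).
Variable s : F.
Hypothesis hs : s ^+ 2 = - 7%:R.

Let iota : {rmorphism F -> L} := GRing.RMorphism.clone _ _ (frac \o polyC) _.
Let sL := iota s.
Let t := 'X%:F.

Let a : F := - 35%:R.
Let b : F := - 98%:R.
Local Notation f := (weierstrass a b).

Let charF : p \in [pchar F].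
Proof. by apply: (@card_finPcharP F p 1) => //; rewrite cardF expn1. Qed.

Let natF_neq0 n : (0 < n < p)%N -> n%:R != 0 :> F := natr_neq0_ltp charF.

Let two_neq0 : 2%:R != 0 :> F. Proof. by apply: natF_neq0; rewrite (leq_trans _ p_gt7). Qed.
Let three_neq0 : 3%:R != 0 :> F. Proof. by apply: natF_neq0; rewrite (leq_trans _ p_gt7). Qed.
Let five_neq0 : 5%:R != 0 :> F. Proof. by apply: natF_neq0; rewrite (leq_trans _ p_gt7). Qed.
Let seven_neq0 : 7%:R != 0 :> F. Proof. by apply: natF_neq0; rewrite (leq_trans _ p_gt7). Qed.

Let disc_neq0 : 4%:R * a ^+ 3 + 27%:R * b ^+ 2 != 0.
Proof.
have -> : 4%:R * a ^+ 3 + 27%:R * b ^+ 2 = 2%:R ^+ 8 * 7%:R ^+ 3 by rewrite /a /b; ring.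
by rewrite mulf_neq0 ?expf_neq0.
Qed.

Let h2 : 2%:R != 0 :> L := two_neq0_frac frac_inj two_neq0.

Local Notation aL := (a%:P%:F).
Local Notation bL := (b%:P%:F).
Local Notation on_curve := (on_curve f%:F aL bL).
Local Notation add_pt := (add_pt f%:F aL).
Local Notation pt := (curve_pt frac_inj fracP two_neq0 disc_neq0).

Let sL_sq : sL ^+ 2 = - 7%:R.
Proof. by rewrite -rmorphXn hs rmorphN rmorph_nat. Qed.

Let aLE : aL = - 35%:R. Proof. by rewrite -[LHS]/(iota a) rmorphN rmorph_nat. Qed.
Let bLE : bL = - 98%:R. Proof. by rewrite -[LHS]/(iota b) rmorphN rmorph_nat. Qed.

Let fE : f%:F = t ^+ 3 - 35%:R * t - 98%:R.
Proof.
rewrite /weierstrass -mul_polyC !rmorphD rmorphXn rmorphM /= aLE bLE; ring.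
Qed.

Lemma iota_om (s' : F) : [/\ iota (tors s') = tors (iota s'),
  iota (om_scale s') = om_scale (iota s'), iota (om_A s') = om_A (iota s')
  & iota (om_B s') = om_B (iota s')].
Proof.
have e2 : iota (tors s') = tors (iota s').
  by rewrite /tors fmorph_div rmorphD rmorphN !rmorph_nat.
have e2' : iota (tors (- s')) = tors (- iota s').
  by rewrite /tors fmorph_div rmorphD !rmorphN !rmorph_nat.
rewrite /om_A /om_B /om_scale; move: (tors s') (tors (- s')) e2 e2' => T T' e2 e2'.
by rewrite fmorph_div !(rmorphM, rmorphN, rmorphB, rmorph1) e2 e2' !rmorph_nat.
Qed.

Section OmegaPoint.
Variable s' : F.
Hypothesis hs' : s' ^+ 2 = - 7%:R.
Let S := iota s'.
Let hS : S ^+ 2 = - 7%:R.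
Proof. by rewrite -rmorphXn hs' rmorphN rmorph_nat. Qed.

Definition om_pt : option (L * L) := Some (om_x S t, om_y S t).

Let U : {poly F} := 'X - (tors s')%:P.
Let UE : U%:F = t - tors S.
Proof. by rewrite rmorphB /=; have [<- _ _ _] := iota_om s'. Qed.
Let U_neq0 : t - tors S != 0.
Proof. by rewrite -UE (frac_eq0 frac_inj) polyXsubC_eq0. Qed.

Lemma om_pt_on_curve : on_curve om_pt.
Proof.
apply/eqP; rewrite fE (om_curve h2 hS U_neq0) aLE bLE; ring.
Qed.

Let s'_neq0 : s' != 0.
Proof.
apply: contraNneq seven_neq0 => e; move/eqP: hs'.
by rewrite e expr0n /= eq_sym oppr_eq0.
Qed.

Let four_neq0 : 4%:R != 0 :> F. Proof. by apply: natF_neq0; rewrite (leq_trans _ p_gt7). Qed.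
Let eight_neq0 : 8%:R != 0 :> F. Proof. by rewrite (natrM _ 2 4) mulf_neq0. Qed.

Lemma om_scale_neq0 : om_scale s' != 0.
Proof.
rewrite mulf_neq0 ?invr_eq0 //; apply: contraNneq eight_neq0 => e.
have -> : 8%:R = (1 - s') * (1 + s') :> F by ring: hs'.
by rewrite e mul0r.
Qed.

Lemma om_B_neq0 : om_B s' != 0.
Proof.
have e : om_B s' * (21%:R + s') * 2%:R = - s' * (2%:R ^+ 6 * 7%:R).
  by rewrite /om_B /tors; field: hs'.
have n0 : - s' * (2%:R ^+ 6 * 7%:R) != 0.
  by rewrite mulf_neq0 ?oppr_eq0 // mulf_neq0 // expf_neq0.
by apply/eqP => e0; move/eqP: n0; apply; rewrite -e e0 !mul0r.
Qed.

Let X : {poly F} := (tors (- s'))%:P * U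
   + (om_scale s' ^+ 2)%:P * (U * U + (om_A s')%:P * U + (om_B s')%:P).

Lemma om_rep : x_rep frac om_pt X U.
Proof.
split.
  rewrite coprimep_XsubC; apply/negP => /rootP.
  rewrite !(hornerD, hornerM, hornerC, hornerX, hornerN) subrr !(mulr0, mul0r, add0r, addr0).
  by apply/eqP; rewrite mulf_neq0 ?expf_neq0 ?om_scale_neq0 ?om_B_neq0.
rewrite /= UE; split=> //; rewrite /X; move: UE; move: U => u ue.
have [_ eK eA eB] := iota_om s'; have [eT _ _ _] := iota_om (- s').
have eX : (om_scale s' ^+ 2)%:P%:F = om_scale S ^+ 2 by rewrite -eK; exact: (rmorphXn iota 2).
move: (om_scale s' ^+ 2) eX eT eA eB => k2 eX; rewrite rmorphN -/S.
move: (tors (- s')) (om_A s') (om_B s') => T A B eT eA eB.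
rewrite !(rmorphD, rmorphM) ue eX [T%:P%:F]eT [A%:P%:F]eA [B%:P%:F]eB.
rewrite /om_x -/S; move: U_neq0; move: (om_A S) (om_B S) (om_scale S) => A' B' k hU.
by field.
Qed.

Lemma om_size : size X = 3%N.
Proof.
have tX : top 2 X (om_scale s' ^+ 2).
  have tU : top 1 U 1.
    split; first by rewrite size_XsubC.
    by rewrite coefB coefX coefC subr0.
  have up (q : {poly F}) c n : top n q c -> top n.+1 q 0.
    by move=> [h _]; split; [exact: leqW|rewrite nth_default].
  have t1 := up _ _ _ (topM (topC (tors (- s'))) tU).
  have t2 := up _ _ _ (topM (topC (om_A s')) tU).
  have t3 := up _ _ _ (up _ _ _ (topC (om_B s'))).
  have := topD t1 (topM (topC (om_scale s' ^+ 2)) (topD (topD (topM tU tU) t2) t3)).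
  by rewrite mulr1 !addr0 add0r mulr1.
have [h1 h2'] := tX; apply/eqP; rewrite eqn_leq h1 ltnNge; apply/negP => h.
by move: h2'; rewrite nth_default // => /esym/eqP; rewrite expf_eq0 /= (negbTE om_scale_neq0).
Qed.

Lemma om_height : height fracP om_pt = 2%N.
Proof. by rewrite (height_rep frac_inj fracP om_rep) om_size size_XsubC. Qed.

Lemma om_pole : pole_at_inf fracP om_pt.
Proof. by rewrite (pole_at_infP frac_inj fracP om_rep) om_size size_XsubC. Qed.

End OmegaPoint.

Lemma om_height_sub (W := om_pt s) :
  height fracP (add_pt W (opp_pt (generic_pt frac))) = 2%N.
Proof.
have hsN : (- s) ^+ 2 = - 7%:R by rewrite sqrrN.
have xW : om_x sL t != t.
  apply/eqP => e; have := om_height hs.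
  have h : x_rep frac (om_pt s) 'X 1.
    by split; rewrite ?coprimep1 //= rmorph1 oner_neq0 mulr1.
  by rewrite (height_rep frac_inj fracP h) size_polyX size_poly1.
rewrite /W /om_pt /generic_pt /opp_pt add_chord // opprK.
have u0 (s' : F) : t - tors (iota s') != 0.
  have [<- _ _ _] := iota_om s'.
  by rewrite -[iota _]/((tors s')%:P%:F) -rmorphB (frac_eq0 frac_inj) polyXsubC_eq0.
have v0 : om_x sL t - t != 0 by rewrite subr_eq0.
have u1 : t - tors (- sL) != 0 by rewrite -rmorphN.
have ch := om_chord h2 sL_sq (u0 s) u1 v0.
rewrite fE ch -(om_height hsN).
have hr := om_rep hsN.
rewrite (height_rep frac_inj fracP hr); apply: height_rep => //.
by move: hr; rewrite /om_pt rmorphN.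
Qed.

Let om : F := (1 + s) / 2%:R.

(** The rate of a multiple of P is its action on the tangent space. *)
Lemma om_rate : has_rate f%:F aL (frac_der fracP) (om_pt s) (om%:P%:F).
Proof.
have U0 : t - tors sL != 0.
  have [<- _ _ _] := iota_om s.
  by rewrite -[iota _]/((tors s)%:P%:F) -rmorphB (frac_eq0 frac_inj) polyXsubC_eq0.
have n4 : 4%:R != 0 :> L by rewrite (natrM _ 2 2) mulf_neq0.
have omE : om%:P%:F = (1 + sL) / 2%:R.
  by rewrite -[LHS]/(iota om) fmorph_div rmorphD rmorph1 rmorph_nat.
have dc c : frac_der fracP (iota c) = 0.
  by rewrite (frac_der_tofrac frac_inj) derivC rmorph0.
have dt : frac_der fracP t = 1.
  by rewrite (frac_der_tofrac frac_inj) derivX rmorph1.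
apply: (has_rate_intro frac_inj); first exact: om_pt_on_curve.
- have [_ eK _ eB] := iota_om s.
  rewrite mulf_neq0 ?expf_neq0 // -?/sL -?eK ?fmorph_eq0 ?om_scale_neq0 //.
  rewrite subr_eq0; apply/eqP => e.
  have eU : ('X - (tors s)%:P)%:F = t - tors sL.
    by rewrite rmorphB /=; have [<- _ _ _] := iota_om s.
  have : ('X - (tors s)%:P) ^+ 2 = (om_B s)%:P.
    apply: frac_inj; rewrite rmorphXn eU -[RHS]/(iota (om_B s)) eB -/sL.
    by apply: (mulIf (_ : ((t - tors sL) ^+ 2)^-1 != 0)); rewrite ?invr_eq0 ?expf_neq0 // -e divff ?expf_neq0.
  move/(congr1 (fun q : {poly F} => size q)); rewrite size_polyC size_exp_XsubC.
  by case: (_ != 0).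
rewrite -[om_x _ _]/(om_x sL t) -[om_y _ _]/(om_y sL t) /om_x /om_y.
have [eT eK eA eB] := iota_om s; have [eT' _ _ _] := iota_om (- s).
rewrite rmorphN in eT'.
have dD := frac_derD frac_inj fracP; have dM := frac_derM frac_inj fracP.
have dU : frac_der fracP (t - tors sL) = 1.
  by rewrite dD dt -eT -rmorphN dc addr0.
rewrite dD -eT' dc add0r dM -eK -(rmorphXn iota 2) dc mul0r add0r.
rewrite (dD _ (_ / _)) (dD _ (om_A sL)) dU -eA dc addr0 (der_div dM) // dU -eB dc mul0r sub0r mulr1.
rewrite !(rmorphXn iota) eB omE eK /om_scale -/sL.
by field: sL_sq; rewrite U0 h2 n4.
Qed.

Let m := p./2.
Let pE : p = (2 * m).+1.
Proof.
have := odd_double_half p; rewrite -/m -mul2n.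
by case/even_prime: p_prime => [e|->]; [move: p_gt7; rewrite e|rewrite add1n].
Qed.

Let charL : p \in [pchar L] := rmorph_pchar iota charF.
Let charP : p \in [pchar {poly F}] := rmorph_pchar polyC charF.

Let frobF (c : F) : c ^+ p = c. Proof. by rewrite -cardF expf_card. Qed.

Let frobD (R : comNzRingType) (x y : R) : p \in [pchar R] -> (x + y) ^+ p = x ^+ p + y ^+ p.
Proof. by move=> cR; rewrite -!(pFrobenius_autE cR) pFrobenius_autD_comm //; exact: mulrC. Qed.

Let frob_iota c : iota c ^+ p = iota c.
Proof. by rewrite -rmorphXn frobF. Qed.

Let frob_cubic x : (x ^+ 3 + aL * x + bL) ^+ p = (x ^+ p) ^+ 3 + aL * x ^+ p + bL.
Proof.
rewrite !frobD // [(aL * x) ^+ p]exprMn -[aL]/(iota a) -[bL]/(iota b) !frob_iota.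
by rewrite -!exprM mulnC.
Qed.

Let fE' : f%:F = t ^+ 3 + aL * t + bL.
Proof. by rewrite fE aLE bLE; ring. Qed.

(** The Frobenius endomorphism as a point: f(t) (f(t)^m)^2 = f(t)^p = f(t^p). *)
Definition frob_pt : option (L * L) := Some (t ^+ p, f%:F ^+ m).

Lemma frob_pt_on_curve : on_curve frob_pt.
Proof.
apply/eqP; rewrite -frob_cubic -fE' -exprM -exprS; congr (_ ^+ _).
by rewrite [RHS]pE mulnC.
Qed.

Let e0 : F := 7%:R.
Let e1 : F := tors s.
Let e2 : F := tors (- s).

Let s_neq0 : s != 0.
Proof.
by apply: contraNneq seven_neq0 => e; move/eqP: hs; rewrite e expr0n eq_sym oppr_eq0.
Qed.

Let roots_uniq : uniq [:: e0; e1; e2].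
Proof.
have d (s' : F) : s' ^+ 2 = - 7%:R -> e0 != tors s'.
  move=> hs'; apply/eqP => e.
  have es : s' = 2%:R * tors s' + 7%:R by rewrite /tors; field.
  have e21 : s' = 21%:R by rewrite es -e /e0; ring.
  have : 2%:R ^+ 6 * 7%:R = s' ^+ 2 + 7%:R :> F by rewrite e21; ring.
  rewrite hs' addNr => /eqP; rewrite mulf_eq0 (negbTE seven_neq0) orbF.
  by rewrite (negbTE (expf_neq0 _ two_neq0)).
rewrite /= !inE negb_or d // d ?sqrrN //= andbT.
apply/eqP => e; move/eqP: s_neq0; apply.
have -> : s = tors s - tors (- s) by rewrite /tors; field.
by rewrite -/e1 -/e2 e subrr.
Qed.

Let f_factor : f = ('X - e0%:P) * ('X - e1%:P) * ('X - e2%:P).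
Proof.
have h1 : e1 + e2 = - 7%:R by rewrite /e1 /e2 /tors; field.
have h2' : e1 * e2 = 14%:R by rewrite /e1 /e2 /tors; field: hs.
have -> : ('X - e0%:P) * ('X - e1%:P) * ('X - e2%:P) =
   ('X - e0%:P) * ('X ^+ 2 - (e1 + e2)%:P * 'X + (e1 * e2)%:P) :> {poly F}.
  by rewrite (polyCD e1 e2) (polyCM e1 e2); ring.
rewrite h1 h2' /weierstrass -mul_polyC /a /b /e0 !polyCN !polyC_natr; ring.
Qed.

Let f_rootE e : root f e = (e \in [:: e0; e1; e2]).
Proof. by rewrite f_factor !rootM !root_XsubC !inE orbA. Qed.

Let hornerf e : f.[e] = e ^+ 3 + a * e + b.
Proof. by rewrite /weierstrass !hornerE. Qed.

Let f_simple e : root f e -> exists2 g, f = ('X - e%:P) * g & g.[e] != 0.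
Proof.
rewrite f_rootE !inE; have := roots_uniq; rewrite /= !inE negb_or => /and3P[/andP[n01 n02] n12 _].
case/or3P => /eqP ->.
- exists (('X - e1%:P) * ('X - e2%:P)); first by rewrite f_factor mulrA.
  by rewrite hornerM !hornerXsubC mulf_neq0 // subr_eq0.
- exists (('X - e0%:P) * ('X - e2%:P)); first by rewrite f_factor mulrA [_ * ('X - e0%:P)]mulrC.
  by rewrite hornerM !hornerXsubC mulf_neq0 // subr_eq0 // eq_sym.
- exists (('X - e0%:P) * ('X - e1%:P)); first by rewrite f_factor mulrC.
  by rewrite hornerM !hornerXsubC mulf_neq0 // subr_eq0 // eq_sym.
Qed.

(** If x = alpha t^p + beta lies on the curve, then alpha t + beta maps the
    zeros of f to zeros of f; the identity is the only affine bijection to do so. *)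
Let affine_frob (al be : F) y : al != 0 ->
  on_curve (Some (iota al * t ^+ p + iota be, y)) -> al = 1 /\ be = 0.
Proof.
move=> al0 /eqP; set g := al%:P * 'X + be%:P.
have -> : iota al * t ^+ p + iota be = g%:F ^+ p.
  by rewrite /g rmorphD rmorphM /= frobD // exprMn -[al%:P%:F]/(iota al) -[be%:P%:F]/(iota be) !frob_iota.
rewrite -frob_cubic => ey.
pose R := g ^+ 3 + a%:P * g + b%:P.
have eR : g%:F ^+ 3 + aL * g%:F + bL = R%:F by rewrite /R; move: (g) => q; rewrite !rmorphD rmorphXn [(a%:P * q)%:F]rmorphM.
rewrite eR in ey.
have [cnd d0 eyn] := lowest_termsP frac_inj fracP y.
move: (lowest_terms fracP y) cnd d0 eyn => [n d] /= cnd d0 eyn.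
have key : f * n ^+ 2 = R ^+ p * d ^+ 2.
  apply: frac_inj; rewrite !rmorphM !rmorphXn -ey -eyn; ring.
have Rroot e : root f e -> R.[e] = 0.
  move=> fe; apply/eqP/negPn/negP => Re.
  have [f1 ef f1e] := f_simple fe.
  have de : root d e.
    have := congr1 (fun q : {poly F} => q.[e]) key.
    rewrite /= (hornerM f) (hornerM (R ^+ p)) !horner_exp (rootP fe) mul0r => /esym/eqP.
    by rewrite mulf_eq0 !expf_eq0 (negbTE Re) andbF.
  have ne : n.[e] != 0 by apply: (coprimep_root _ de); rewrite coprimep_sym.
  have /factor_theorem[d1 ed] := de.
  have X0 : 'X - e%:P != 0 by rewrite polyXsubC_eq0.
  have : f1 * n ^+ 2 = R ^+ p * d1 ^+ 2 * ('X - e%:P).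
    by apply: (mulfI X0); rewrite mulrA -ef key ed; ring.
  move/(congr1 (fun q : {poly F} => q.[e])); rewrite /= (hornerM f1) [in RHS]hornerM horner_exp.
  rewrite hornerXsubC subrr mulr0 => /eqP.
  by rewrite mulf_eq0 expf_eq0 (negbTE f1e) (negbTE ne).
pose c0 := 98%:R * al ^+ 3 + be ^+ 3 - 35%:R * be - 98%:R.
pose c1 := 35%:R * al ^+ 3 + 3%:R * al * be ^+ 2 - 35%:R * al.
pose c2 := 3%:R * al ^+ 2 * be.
have q0 : Poly [:: c0; c1; c2] = 0.
  apply: (@roots_geq_poly_eq0 _ _ [:: e0; e1; e2]) => //; last exact: size_Poly.
  apply/allP => e; rewrite -f_rootE => fe; apply/rootP.
  rewrite horner_Poly /= mul0r add0r -(Rroot e fe).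
  rewrite /R /g !hornerE /=.
  have he : e ^+ 3 = - (a * e) - b.
    by apply/eqP; rewrite -subr_eq0 -(rootP fe) hornerf; apply/eqP; ring.
  have -> : (al * e + be) ^+ 3 = al ^+ 3 * e ^+ 3 + 3%:R * al ^+ 2 * be * e ^+ 2 + 3%:R * al * be ^+ 2 * e + be ^+ 3 by ring.
  by rewrite he /c0 /c1 /c2 /a /b; ring.
have cz i : [:: c0; c1; c2]`_i = 0 by rewrite -coef_Poly q0 coef0.
have be0 : be = 0.
  have n3 : 3%:R * al ^+ 2 != 0 by apply: mulf_neq0 => //; exact: expf_neq0.
  by apply: (mulfI n3); rewrite mulr0; have := cz 2.
split=> //.
have al2 : al ^+ 2 = 1.
  have n35 : 35%:R * al != 0 by rewrite mulf_neq0 // (natrM _ 5 7) mulf_neq0.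
  apply: (mulfI n35); apply/eqP; rewrite -subr_eq0; apply/eqP; rewrite -(cz 1) /= /c1 be0; ring.
have n98 : 98%:R != 0 :> F by rewrite (_ : 98%:R = 2%:R * (7%:R * 7%:R)) ?mulf_neq0 //; ring.
apply: (mulfI n98); apply/eqP; rewrite -subr_eq0; apply/eqP; rewrite -(cz 0) /= /c0 be0.
have -> : al ^+ 3 = al by rewrite exprS al2 mulr1.
by ring.
Qed.

(* the zeros in F of f, of f^m - 1 and of f^m + 1 exhaust F *)
Let level (c : F) : seq F := enum [pred x | f.[x] ^+ m == c].
Let Zc (c : F) : {poly F} := \prod_(x <- level c) ('X - x%:P).

Let m_gt0 : (0 < m)%N.
Proof. by rewrite lt0n; apply: contraTneq p_gt7 => m0; rewrite pE m0. Qed.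

Let one_neq_m1 : 1 != -1 :> F.
Proof. by rewrite -subr_eq0 opprK. Qed.

Let level_perm : perm_eq (enum F) ([:: e0; e1; e2] ++ (level 1 ++ level (-1))).
Proof.
apply: uniq_perm; first exact: enum_uniq.
  rewrite cat_uniq roots_uniq; apply/andP; split=> //; apply/andP; split.
    apply/hasPn => x h; suff: x \notin [:: e0; e1; e2] by [].
    rewrite -f_rootE; apply/negP => /rootP fx.
    move: h; rewrite mem_cat !mem_enum !inE.
    rewrite fx expr0n -(prednK m_gt0) /= eq_sym oner_eq0 /=.
    by rewrite eq_sym oppr_eq0 oner_eq0.
  rewrite cat_uniq !enum_uniq andbT; apply/hasPn => x hx; suff: x \notin level 1 by [].
  by move: hx; rewrite !mem_enum !inE => /eqP ->; rewrite eq_sym.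
move=> x; rewrite mem_enum inE !mem_cat !mem_enum !inE; apply/esym.
have [fx|fx] := boolP (root f x); first by move: fx; rewrite f_rootE !inE => ->.
have h : (f.[x] ^+ m) ^+ 2 = 1.
  apply: (mulIf fx); rewrite mul1r -exprM -exprSr mulnC -pE; exact: frobF.
by move/eqP: h; rewrite sqrf_eq1 => ->; rewrite orbT.
Qed.

Let pcard : p = (3 + size (level 1%R) + size (level (-1)%R))%N.
Proof. by have := perm_size level_perm; rewrite -cardE cardF !size_cat /= addnA. Qed.

Let sum_level : \sum_(x : F) f.[x] ^+ m = (size (level 1%R))%:R - (size (level (-1)%R))%:R.
Proof.
have slev c : \sum_(x <- level c) f.[x] ^+ m = c *+ size (level c).
  rewrite big_seq (eq_bigr (fun=> c)) => [|x]; last by rewrite mem_enum inE => /eqP.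
  by rewrite -big_seq big_const_seq count_predT iter_addr_0.
rewrite -big_enum (perm_big _ level_perm) /= !big_cons big_cat /= !slev mulNrn.
have z e : e \in [:: e0; e1; e2] -> f.[e] ^+ m = 0.
  by rewrite -f_rootE => /rootP ->; rewrite expr0n -(prednK m_gt0).
by rewrite !z ?inE ?eqxx ?orbT // !add0r.
Qed.

Let Xp_factor : 'X^p - 'X = f * Zc 1 * Zc (-1).
Proof.
rewrite -{1}cardF finField_genPoly -big_enum (perm_big _ level_perm) /= !big_cons big_cat.
by rewrite f_factor !mulrA.
Qed.

Let size_Zc c : size (Zc c) = (size (level c)).+1.
Proof. by rewrite size_prod_XsubC. Qed.
Let Zc_neq0 c : Zc c != 0.
Proof. by rewrite -size_poly_eq0 size_Zc. Qed.

Let Zc_dvd c : Zc c %| f ^+ m - c%:P.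
Proof.
apply: uniq_roots_dvdp; last by rewrite uniq_rootsE enum_uniq.
apply/allP => x; rewrite mem_enum inE => /eqP h.
by apply/rootP; rewrite hornerD hornerN hornerC horner_exp h subrr.
Qed.

Let f_neq0 : f != 0 := weierstrass_neq0 a b.
Let size_f : size f = 4%N := size_weierstrass a b.

(* The abscissa of Frobenius minus the identity is
   (f (f^m + 1)^2 - (t^p + t) (t^p - t)^2) / (t^p - t)^2. Here t^p - t is
   f Zc(1) Zc(-1), and Zc(-1) divides f^m + 1, so f Zc(-1)^2 cancels. *)
Let numF : {poly F} :=
  ((f ^+ m + 1) %/ Zc (-1)) ^+ 2 - ('X^p + 'X) * (f * Zc 1 ^+ 2).
Let denF : {poly F} := f * Zc 1 ^+ 2.
Let qE : f ^+ m + 1 = (f ^+ m + 1) %/ Zc (-1) * Zc (-1).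
Proof. by rewrite divpK //; have := Zc_dvd (-1); rewrite polyCN opprK. Qed.

Let frob_sub_rep : x_rep frac (add_pt frob_pt (opp_pt (generic_pt frac))) numF denF.
Proof.
rewrite /numF /denF; move: qE; set q := _ %/ _ => hq.
have cq : coprimep q (f ^+ m - 1) && coprimep q f.
  have c1 : coprimep (f ^+ m + 1) f.
    rewrite -(prednK m_gt0) exprSr coprimep_sym coprimep_addl_mul; exact: coprimep1.
  have c2 : coprimep (f ^+ m + 1) (f ^+ m - 1).
    have -> : f ^+ m + 1 = 1 * (f ^+ m - 1) + 2%:R%:P by rewrite polyC_natr; ring.
    rewrite coprimep_sym coprimep_addl_mul -[2%:R%:P]mulr1 mul_polyC coprimepZr //.
    exact: coprimep1.
  have dq : q %| f ^+ m + 1 by rewrite hq dvdp_mulr.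
  by rewrite !(coprimep_dvdr dq).
case/andP: cq => c1 c2.
split.
  rewrite coprimep_sym -mulNr addrC coprimep_addl_mul coprimep_expr //.
  rewrite coprimep_sym coprimepMr c2 coprimep_expr //.
  by apply: coprimep_dvdl c1; exact: (Zc_dvd 1).
have tpt : t ^+ p - t = f%:F * (Zc 1)%:F * (Zc (-1))%:F.
  by rewrite -!rmorphM -Xp_factor rmorphB rmorphXn.
have Z0 c : (Zc c)%:F != 0 by rewrite (frac_eq0 frac_inj).
have F0 : f%:F != 0 by rewrite (frac_eq0 frac_inj).
have ne : t ^+ p != t by rewrite -subr_eq0 tpt !mulf_neq0.
rewrite /frob_pt /generic_pt /opp_pt add_chord //=; split.
  by rewrite (frac_eq0 frac_inj) mulf_neq0 ?expf_neq0.
have qF : f%:F ^+ m + 1 = q%:F * (Zc (-1))%:F by rewrite -rmorphM -hq -(rmorphXn frac) -(rmorph1 frac) -rmorphD.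
rewrite opprK qF tpt.
have E1 (u z : {poly F}) : (q ^+ 2 - ('X^p + 'X) * (u * z ^+ 2))%:F =
    q%:F ^+ 2 - (t ^+ p + t) * (u%:F * z%:F ^+ 2).
  by rewrite rmorphB (rmorphM _ (_ + _)) (rmorphM _ u) rmorphD !rmorphXn.
have E2 (u z : {poly F}) : (u * z ^+ 2)%:F = u%:F * z%:F ^+ 2 by rewrite (rmorphM _ u) rmorphXn.
rewrite E1 E2.
by move: F0 (Z0 1) (Z0 (-1)); move: f%:F (Zc 1)%:F (Zc (-1))%:F => x y z x0 y0 z0; field; rewrite x0 y0 z0.
Qed.

Let f_frob : f ^+ p = ('X^p) ^+ 3 + a%:P * 'X^p + b%:P.
Proof.
rewrite /weierstrass -mul_polyC !frobD // [(a%:P * _) ^+ p]exprMn -!polyC_exp !frobF.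
by rewrite -!exprM mulnC.
Qed.

Let size_num : size numF = (5 + 2 * size (level 1%R))%N.
Proof.
have eN : numF * (f * Zc (-1) ^+ 2) = 'X^((2 * p).+1) +
    ('X^(p + 2) + 2%:R%:P * f ^+ m.+1 + a%:P * 'X^p + b%:P + f - 'X^3).
  have -> : numF * (f * Zc (-1) ^+ 2) =
      f * ((f ^+ m + 1) %/ Zc (-1) * Zc (-1)) ^+ 2 - ('X^p + 'X) * (f * Zc 1 * Zc (-1)) ^+ 2.
    by rewrite /numF; ring.
  rewrite -qE -Xp_factor.
  have e : f * (f ^+ m) ^+ 2 = ('X^p) ^+ 3 + a%:P * 'X^p + b%:P.
    by rewrite -f_frob -exprM -exprS mulnC -pE.
  have -> : f * (f ^+ m + 1) ^+ 2 = f * (f ^+ m) ^+ 2 + 2%:R * f ^+ m.+1 + f by rewrite (exprS f m); ring.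
  have X1 : 'X^((2 * p).+1) = 'X * ('X^p) ^+ 2 :> {poly F} by rewrite exprS mulnC exprM.
  have X2 : 'X^(p + 2) = 'X^p * 'X ^+ 2 :> {poly F} by rewrite exprD.
  rewrite e polyC_natr X1 X2; ring.
have sN : size (numF * (f * Zc (-1) ^+ 2)) = (2 * p).+2.
  rewrite eN size_polyDl size_polyXn // ltnS.
  have p7 := p_gt7; have pE' := pE.
  have sf : (size (2%:R%:P * f ^+ m.+1)%R <= (2 * p).+1)%N.
    rewrite mul_polyC (leq_trans (size_scale_leq _ _)) //.
    rewrite (leq_trans (size_poly_exp_leq _ _)) // size_f /= ltnS.
    by clear -p7 pE'; lia.
  rewrite (leq_trans (size_polyD _ _)) // geq_max size_polyN size_polyXn; apply/andP; split; last by clear -p7; lia.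
  rewrite (leq_trans (size_polyD _ _)) // geq_max size_f; apply/andP; split; last by clear -p7; lia.
  rewrite (leq_trans (size_polyD _ _)) // geq_max (leq_trans (size_polyC_leq1 _)) // andbT.
  rewrite (leq_trans (size_polyD _ _)) // geq_max; apply/andP; split; last first.
    by rewrite mul_polyC (leq_trans (size_scale_leq _ _)) // size_polyXn; clear -p7; lia.
  rewrite (leq_trans (size_polyD _ _)) // geq_max sf andbT size_polyXn; clear -p7; lia.
have n0 : numF != 0 by apply: contra_eq_neq sN => ->; rewrite mul0r size_poly0.
have sq : size (Zc (-1) ^+ 2) = (2 * size (level (-1)%R)).+1.
  by rewrite expr2 size_mul ?Zc_neq0 // size_Zc; clear; lia.
have := sN; rewrite size_mul ?mulf_neq0 ?expf_neq0 // size_mul ?expf_neq0 // sq size_f.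
have := pcard; move: (size numF) (size (level 1)) (size (level (-1))) => x y z.
by clear; lia.
Qed.

Let size_den : size denF = (4 + 2 * size (level 1%R))%N.
Proof.
rewrite /denF size_mul ?expf_neq0 // expr2 size_mul ?Zc_neq0 // size_Zc size_f; clear; lia.
Qed.

(** Let N and N' count the x for which f(x)^m is 1 and -1. The cancellation
    leaves degree 4 + 2 N, while 3 + N + N' = p vanishes in F. *)
Lemma frob_sub_height :
  (height fracP (add_pt frob_pt (opp_pt (generic_pt frac))))%:R
    = 1 + \sum_(x : F) f.[x] ^+ m :> F.
Proof.
rewrite (height_rep frac_inj fracP frob_sub_rep) size_num size_den sum_level.
rewrite (maxn_idPl _); last by rewrite leq_add2r.
have : (3 + size (level 1%R) + size (level (-1)%R))%:R = 0 :> F by rewrite -pcard (pcharf0 charF).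
rewrite !natrD => e; rewrite -[(5 + _).-1]/(4 + _)%N natrD natrM.
apply/eqP; rewrite -subr_eq0 -e; apply/eqP; ring.
Qed.

Section NormP.
Variables C Dd : int.
Hypotheses (normp : p%:Z = C ^+ 2 + 7 * Dd ^+ 2) (piF : C%:~R + Dd%:~R * s = 0 :> F).

Let mkpt (Q : option (L * L)) (h : on_curve Q) : pt :=
  exist (fun R => is_true (on_curve R)) Q h.
Let P : pt := mkpt (generic_on_curve frac_inj a b).
Let W : pt := mkpt (om_pt_on_curve hs).
(* the endomorphism C + k + D s: with s = 2 omega - 1 its coordinates on 1 and
   omega are C + k - D and 2 D *)
Let Pi (k : int) : pt := P *~ (C - Dd + k) + W *~ (2 * Dd).

(** The height is the norm form of Z[omega] on the multiples of P, here the
    norm (C + k)^2 + 7 D^2. *)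
Lemma height_Pi k : (height fracP (sval (Pi k)))%:Z = p%:Z + 2 * k * C + k ^+ 2.
Proof.
have := height_form P W (C - Dd + k) (2 * Dd); rewrite /= -/(Pi k) => ->.
have hP : height fracP (sval P) = 1%N := generic_height frac_inj fracP.
have hW : height fracP (sval W) = 2%N := om_height hs.
have hWP : height fracP (sval (W - P)) = 2%N := om_height_sub.
have hPW : height fracP (sval (P + W)) = 4%N.
  have := height_parallelogram frac_inj fracP two_neq0 (D_neq0 frac_inj a b) disc_neq0 (svalP W) (svalP P).
  rewrite -[add_pt _ (opp_pt _)]/(sval (W - P)) hWP -[add_pt _ _]/(sval (W + P)) hP hW.
  by rewrite [W + P]addrC => /(congr1 (fun i => i - 2)%N); rewrite addnK.
rewrite hP hW hPW normp; ring.
Qed.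

Lemma Pi_pole : pole_at_inf fracP (sval (Pi 0)).
Proof.
apply: pole_add; apply: pole_mulz; last exact: om_pole.
by rewrite (pole_at_infP frac_inj fracP (generic_rep frac)) size_polyX size_poly1.
Qed.

(** The multiplication by C + D s is inseparable: it acts on the tangent space
    as its residue in F, which is zero. *)
Lemma Pi_rate : rate (Pi 0) 0.
Proof.
have rP : rate P 1.
  apply: (has_rate_intro frac_inj); rewrite ?rmorph1 ?oner_neq0 ?mulr1 //.
  - exact: generic_on_curve.
  - by rewrite (frac_der_tofrac frac_inj) derivX rmorph1.
have -> : 0 = (C - Dd + 0)%:~R * 1 + (2 * Dd)%:~R * om :> F.
  by rewrite -piF addr0 mulr1 intrM rmorphB /= /om; field.
by apply: rateD; apply: rate_mulz => //; exact: om_rate.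
Qed.

Lemma deriv_eq0_small (q : {poly F}) : (size q <= p.+1)%N -> q^`() = 0 ->
  q = (q`_p)%:P * 'X^p + (q`_0)%:P.
Proof.
move=> sq dq; apply/polyP => i; rewrite coefD coefCM coefXn coefC.
have [->|i0] := eqVneq i 0%N.
  by rewrite (_ : (0 == p)%N = false) ?mulr0 ?add0r //; case: p p_gt7.
rewrite addr0; have [->|ip] := eqVneq i p; first by rewrite mulr1.
rewrite mulr0; have [h|h] := leqP (size q) i; first by rewrite nth_default.
have lip : (i < p)%N by rewrite ltn_neqAle ip -ltnS (leq_trans h).
have := congr1 (fun r : {poly F} => r`_i.-1) dq.
rewrite /= coef_deriv coef0 prednK ?lt0n // => /eqP.
rewrite -mulr_natr mulf_eq0 => /orP[/eqP //|].
by rewrite (negbTE (natF_neq0 _)) // lt0n i0.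
Qed.

(** With rate zero the abscissa is a function of t^p. Having degree p and a
    pole at infinity, it is alpha t^p + beta, and affine_frob leaves t^p. *)
Lemma Pi_frob : sval (Pi 0) = frob_pt \/ sval (Pi 0) = opp_pt frob_pt.
Proof.
have := height_Pi 0; rewrite mulr0 mul0r expr0n !addr0 => /eqP; rewrite eqz_nat => /eqP hh.
have := Pi_pole; have := Pi_rate; have := svalP (Pi 0); rewrite /rate.
move: (sval (Pi 0)) hh => Q hh.
case: Q hh => [[x y]|] hh cQ; last first.
  move: hh; rewrite /height /= ?size_poly1 ?size_poly0 => hh _ _.
  by move: p_gt7; rewrite -hh.
move=> [rx _]; rewrite /pole_at_inf -[x_pair _ _]/(lowest_terms fracP x); rewrite polyC0 rmorph0 mul0r in rx.
have [cXZ Z0 eX] := lowest_termsP frac_inj fracP x.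
move: hh; rewrite /height -[x_pair _ _]/(lowest_terms fracP x).
have derx := frac_derE frac_inj fracP Z0 eX.
move: (lowest_terms fracP x) cXZ Z0 eX derx => [X Z] /= cXZ Z0 eX derx hh lt.
rewrite (maxn_idPl (ltnW lt)) in hh.
have sX : size X = p.+1 by rewrite -hh prednK // (leq_ltn_trans _ lt).
have Zf0 : Z%:F != 0 by rewrite (frac_eq0 frac_inj).
have e : X^`() * Z = X * Z^`().
  apply: frac_inj; rewrite !rmorphM -eX [RHS]mulrAC; congr (_ * _).
  apply/eqP; rewrite -subr_eq0; apply/eqP.
  by apply: (mulIf (_ : (Z%:F)^-1 != 0)); rewrite ?invr_eq0 // -derx rx mul0r.
have dZ : Z^`() = 0.
  apply/eqP; apply: contraT => dz.
  have cZX : coprimep Z X by rewrite coprimep_sym.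
  have : Z %| Z^`() by rewrite -(Gauss_dvdpr _ cZX) -e dvdp_mull.
  by move/(dvdp_leq dz); rewrite leqNgt lt_size_deriv.
have dX : X^`() = 0 by apply: (mulIf Z0); rewrite e dZ mulr0 mul0r.
have sXp : (size X <= p.+1)%N by rewrite sX.
have XE := deriv_eq0_small sXp dX.
have sZp : (size Z <= p.+1)%N by rewrite -sX ltnW.
have ZE : Z = (Z`_0)%:P.
  rewrite {1}(deriv_eq0_small sZp dZ) [Z`_p]nth_default ?mul0r ?add0r //.
  by move: lt; rewrite sX ltnS.
have z0 : Z`_0 != 0 by apply: contraNneq Z0 => z; rewrite ZE z.
have Xp0 : X`_p != 0.
  have : lead_coef X != 0 by rewrite lead_coef_eq0 -size_poly_eq0 sX.
  by rewrite lead_coefE sX.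
have xE : x = iota (X`_p / Z`_0) * t ^+ p + iota (X`_0 / Z`_0).
  have eXF : X%:F = iota X`_p * t ^+ p + iota X`_0.
    by rewrite [in LHS]XE rmorphD rmorphM rmorphXn.
  have eZF : Z%:F = iota Z`_0 by rewrite [in LHS]ZE.
  apply: (mulIf Zf0); rewrite eX eXF eZF !fmorph_div.
  by field; rewrite fmorph_eq0.
have alp : X`_p / Z`_0 != 0 by rewrite mulf_neq0 ?invr_eq0.
rewrite xE in cQ; have [al1 be0] := affine_frob alp cQ.
rewrite xE; move: cQ; rewrite al1 be0 rmorph1 rmorph0 addr0 mul1r => cQ.
exact: (same_x (D_neq0 frac_inj a b) cQ frob_pt_on_curve).
Qed.

(** If Frobenius is C + D s, up to sign, then Frobenius minus 1 has norm
    p + 1 - 2 C or p + 1 + 2 C. Its height is also given by frob_sub_height. *)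
Theorem sum_legendre_split : (\sum_(x : F) f.[x] ^+ m) ^+ 2 = (4 * C ^+ 2)%:~R.
Proof.
have S k : (height fracP (sval (Pi k)))%:R = (2 * k * C + k ^+ 2)%:~R :> F.
  rewrite -[LHS]/((_)%:Z%:~R) height_Pi -addrA intrD.
  by rewrite -[(p%:Z)%:~R]/(p%:R) (pcharf0 charF) add0r.
have PiE k : Pi k = Pi 0 + P *~ k.
  by rewrite /Pi addr0 mulrzDr addrAC.
have hN (Q : pt) : height fracP (sval (- Q)) = height fracP (sval Q).
  by rewrite val_ptN; case: (sval Q) => [[]|].
have := frob_sub_height; pose FP := mkpt frob_pt_on_curve.
have -> : add_pt frob_pt (opp_pt (generic_pt frac)) = sval (FP - P) by [].
case: Pi_frob => e.
  have -> : FP - P = Pi (-1) by rewrite PiE; congr (_ + _); apply: pt_inj; rewrite e.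
  rewrite S => e'; have -> : \sum_(x : F) f.[x] ^+ m = (- 2 * C)%:~R.
    by apply: (addrI 1); rewrite -e' -[1]/(1%:~R) -intrD; congr (_%:~R); ring.
  by rewrite -rmorphXn; congr (_%:~R); ring.
have -> : FP - P = - Pi 1.
  rewrite PiE opprD mulr1z; congr (_ - _); apply: pt_inj.
  by rewrite val_ptN e opp_ptK.
rewrite hN S => e'; have -> : \sum_(x : F) f.[x] ^+ m = (2 * C)%:~R.
  by apply: (addrI 1); rewrite -e' -[1]/(1%:~R) -intrD; congr (_%:~R); ring.
by rewrite -rmorphXn; congr (_%:~R); ring.
Qed.

End NormP.

End FrobeniusPoint.

(** * The character sum over the prime field *)

Section FractionField.
Import FracField.
Local Open Scope quotient_scope.

Lemma tofrac_inj (R : idomainType) : injective (@tofrac R).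
Proof. by move=> x y /eqP; rewrite tofrac_eq => /eqP. Qed.

Lemma frac_repr (R : idomainType) (x : {fraction R}) :
  exists nd : R * R, (nd.2 != 0) && (x * tofrac nd.2 == tofrac nd.1).
Proof.
exists (\n_(repr x), \d_(repr x)); rewrite /= denom_ratioP /=; apply/eqP.
rewrite -{1}[x]reprK; unlock tofrac; rewrite -[LHS]pi_mul.
apply/eqmodP; rewrite /= /mulf /equivf !numden_Ratio ?oner_neq0 ?mulr1 ?mulf_neq0 //.
- by rewrite mulrC.
all: by rewrite ?mulf_neq0 ?denom_ratioP ?oner_neq0.
Qed.
End FractionField.

Lemma ndvd_sum_sq (p : nat) (C D : int) : prime p -> (7 < p)%N -> p%:Z = C ^+ 2 + 7 * D ^+ 2 ->
  ~~ (p%:Z %| D)%Z.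
Proof.
move=> pp p7 e; apply/negP => /dvdzP[q Dq].
have [q0|q0] := eqVneq q 0.
  move: e; rewrite Dq q0 mul0r expr0n /= mulr0 addr0 => e.
  have : (p = absz C * absz C)%N by apply/eqP; rewrite -eqz_nat PoszM !abszE -expr2 real_normK ?num_real // e.
  move=> e'; have : (absz C %| p)%N by rewrite e' dvdn_mulr.
  case/(primeP pp).2/orP=> /eqP h; move: e'; rewrite h; move: p7; clear; nia.
have : (1 <= q ^+ 2)%R by rewrite -gtz0_ge1 exprn_even_gt0.
have := sqr_ge0 C; have p7' : (7 < p%:Z) by [].
move: e; rewrite Dq exprMn; move: (C ^+ 2) (q ^+ 2) => c d e c0 d1.
by move: p7'; rewrite expr2 in e; nia.
Qed.

(** Take s = - C / D, a square root of -7 for which C + D s vanishes. *)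
Theorem sum_legendre_Fp (p : nat) (C D : int) : prime p -> (7 < p)%N ->
  p%:Z = C ^+ 2 + 7 * D ^+ 2 ->
  (\sum_(x : 'F_p) (weierstrass (- 35%:R) (- 98%:R) : {poly 'F_p}).[x] ^+ p./2) ^+ 2 = (4 * C ^+ 2)%:~R.
Proof.
move=> pp p7 e.
have charF : p \in [pchar 'F_p] by exact: pchar_Fp.
have D0 : D%:~R != 0 :> 'F_p.
  by rewrite -(dvdz_pcharf charF) (ndvd_sum_sq pp p7 e).
have hs : (- C%:~R / D%:~R : 'F_p) ^+ 2 = - 7%:R.
  have : (p%:Z)%:~R = 0 :> 'F_p by exact: pcharf0 charF.
  rewrite e rmorphD rmorphM !rmorphXn /= => h.
  rewrite expr_div_n sqrrN; apply: (mulIf (expf_neq0 2 D0)); rewrite mulfVK ?expf_neq0 //.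
  by move/eqP: h; rewrite addr_eq0 => /eqP ->; rewrite mulNr.
apply: (sum_legendre_split (@tofrac_inj _) (@frac_repr _) pp p7 (card_Fp pp) hs e).
by rewrite mulrC divfK // addrN.
Qed.

(** * Clausen's identity *)

(** The coefficients of the hypergeometric series 2F1(1/6, 5/6; 1; 432 x) and
    3F2(1/6, 1/2, 5/6; 1, 1; 1728 x). *)
Definition hyp_a (k : nat) : nat := 'C(3 * k, k) * 'C(6 * k, 3 * k).
Definition hyp_c (k : nat) : nat := 'C(2 * k, k) * 'C(3 * k, k) * 'C(6 * k, 3 * k).

Lemma hyp_cE k : hyp_c k = ('C(2 * k, k) * hyp_a k)%N.
Proof. by rewrite /hyp_c -mulnA. Qed.

Lemma hyp_a_fact k : (hyp_a k * (k`! * (2 * k)`! * (3 * k)`!) = (6 * k)`!)%N.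
Proof.
have h1 := @bin_fact (3 * k) k; have h2 := @bin_fact (6 * k) (3 * k).
rewrite (_ : 3 * k - k = 2 * k)%N in h1; last by lia.
rewrite (_ : 6 * k - 3 * k = 3 * k)%N in h2; last by lia.
rewrite -h2 -?[in RHS]h1 /hyp_a; [lia|lia..].
Qed.

Section Clausen.
Variable R : realFieldType.

Lemma natr_neq0 n : n.+1%:R != 0 :> R.
Proof. by rewrite pnatr_eq0. Qed.

Lemma natr_fact n : n.+1`!%:R = n.+1%:R * n`!%:R :> R.
Proof. by rewrite factS natrM. Qed.

Lemma hyp_a_rec k :
  (k.+1%:R) ^+ 2 * (hyp_a k.+1)%:R =
  12 * (6 * k%:R + 1) * (6 * k%:R + 5) * (hyp_a k)%:R :> R.
Proof.
have f0 n : n`!%:R != 0 :> R by rewrite pnatr_eq0 -lt0n fact_gt0.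
have aE j : (hyp_a j)%:R = (6 * j)`!%:R / (j`!%:R * (2 * j)`!%:R * (3 * j)`!%:R) :> R.
  by rewrite -hyp_a_fact !natrM mulfK // !mulf_neq0.
rewrite !aE (_ : 6 * k.+1 = (6 * k).+4.+2)%N; last by lia.
rewrite (_ : 2 * k.+1 = (2 * k).+2)%N; last by lia.
rewrite (_ : 3 * k.+1 = (3 * k).+3)%N; last by lia.
rewrite !natr_fact -!natr1 !natrM.
have K : 0 <= k%:R :> R := ler0n _ k.
field; rewrite !f0 /=.
by apply/and5P; split; lra.
Qed.

Lemma hyp_c_rec k :
  (k.+1%:R) ^+ 3 * (hyp_c k.+1)%:R =
  24 * (6 * k%:R + 1) * (2 * k%:R + 1) * (6 * k%:R + 5) * (hyp_c k)%:R :> R.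
Proof.
have f0 n : n`!%:R != 0 :> R by rewrite pnatr_eq0 -lt0n fact_gt0.
have bE j : 'C(2 * j, j)%:R = (2 * j)`!%:R / (j`!%:R * j`!%:R) :> R.
  have h := @bin_fact (2 * j) j.
  rewrite (_ : 2 * j - j = j)%N in h; last by lia.
  by rewrite -h ?leq_pmull // !natrM mulfK // mulf_neq0.
have K : 0 <= k%:R :> R := ler0n _ k.
have e : k.+1%:R * 'C(2 * k.+1, k.+1)%:R = 2 * (2 * k%:R + 1) * 'C(2 * k, k)%:R :> R.
  rewrite !bE (_ : 2 * k.+1 = (2 * k).+2)%N; last by lia.
  rewrite !natr_fact -!natr1 !natrM; field; rewrite !f0 /=; lra.
rewrite !hyp_cE (natrM _ _ (hyp_a k.+1)) (natrM _ _ (hyp_a k)).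
have -> : k.+1%:R ^+ 3 * ('C(2 * k.+1, k.+1)%:R * (hyp_a k.+1)%:R) =
  (k.+1%:R * 'C(2 * k.+1, k.+1)%:R) * (k.+1%:R ^+ 2 * (hyp_a k.+1)%:R) :> R by ring.
by rewrite e hyp_a_rec; ring.
Qed.

Lemma sub_nat_neq0 (u v j : nat) : (u * j != v)%N -> u%:R * j%:R - v%:R != 0 :> R.
Proof. by move=> h; rewrite -natrM subr_eq0 eqr_nat. Qed.

(** Coefficients of the recurrence satisfied by both sides of Clausen's
    formula. *)
Definition rec0 (n : R) : R := 20736 * (n + 1) * (3 * n + 1) * (3 * n + 5).
Definition rec1 (n : R) : R := - 24 * (2 * n + 3) * (18 * n ^+ 2 + 54 * n + 41).
Definition rec2 (n : R) : R := (n + 2) ^+ 3.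

Lemma rec_unique (u v : nat -> R) : u 0%N = v 0%N -> u 1%N = v 1%N ->
  (forall n, rec0 n%:R * u n + rec1 n%:R * u n.+1 + rec2 n%:R * u n.+2 = 0) ->
  (forall n, rec0 n%:R * v n + rec1 n%:R * v n.+1 + rec2 n%:R * v n.+2 = 0) ->
  forall n, u n = v n.
Proof.
move=> e0 e1 hu hv n.
suff [] : u n = v n /\ u n.+1 = v n.+1 by [].
elim: n => [|n [i0 i1]] //; split=> //.
have r2 : rec2 n%:R != 0.
  by rewrite expf_neq0 // -(natrD _ n 2) pnatr_eq0 addn2.
apply: (mulfI r2); apply: (addrI (rec0 n%:R * u n + rec1 n%:R * u n.+1)).
by rewrite hu i0 i1 hv.
Qed.

Section Square.
Let al k : R := (hyp_a k)%:R.
Let rho (J : R) : R := J ^+ 2 / (12 * (6 * J - 5) * (6 * J - 1)).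

Let nz5 (j : nat) : 6 * j%:R - 5 != 0 :> R.
Proof. by apply: (sub_nat_neq0 (v := 5)); apply/eqP; lia. Qed.
Let nz1 (j : nat) : 6 * j%:R - 1 != 0 :> R.
Proof. by apply: (sub_nat_neq0 (v := 1)); apply/eqP; lia. Qed.
Let nz11 (j : nat) : 6 * j%:R - 11 != 0 :> R.
Proof. by apply: (sub_nat_neq0 (v := 11)); apply/eqP; lia. Qed.
Let nz7 (j : nat) : 6 * j%:R - 7 != 0 :> R.
Proof. by apply: (sub_nat_neq0 (v := 7)); apply/eqP; lia. Qed.

Let al_down j : al j = rho j.+1%:R * al j.+1.
Proof.
have := hyp_a_rec j; rewrite -/(al j) -/(al j.+1) => h.
have e5 : 6 * j.+1%:R - 5 = 6 * j%:R + 1 :> R by rewrite -natr1; ring.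
have e1 : 6 * j.+1%:R - 1 = 6 * j%:R + 5 :> R by rewrite -natr1; ring.
have := nz5 j.+1; have := nz1 j.+1; rewrite /rho e5 e1 => n1 n5.
apply: (mulfI (_ : 12 * (6 * j%:R + 1) * (6 * j%:R + 5) != 0)).
  by rewrite !mulf_neq0 // pnatr_eq0.
rewrite -h; field; rewrite n1 n5 //.
Qed.

(** Creative telescoping. All three sums are written with the terms T k of the
    longest one, using [al_down] to express earlier coefficients by later ones;
    the factor rho vanishes at the added terms. The combination of summands is
    then G (k + 1) - G k for the certificate built on Q. *)
Lemma square_rec n :
  let u m := \sum_(k < m.+1) al k * al (m - k) in
  rec0 n%:R * u n + rec1 n%:R * u n.+1 + rec2 n%:R * u n.+2 = 0.
Proof.
move=> u; pose J k : R := (n.+2 - k)%:R; pose T k := al k * al (n.+2 - k).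
have Jn2 : J n.+2 = 0 by rewrite /J subnn.
have Jn1 : J n.+1 = 1 by rewrite /J subSnn.
have rho0 : rho 0 = 0 by rewrite /rho expr0n mul0r.
have u1 : u n.+1 = \sum_(k < n.+3) rho (J k) * T k.
  rewrite [RHS]big_ord_recr /= Jn2 rho0 mul0r addr0; apply: eq_bigr => k _.
  have lk := ltn_ord k; rewrite /T /J (subSn (_ : (k <= n.+1)%N)) //.
  by rewrite (al_down (n.+1 - k)); ring.
have u0 : u n = \sum_(k < n.+3) rho (J k) * rho (J k - 1) * T k.
  rewrite [RHS]big_ord_recr /= Jn2 rho0 !mul0r addr0.
  rewrite [RHS]big_ord_recr /= Jn1 subrr rho0 mulr0 mul0r addr0.
  apply: eq_bigr => k _; have lk := ltn_ord k.
  rewrite /T /J !subSn //; last exact: leqW.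
  by rewrite (al_down (n - k)) (al_down (n - k).+1) -[(n - k).+2%:R]natr1 addrK; ring.
pose Q (k : R) : R := 114 + 129 * n%:R + 36 * n%:R ^+ 2 - 62 * k - 36 * n%:R * k.
pose G k : R := if (k < n.+3)%N then
  k%:R ^+ 2 * Q k%:R / ((6 * J k - 5) * (6 * J k - 1)) * T k else 0.
have -> : rec0 n%:R * u n + rec1 n%:R * u n.+1 + rec2 n%:R * u n.+2 =
    \sum_(0 <= k < n.+3) (G k.+1 - G k).
  rewrite u0 u1 /u !mulr_sumr -!big_split big_mkord; apply: eq_bigr => k _.
  have lk := ltn_ord k; rewrite /G lk /= -/(T k).
  have Jk : n%:R = J k + k%:R - 2 :> R.
    by rewrite /J -natrD subnK // -[n.+2]addn2 natrD addrK.
  have [e|ne] := eqVneq (k : nat) n.+2.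
    rewrite e ltnn sub0r.
    have J0 : J k = 0 by rewrite /J e subnn.
    have kE : k%:R = n%:R + 2 :> R by rewrite Jk J0; ring.
    rewrite -e J0 rho0 !mul0r mulr0 add0r mulr0 add0r kE /Q /rec2; field.
    by rewrite ?oppr_eq0 ?pnatr_eq0.
  have lk2 : (k < n.+2)%N by rewrite ltn_neqAle ne.
  rewrite ltnS lk2; have eK := subnSK lk2.
  have tk : T k.+1 = (6 * k%:R + 1) * (6 * k%:R + 5) * (J k) ^+ 2
      / ((k%:R + 1) ^+ 2 * (6 * J k - 5) * (6 * J k - 1)) * T k.
    have k1 : k%:R + 1 != 0 :> R by rewrite natr1 pnatr_eq0.
    have e1 : al k.+1 = 12 * (6 * k%:R + 1) * (6 * k%:R + 5) / (k%:R + 1) ^+ 2 * al k.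
      apply: (mulfI (expf_neq0 2 k1)); rewrite {1}natr1 hyp_a_rec -/(al k); field; exact: k1.
    rewrite /T e1 (_ : al (n.+2 - k.+1) = rho (J k) * al (n.+2 - k)).
      by rewrite /rho; field; rewrite nz5 nz1 k1.
    by rewrite al_down /J -eK.
  have J1 : J k.+1 = J k - 1.
    by rewrite /J -eK -natr1 addrK.
  rewrite tk J1 -natr1 /Q Jk /rec0 /rec1 /rec2 /rho.
  have k1 : k%:R + 1 != 0 :> R by rewrite natr1 pnatr_eq0.
  have := nz5 (n.+2 - k); have := nz1 (n.+2 - k); have := nz11 (n.+2 - k); have := nz7 (n.+2 - k).
  rewrite -/(J k) => n7 n11 n1 n5.
  have n11' : 6 * (J k - 1) - 5 != 0 by rewrite (_ : _ - 5 = 6 * J k - 11) //; ring.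
  have n7' : 6 * (J k - 1) - 1 != 0 by rewrite (_ : _ - 1 = 6 * J k - 7) //; ring.
  by field; rewrite n7' n11' n1 n5 k1.
by rewrite telescope_sumr // /G ltnn mulr0n expr0n !mul0r subrr.
Qed.

End Square.

Section BinomialSide.
Let ga k : R := (hyp_c k)%:R.
Let term m j : R := ga (m - j) * 'C(m - j, j)%:R * (- 432) ^+ j.
Let rho (K j : R) : R := K ^+ 2 * (K - j) / (24 * (6 * K - 5) * (2 * K - 1) * (6 * K - 1)).

Let nz5 (j : nat) : 6 * j%:R - 5 != 0 :> R.
Proof. by apply: (sub_nat_neq0 (v := 5)); apply/eqP; lia. Qed.
Let nz1 (j : nat) : 6 * j%:R - 1 != 0 :> R.
Proof. by apply: (sub_nat_neq0 (v := 1)); apply/eqP; lia. Qed.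
Let nz2 (j : nat) : 2 * j%:R - 1 != 0 :> R.
Proof. by apply: (sub_nat_neq0 (v := 1)); apply/eqP; lia. Qed.
Let nz11 (j : nat) : 6 * j%:R - 11 != 0 :> R.
Proof. by apply: (sub_nat_neq0 (v := 11)); apply/eqP; lia. Qed.
Let nz7 (j : nat) : 6 * j%:R - 7 != 0 :> R.
Proof. by apply: (sub_nat_neq0 (v := 7)); apply/eqP; lia. Qed.
Let nz3 (j : nat) : 2 * j%:R - 3 != 0 :> R.
Proof. by apply: (sub_nat_neq0 (v := 3)); apply/eqP; lia. Qed.

Let bin_down k j :
  k.+1%:R * 'C(k, j)%:R = (k.+1%:R - j%:R) * 'C(k.+1, j)%:R :> R.
Proof.
have [h|h] := leqP j k.+1; last by rewrite !bin_small ?mulr0 // ltnW.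
by rewrite -natrB // -!natrM mul_bin_down.
Qed.

Let ga_down k : ga k = k.+1%:R ^+ 3 /
  (24 * (6 * k.+1%:R - 5) * (2 * k.+1%:R - 1) * (6 * k.+1%:R - 1)) * ga k.+1.
Proof.
have := hyp_c_rec k; rewrite -/(ga k) -/(ga k.+1) => h.
have e5 : 6 * k.+1%:R - 5 = 6 * k%:R + 1 :> R by rewrite -natr1; ring.
have e1 : 6 * k.+1%:R - 1 = 6 * k%:R + 5 :> R by rewrite -natr1; ring.
have e2 : 2 * k.+1%:R - 1 = 2 * k%:R + 1 :> R by rewrite -natr1; ring.
have := nz5 k.+1; have := nz1 k.+1; have := nz2 k.+1; rewrite e5 e1 e2 => n2 n1 n5.
apply: (mulfI (_ : 24 * (6 * k%:R + 1) * (2 * k%:R + 1) * (6 * k%:R + 5) != 0)).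
  by rewrite !mulf_neq0 // pnatr_eq0.
by rewrite -h; field; rewrite n1 n5 n2.
Qed.

Let down k j : ga k * 'C(k, j)%:R = rho k.+1%:R j%:R * (ga k.+1 * 'C(k.+1, j)%:R).
Proof.
have k0 := natr_neq0 k.
have -> : 'C(k, j)%:R = (k.+1%:R - j%:R) / k.+1%:R * 'C(k.+1, j)%:R :> R.
  by rewrite mulrAC -bin_down mulrAC divff // mul1r.
rewrite ga_down /rho; have := nz5 k.+1; have := nz1 k.+1; have := nz2 k.+1.
by move: (k.+1%:R : R) k0 => c c0 n2 n1 n5; field; rewrite n5 n1 n2 c0.
Qed.

(** The method of square_rec, with another certificate Q. *)
Lemma binomial_rec n :
  let v m := \sum_(j < m.+1) term m j in
  rec0 n%:R * v n + rec1 n%:R * v n.+1 + rec2 n%:R * v n.+2 = 0.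
Proof.
move=> v; pose K j : R := (n.+2 - j)%:R; pose T j := term n.+2 j.
have Kn2 : K n.+2 = 0 by rewrite /K subnn.
have Kn1 : K n.+1 = 1 by rewrite /K subSnn.
have rho0 j : rho 0 j = 0 by rewrite /rho expr0n !mul0r.
have v1 : v n.+1 = \sum_(j < n.+3) rho (K j) j%:R * T j.
  rewrite [RHS]big_ord_recr /= Kn2 rho0 mul0r addr0; apply: eq_bigr => j _.
  have lj := ltn_ord j; rewrite /T /K /term (subSn (_ : (j <= n.+1)%N)) //.
  by rewrite down; ring.
have v0 : v n = \sum_(j < n.+3) rho (K j) j%:R * rho (K j - 1) j%:R * T j.
  rewrite [RHS]big_ord_recr /= Kn2 rho0 !mul0r addr0.
  rewrite [RHS]big_ord_recr /= Kn1 subrr rho0 mulr0 mul0r addr0.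
  apply: eq_bigr => j _; have lj := ltn_ord j.
  rewrite /T /K /term !subSn //; last exact: leqW.
  by rewrite down down -[(n - j).+2%:R]natr1 addrK; ring.
pose Q (j : R) : R := - 1888 + 4326 * j - 3558 * j ^+ 2 + 1224 * j ^+ 3 - 144 * j ^+ 4 - 5896 * n%:R + 10399 * n%:R * j - 6140 * n%:R * j ^+ 2 + 1332 * n%:R * j ^+ 3 - 72 * n%:R * j ^+ 4 - 7288 * n%:R ^+ 2 + 9302 * n%:R ^+ 2 * j - 3510 * n%:R ^+ 2 * j ^+ 2 + 360 * n%:R ^+ 2 * j ^+ 3 - 4458 * n%:R ^+ 3 + 3672 * n%:R ^+ 3 * j - 666 * n%:R ^+ 3 * j ^+ 2 - 1350 * n%:R ^+ 4 + 540 * n%:R ^+ 4 * j - 162 * n%:R ^+ 5.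
pose G j : R := if (j < n.+3)%N then
  j%:R * Q j%:R / ((6 * K j - 5) * (2 * K j - 1) * (6 * K j - 1)) * T j else 0.
have -> : rec0 n%:R * v n + rec1 n%:R * v n.+1 + rec2 n%:R * v n.+2 =
    \sum_(0 <= j < n.+3) (G j.+1 - G j).
  rewrite v0 v1 /v !mulr_sumr -!big_split big_mkord; apply: eq_bigr => j _.
  have lj := ltn_ord j; rewrite /G lj /= -/(T j).
  have Kj : n%:R = K j + j%:R - 2 :> R.
    by rewrite /K -natrD subnK // -[n.+2]addn2 natrD addrK.
  have [e|ne] := eqVneq (j : nat) n.+2.
    rewrite e ltnn sub0r.
    have T0 : T n.+2 = 0 by rewrite /T /term subnn bin_small // mulr0 mul0r.
    by rewrite T0 !mulr0 !addr0 oppr0.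
  have lj2 : (j < n.+2)%N by rewrite ltn_neqAle ne.
  rewrite ltnS lj2; have eK := subnSK lj2.
  have j1 : j%:R + 1 != 0 :> R by rewrite natr1 pnatr_eq0.
  have K1 : K j.+1 = K j - 1 by rewrite /K -eK -natr1 addrK.
  have K0 : K j != 0 by rewrite /K -eK; exact: natr_neq0.
  have tj : T j.+1 = K j ^+ 2 / (24 * (6 * K j - 5) * (2 * K j - 1) * (6 * K j - 1)) *
      (- 432) * (K j - j%:R) * (K j - j%:R - 1) / (j%:R + 1) * T j.
    have b1 := natr_bin_left R (n.+2 - j.+1) j; have b2 := bin_down (n.+2 - j.+1) j.
    rewrite eK -/(K j) in b2; rewrite -/(K j.+1) K1 in b1.
    rewrite /T /term ga_down eK -/(K j) [(- 432) ^+ j.+1]exprS.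
    have -> : 'C(n.+2 - j.+1, j.+1)%:R =
        (K j - 1 - j%:R) / (j%:R + 1) * ((K j - j%:R) / K j * 'C(n.+2 - j, j)%:R).
      apply: (mulfI j1); rewrite {1}natr1 b1.
      have -> : 'C(n.+2 - j.+1, j)%:R = (K j - j%:R) / K j * 'C(n.+2 - j, j)%:R.
        by apply: (mulfI K0); rewrite b2; field.
      by field; rewrite K0 j1.
    have := nz5 (n.+2 - j); have := nz1 (n.+2 - j); have := nz2 (n.+2 - j); rewrite -/(K j).
    move: (K j) K0 (j%:R : R) j1 (ga _) ('C(_, _)%:R) ((- 432) ^+ j) => k k0 i i1 g c w n2 n1 n5.
    by field; rewrite k0 n1 n2 n5 i1.
  rewrite tj K1 -natr1 /Q Kj /rec0 /rec1 /rec2 /rho.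
  have := nz5 (n.+2 - j); have := nz1 (n.+2 - j); have := nz11 (n.+2 - j).
  have := nz7 (n.+2 - j); have := nz2 (n.+2 - j); have := nz3 (n.+2 - j).
  rewrite -/(K j) => n3 n2 n7 n11 n1 n5.
  have n11' : 6 * (K j - 1) - 5 != 0 by rewrite (_ : _ - 5 = 6 * K j - 11) //; ring.
  have n7' : 6 * (K j - 1) - 1 != 0 by rewrite (_ : _ - 1 = 6 * K j - 7) //; ring.
  have n3' : 2 * (K j - 1) - 1 != 0 by rewrite (_ : _ - 1 = 2 * K j - 3) //; ring.
  by field; rewrite n7' n11' n3' n1 n2 n5 j1.
by rewrite telescope_sumr // /G ltnn !mul0r subrr.
Qed.

End BinomialSide.

(** The coefficients of x^n in Clausen's formula, which squares the first
    series: (sum a_k x^k)^2 = sum c_k (x (1 - 432 x))^k. *)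
Theorem clausen_coef n :
  \sum_(k < n.+1) (hyp_a k)%:R * (hyp_a (n - k))%:R =
  \sum_(j < n.+1) (hyp_c (n - j))%:R * 'C(n - j, j)%:R * (- 432) ^+ j :> R.
Proof.
have [a0 a1] : hyp_a 0 = 1%N /\ hyp_a 1 = 60%N by [].
have [c0 c1] : hyp_c 0 = 1%N /\ hyp_c 1 = 120%N by [].
apply: (rec_unique (u := fun n => \sum_(k < n.+1) (hyp_a k)%:R * (hyp_a (n - k))%:R)
  (v := fun n => \sum_(j < n.+1) (hyp_c (n - j))%:R * 'C(n - j, j)%:R * (- 432) ^+ j)).
- by rewrite !big_ord1 /= !subn0 a0 c0 bin0 expr0 !mulr1.
- rewrite !big_ord_recr !big_ord0 /= !subn0 !subnn a0 a1 c0 c1 bin0 bin_small // expr0; ring.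
- exact: square_rec.
- exact: binomial_rec.
Qed.

End Clausen.

(** * Truncation modulo the square of a prime *)

Section Valuation.
Variable p : nat.
Hypotheses (p_prime : prime p) (p_gt7 : (7 < p)%N).

Lemma logn_fact_small n : (n < p ^ 2)%N -> logn p n`! = (n %/ p)%N.
Proof.
move=> h; rewrite logn_fact //; case: n h => [|n] h; first by rewrite big_geq // div0n.
rewrite big_ltn // expn1 big1_seq ?addn0 // => i; rewrite mem_index_iota => /andP[_ /andP[i2 _]].
by rewrite divn_small // (leq_trans h) // leq_exp2l // prime_gt1.
Qed.

Let small c k : (c <= 6)%N -> (k < p)%N -> (c * k < p ^ 2)%N.
Proof. by move=> hc hk; rewrite -mulnn; nia. Qed.

Lemma hyp_a_gt0 k : (0 < hyp_a k)%N.
Proof. by rewrite muln_gt0 !bin_gt0; apply/andP; split; lia. Qed.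

Lemma logn_hyp_a k : (k < p)%N ->
  (logn p (hyp_a k) + (2 * k) %/ p + (3 * k) %/ p = (6 * k) %/ p)%N.
Proof.
move=> hk; move: (hyp_a k) (hyp_a_gt0 k) (hyp_a_fact k) => x x0 /(congr1 (logn p)).
rewrite !lognM ?muln_gt0 ?fact_gt0 ?x0 //.
have hk1 : (k < p ^ 2)%N by have := @small 1 k isT hk; rewrite mul1n.
have [h2 h3 h6] := And3 (@small 2 k isT hk) (@small 3 k isT hk) (@small 6 k isT hk).
rewrite !logn_fact_small //.
by rewrite [(k %/ p)%N]divn_small // add0n addnA.
Qed.

Let divn_ge q n : (q <= n %/ p)%N = (q * p <= n)%N.
Proof. by rewrite leq_divRL // prime_gt0. Qed.

Let divn_lt q n : (n < q * p)%N -> (n %/ p < q)%N.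
Proof. by move=> h; rewrite ltn_divLR // prime_gt0. Qed.

Lemma logn_hyp_a_ge1 k : (k < p)%N -> (p <= 6 * k)%N -> (0 < logn p (hyp_a k))%N.
Proof.
move=> hk h; have e := logn_hyp_a hk.
have h2 := @divn_lt 2 (2 * k); have h2' := @divn_lt 1 (2 * k).
have h3 := @divn_lt 3 (3 * k); have h3' := @divn_lt 2 (3 * k); have h3'' := @divn_lt 1 (3 * k).
have h6 q := divn_ge q (6 * k).
have a1 := h6 1%N; have a2 := h6 2%N; have a3 := h6 3%N; have a4 := h6 4%N.
clear h6; lia.
Qed.

Lemma logn_hyp_a_ge2 k : (k < p)%N -> (5 * p <= 6 * k)%N -> (1 < logn p (hyp_a k))%N.
Proof.
move=> hk h; have e := logn_hyp_a hk.
have h2 := @divn_lt 2 (2 * k).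
have h3 := @divn_lt 3 (3 * k).
have a5 := divn_ge 5 (6 * k).
lia.
Qed.

Lemma p_dvd_hyp_a k : (k < p)%N -> (p <= 6 * k)%N -> (p %| hyp_a k)%N.
Proof.
by move=> hk h; have := logn_hyp_a_ge1 hk h; rewrite -[p in (p %| _)%N]expn1 pfactor_dvdn ?hyp_a_gt0.
Qed.

(** Either both indices are at least p / 6 and each factor contributes p, or
    one is below p / 6 and the other one above 5 p / 6 contributes p^2. *)
Lemma p2_dvd_hyp_aa k j : (k < p)%N -> (j < p)%N -> (p <= k + j)%N ->
  (p ^ 2 %| hyp_a k * hyp_a j)%N.
Proof.
move=> hk hj h; have xy0 : (0 < hyp_a k * hyp_a j)%N by rewrite (muln_gt0 (hyp_a k)) !hyp_a_gt0.
rewrite pfactor_dvdn // (lognM p (hyp_a_gt0 k) (hyp_a_gt0 j)).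
have a1 := @logn_hyp_a_ge1 k hk; have a2 := @logn_hyp_a_ge2 k hk.
have b1 := @logn_hyp_a_ge1 j hj; have b2 := @logn_hyp_a_ge2 j hj.
lia.
Qed.

Lemma p2_dvd_hyp_c k : (k < p)%N -> (p <= 2 * k)%N -> (p ^ 2 %| hyp_c k)%N.
Proof.
move=> hk h.
have ec : (hyp_c k * (k`! * k`! * k`! * (3 * k)`!) = (6 * k)`!)%N.
  rewrite -hyp_a_fact hyp_cE -(@bin_fact (2 * k) k) ?leq_pmull //.
  by rewrite (_ : 2 * k - k = k)%N; [ring|lia].
have c0 : (0 < hyp_c k)%N by rewrite hyp_cE muln_gt0 hyp_a_gt0 bin_gt0 leq_pmull.
rewrite pfactor_dvdn //; move: (hyp_c k) c0 ec => x x0 /(congr1 (logn p)).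
rewrite !lognM ?muln_gt0 ?fact_gt0 //.
have hk1 : (k < p ^ 2)%N by have := @small 1 k isT hk; rewrite mul1n.
have [h3 h6] := conj (@small 3 k isT hk) (@small 6 k isT hk).
rewrite !logn_fact_small //.
rewrite [(k %/ p)%N]divn_small // => e.
have h3d := @divn_lt 3 (3 * k); have h3' := @divn_lt 2 (3 * k).
have a3 := divn_ge 3 (6 * k); have a4 := divn_ge 4 (6 * k).
lia.
Qed.

End Valuation.

Lemma triangle_sum (V : nmodType) (g : nat -> nat -> V) p :
  \sum_(k < p) \sum_(j < p - k) g k j = \sum_(n < p) \sum_(k < n.+1) g k (n - k)%N.
Proof.
elim: p => [|p IH]; first by rewrite !big_ord0.
rewrite [RHS]big_ord_recr -IH /= [in RHS]big_ord_recr /= subnn addrA -big_split.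
rewrite big_ord_recr /= subSnn big_ord1; congr (_ + _); apply: eq_bigr => k _.
have lk : (k <= p)%N := ltnW (ltn_ord k).
by rewrite subSn // big_ord_recr.
Qed.

Section Truncated.
Variables (A : comNzRingType) (u w : A) (p : nat).
Hypotheses (p_prime : prime p) (p_gt7 : (7 < p)%N).

Let T (k j : nat) : int :=
  (hyp_c k)%:Z * 'C(k, j)%:Z * (- 432) ^+ j - (hyp_a k)%:Z * (hyp_a j)%:Z.

Let T_dvd k j : (k < p)%N -> (j < p)%N -> (p <= k + j)%N -> exists z, T k j = (p ^ 2)%:Z * z.
Proof.
move=> hk hj h.
have /dvdnP[x ex] := p2_dvd_hyp_aa p_prime p_gt7 hk hj h.
have [jk|jk] := leqP j k; last first.
  exists (- x%:Z); rewrite /T bin_small // mulr0 mul0r sub0r -PoszM ex PoszM; ring.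
have /dvdnP[y ey] : (p ^ 2 %| hyp_c k)%N by apply: p2_dvd_hyp_c => //; lia.
exists (y%:Z * 'C(k, j)%:Z * (- 432) ^+ j - x%:Z).
by rewrite /T ey -[_ * (hyp_a j)%:Z]PoszM ex !PoszM; ring.
Qed.

Let TE (R : pzRingType) k j : (T k j)%:~R =
  (hyp_c k)%:R * 'C(k, j)%:R * (- 432) ^+ j - (hyp_a k)%:R * (hyp_a j)%:R :> R.
Proof.
rewrite /T; move: (hyp_c k) (hyp_a k) (hyp_a j) => x y z.
by rewrite rmorphB !rmorphM rmorphXn.
Qed.

Let T_sum n : \sum_(k < n.+1) T k (n - k)%N = 0.
Proof.
apply: (@intr_inj rat); rewrite rmorph0 rmorph_sum /=.
under eq_bigr do rewrite TE.
rewrite sumrB; apply/eqP; rewrite subr_eq0; apply/eqP; rewrite clausen_coef.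
rewrite (reindex_inj rev_ord_inj) /=; apply: eq_bigr => j _; rewrite subSS subKn //.
by rewrite -ltnS.
Qed.

(** In total degree below p the identity clausen_coef applies degree by degree,
    and beyond it every term on either side is divisible by p^2. The variable w
    homogenises the formula, for rings in which nothing can be inverted. *)
Theorem truncated_clausen : exists z : A,
  \sum_(k < p) (hyp_c k)%:R * (u * (w - 432%:R * u)) ^+ k * w ^+ (2 * (p.-1 - k)) =
  (\sum_(k < p) (hyp_a k)%:R * u ^+ k * w ^+ (p.-1 - k)) ^+ 2 + (p ^ 2)%:R * z.
Proof.
have p0 : (0 < p)%N by rewrite prime_gt0.
pose M n : A := u ^+ n * w ^+ (2 * p.-1 - n).
have S1 : \sum_(k < p) (hyp_c k)%:R * (u * (w - 432%:R * u)) ^+ k * w ^+ (2 * (p.-1 - k)) =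
    \sum_(k < p) \sum_(j < p) ((hyp_c k)%:R * 'C(k, j)%:R * (- 432) ^+ j) * M (k + j)%N.
  apply: eq_bigr => k _; have lk := ltn_ord k.
  rewrite exprMn exprBn mulr_sumr mulr_sumr mulr_suml.
  rewrite (big_ord_widen_cond p xpredT (fun j => (hyp_c k)%:R * (u ^+ k * ((-1) ^+ j * w ^+ (k - j) * (432%:R * u) ^+ j *+ 'C(k, j))) * w ^+ (2 * (p.-1 - k)))) //.
  rewrite [RHS](bigID (fun j : 'I_p => (j < k.+1)%N)) /= [X in _ = _ + X]big1 ?addr0.
    apply: eq_bigr => j /= jk; rewrite /M -mulr_natl [in RHS]exprNn exprMn exprD.
    have -> : w ^+ (2 * p.-1 - (k + j)) = w ^+ (k - j) * w ^+ (2 * (p.-1 - k)).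
      by rewrite -exprD; congr (_ ^+ _); lia.
    by ring.
  by move=> j; rewrite -leqNgt => jk; rewrite bin_small // mulr0 mul0r mul0r.
have S2 : (\sum_(k < p) (hyp_a k)%:R * u ^+ k * w ^+ (p.-1 - k)) ^+ 2 =
    \sum_(k < p) \sum_(j < p) ((hyp_a k)%:R * (hyp_a j)%:R) * M (k + j)%N.
  rewrite expr2 mulr_suml; apply: eq_bigr => k _; rewrite mulr_sumr.
  apply: eq_bigr => j _; have lk := ltn_ord k; have lj := ltn_ord j.
  rewrite /M exprD.
  have -> : w ^+ (2 * p.-1 - (k + j)) = w ^+ (p.-1 - k) * w ^+ (p.-1 - j).
    by rewrite -exprD; congr (_ ^+ _); lia.
  by ring.
have E : \sum_(k < p) (hyp_c k)%:R * (u * (w - 432%:R * u)) ^+ k * w ^+ (2 * (p.-1 - k)) -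
   (\sum_(k < p) (hyp_a k)%:R * u ^+ k * w ^+ (p.-1 - k)) ^+ 2 =
   \sum_(k < p) \sum_(j < p) (T k j)%:~R * M (k + j)%N.
  rewrite S1 S2 -sumrB; apply: eq_bigr => k _; rewrite -sumrB; apply: eq_bigr => j _.
  by rewrite TE mulrBl.
have low : \sum_(k < p) \sum_(j < p - k) (T k j)%:~R * M (k + j)%N = 0 :> A.
  rewrite (triangle_sum (fun k j => (T k j)%:~R * M (k + j)%N)) big1 // => n _.
  rewrite (eq_bigr (fun k : 'I_n.+1 => (T k (n - k)%N)%:~R * M n)); last first.
    by move=> k _; rewrite subnKC // -ltnS.
  by rewrite -mulr_suml -rmorph_sum T_sum rmorph0 mul0r.
have high (k : 'I_p) : exists z : A, \sum_(j < p) (T k j)%:~R * M (k + j)%N =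
    \sum_(j < p - k) (T k j)%:~R * M (k + j)%N + (p ^ 2)%:R * z.
  have [zj hz] : exists z : 'I_p -> A, forall j : 'I_p, (p <= k + j)%N ->
      (T k j)%:~R * M (k + j)%N = (p ^ 2)%:R * z j.
    have h (j : 'I_p) : exists z : A, (p <= k + j)%N -> (T k j)%:~R * M (k + j)%N = (p ^ 2)%:R * z.
      have [kj|] := leqP p (k + j)%N; last by exists 0.
      have [z ez] := T_dvd (ltn_ord k) (ltn_ord j) kj.
      by exists (z%:~R * M (k + j)%N) => _; rewrite ez (intrM _ (p ^ 2)%N%:Z) -mulrA.
    by have := fin_all_exists h.
  exists (\sum_(j < p | (p <= k + j)%N) zj j).
  rewrite (bigID (fun j : 'I_p => (j < p - k)%N)) /=; congr (_ + _).
    by apply/esym; apply: (big_ord_widen p (fun j => (T k j)%:~R * M (k + j)%N)); exact: leq_subr.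
  rewrite mulr_sumr; apply: eq_big => j.
    by rewrite -leqNgt leq_subLR.
  by rewrite -leqNgt leq_subLR => /hz.
have [z hz] := fin_all_exists high.
exists (\sum_(k < p) z k).
have e : \sum_(k < p) \sum_(j < p) (T k j)%:~R * M (k + j)%N = (p ^ 2)%:R * \sum_(k < p) z k.
  by rewrite (eq_bigr _ (fun k _ => hz k)) big_split /= low add0r mulr_sumr.
by rewrite -e -E [RHS]addrC subrK.
Qed.

End Truncated.

(** * The Hasse invariant *)

Section Hasse.
Variables (K : fieldType) (p m : nat).
Hypotheses (charK : p \in [pchar K]) (pE : p = (2 * m).+1) (p_gt7 : (7 < p)%N).

Let p_prime : prime p := pcharf_prime charK.

(** For a cubic f, the Hasse invariant of y^2 = f(x). *)
Definition hasse (f : {poly K}) : K := (f ^+ m)`_p.-1.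

Lemma hasseZ c f : hasse (c *: f) = c ^+ m * hasse f.
Proof. by rewrite /hasse exprZn coefZ. Qed.

Lemma hasse_scale c f : hasse (f \Po (c *: 'X)) = c ^+ p.-1 * hasse f.
Proof.
rewrite /hasse -rmorphXn /=; move: (f ^+ m) => g.
rewrite comp_polyE coef_sum.
have [h|h] := ltnP p.-1 (size g); last first.
  rewrite [g`_p.-1]nth_default // mulr0 big1 // => i _.
  rewrite exprZn !coefZ coefXn (_ : (p.-1 == i)%N = false) ?mulr0 //.
  by apply/negbTE; rewrite neq_ltn (leq_trans (ltn_ord i) h) orbT.
rewrite (bigD1 (Ordinal h)) //= big1 ?addr0 => [|i ne].
  by rewrite exprZn !coefZ coefXn eqxx mulr1 mulrC.
rewrite exprZn !coefZ coefXn (_ : (p.-1 == i)%N = false) ?mulr0 //.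
by apply/negbTE; rewrite eq_sym.
Qed.

Let pP : p \in [pchar {poly K}] := rmorph_pchar polyC charK.

(** For p <= i < 2 p - 1 the polynomial (X + c)^i = (X^p + c^p) (X + c)^(i - p)
    has no term of degree p - 1, and f^m has degree below 2 p - 1. *)
Lemma hasse_shift (c : K) (f : {poly K}) : (size f <= 4)%N -> hasse (f \Po ('X + c%:P)) = hasse f.
Proof.
move=> sf; rewrite /hasse -rmorphXn /=.
have sg : (size (f ^+ m) <= p + p.-1)%N.
  apply: leq_trans (size_poly_exp_leq _ _) _.
  have : ((size f).-1 * m <= 3 * m)%N by rewrite leq_mul2r -subn1 leq_subLR sf orbT.
  by move: p_gt7 pE; clear; lia.
move: (f ^+ m) sg => g sg.
rewrite comp_polyE coef_sum -[in RHS](coefK g) poly_def coef_sum.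
apply: eq_bigr => i _; rewrite !coefZ coefXn; congr (_ * _).
have li := leq_trans (ltn_ord i) sg.
have [ip|ip] := ltnP i p.
  have [e|ne] := eqVneq p.-1 i.
    rewrite e; have mon : ('X + c%:P) ^+ i \is monic by rewrite monic_exp // -[c%:P]opprK -polyCN monicXsubC.
    move/monicP: mon; rewrite lead_coefE.
    by rewrite -[c%:P]opprK -polyCN size_exp_XsubC => ->.
  rewrite nth_default // -[c%:P]opprK -polyCN size_exp_XsubC.
  by rewrite ltn_neqAle eq_sym ne -ltnS (ltn_predK ip).
rewrite (_ : (p.-1 == i)%N = false); last first.
  by apply/negbTE; rewrite neq_ltn (leq_trans _ ip) // (ltn_predK p_gt7).
have -> : ('X + c%:P) ^+ i = ('X^p + (c ^+ p)%:P) * ('X + c%:P) ^+ (i - p).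
  by rewrite polyC_exp -!(pFrobenius_autE pP) -pFrobenius_autD_comm ?pFrobenius_autE -?exprD ?subnKC //; exact: mulrC.
rewrite mulrDl coefD coefXnM mul_polyC coefZ (_ : (p.-1 < p)%N) ?(ltn_predK p_gt7) // add0r.
rewrite nth_default ?mulr0 // -[c%:P]opprK -polyCN size_exp_XsubC.
by move: li ip p_gt7; clear; lia.
Qed.

Let nat_neq0 n : (0 < n < p)%N -> n%:R != 0 :> K := natr_neq0_ltp charK.

Let twom : 2%:R * m%:R = -1 :> K.
Proof.
apply/eqP; rewrite -addr_eq0 -natrM natr1 -pE; apply/eqP; exact: pcharf0 charK.
Qed.

(** In K, m = -1/2, and (2n choose n) is (-4)^n times (-1/2 choose n). *)
Lemma central_bin n : (n < p)%N -> 'C(m, n)%:R * (- 4) ^+ n = 'C(2 * n, n)%:R :> K.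
Proof.
elim: n => [|n IH] np; first by rewrite !bin0 expr0 mulr1.
have n0 : n.+1%:R != 0 :> K by apply: nat_neq0.
apply: (mulfI n0); rewrite mulrA natr_bin_left.
have e : (n.+1 * 'C(2 * n.+1, n.+1) = 2 * (2 * n).+1 * 'C(2 * n, n))%N.
  have h1 := mul_bin_diag (2 * n).+2 n; rewrite succnK in h1; have h2 := mul_bin_down (2 * n).+1 n; rewrite succnK in h2.
  rewrite (_ : (2 * n).+1 - n = n.+1)%N in h2; last by clear; lia.
  have -> : (2 * n.+1 = (2 * n).+2)%N by clear; lia.
  apply/eqP; rewrite -(eqn_pmul2l (ltn0Sn n)) -h1; apply/eqP.
  have -> : (n.+1 * ((2 * n).+2 * 'C((2 * n).+1, n)) = (2 * n).+2 * (n.+1 * 'C((2 * n).+1, n)))%N by ring.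
  rewrite -h2; ring.
rewrite -natrM e !natrM -(IH (ltnW np)) exprS -[(2 * n).+1%:R]natr1 natrM.
have -> : (m%:R - n%:R) * 'C(m, n)%:R * (-4 * (-4) ^+ n) =
   (- 2 * (2%:R * m%:R) + 4 * n%:R) * ('C(m, n)%:R * (-4) ^+ n) :> K by ring.
by rewrite twom; ring.
Qed.

(** Expanding by powers of the constant term gives the summands
    (m choose 3i) (3i choose i), to which central_bin applies. For k > m the
    coefficients of the series vanish in K. *)
Lemma hyp_a_hasse (l : K) :
  \sum_(k < p) (hyp_a k)%:R * l ^+ k = hasse (4%:R *: 'X^3 + 'X^2 - (4%:R * l)%:P).
Proof.
rewrite /hasse.
have -> : 4%:R *: 'X^3 + 'X^2 - (4%:R * l)%:P =
    - (4%:R * l)%:P + 'X^2 * (1 + 4%:R *: 'X) :> {poly K}.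
  by rewrite -!mul_polyC; ring.
rewrite exprDn coef_sum.
have mp : (m < p)%N by rewrite pE; clear; lia.
rewrite -(big_mkord xpredT (fun k => (hyp_a k)%:R * l ^+ k)) (big_cat_nat (n := m.+1)) //=.
rewrite [X in _ + X]big_nat_cond [X in _ + X]big1 ?addr0; last first.
  move=> i /andP[/andP[i1 i2] _]; apply/eqP; rewrite mulf_eq0 -(dvdn_pcharf charK).
  by rewrite p_dvd_hyp_a //; move: i1 pE p_gt7; clear; lia.
rewrite big_mkord [RHS](reindex_inj rev_ord_inj) /=; apply: eq_bigr => i _.
have im : (i <= m)%N by rewrite -ltnS.
rewrite subSS subKn //.
rewrite exprMn coefMn -exprM.
have -> : (- (4%:R * l)%:P) ^+ i * ('X^(2 * (m - i)) * (1 + 4%:R *: 'X) ^+ (m - i)) =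
   ((- 4 * l) ^+ i) *: ('X^(2 * (m - i)) * (1 + 4%:R *: 'X) ^+ (m - i)) :> {poly K}.
  by rewrite -polyCN -polyC_exp mul_polyC mulNr.
rewrite coefZ coefXnM.
rewrite (_ : (p.-1 < 2 * (m - i))%N = false); last by apply/negbTE; rewrite -leqNgt pE; move: im; clear; lia.
rewrite (_ : p.-1 - 2 * (m - i) = 2 * i)%N; last by rewrite pE; move: im; clear; lia.
have -> : ((1 + 4%:R *: 'X) ^+ (m - i))`_(2 * i) = 'C(m - i, 2 * i)%:R * 4 ^+ (2 * i) :> K.
  by rewrite addrC coef_exp_linear expr1n mulr1 mulrC.
rewrite bin_sub // -mulr_natl exprMn.
have e : 'C(m, i)%:R * 'C(m - i, 2 * i)%:R * (- 64) ^+ i = (hyp_a i)%:R :> K.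
  have c3 : ('C(m, i) * 'C(m - i, 2 * i) = 'C(m, 3 * i) * 'C(3 * i, i))%N.
    have [h|h] := leqP (3 * i) m; last first.
      by rewrite (bin_small h) mul0n ['C(m - i, _)]bin_small ?muln0 //; move: h im; clear; lia.
    apply/eqP; rewrite -(@eqn_pmul2r (i`! * (2 * i)`! * (m - 3 * i)`!)) ?muln_gt0 ?fact_gt0 //.
    have b1 := bin_fact im.
    have h2 : (2 * i <= m - i)%N by move: h; clear; lia.
    have b2 := bin_fact h2.
    have b3 := bin_fact h.
    have h4 : (i <= 3 * i)%N by rewrite leq_pmull.
    have b4 := bin_fact h4.
    rewrite (_ : 3 * i - i = 2 * i)%N in b4; last by clear; lia.
    rewrite (_ : m - i - 2 * i = m - 3 * i)%N in b2; last by clear; lia.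
    have -> : ('C(m, i) * 'C(m - i, 2 * i) * (i`! * (2 * i)`! * (m - 3 * i)`!) =
       'C(m, i) * (i`! * ('C(m - i, 2 * i) * ((2 * i)`! * (m - 3 * i)`!))))%N by ring.
    have -> : ('C(m, 3 * i) * 'C(3 * i, i) * (i`! * (2 * i)`! * (m - 3 * i)`!) =
       'C(m, 3 * i) * ('C(3 * i, i) * (i`! * (2 * i)`!) * (m - 3 * i)`!))%N by ring.
    by rewrite b2 b1 b4 b3.
  rewrite -natrM c3 natrM /hyp_a natrM.
  have [h|h] := ltnP (3 * i) p.
    have := central_bin h; rewrite mulnA -[(2 * 3)%N]/6%N => <-.
    have -> : (-64) ^+ i = (-4) ^+ (3 * i) :> K by rewrite exprM; congr (_ ^+ _); ring.
    by ring.
  rewrite bin_small ?mul0r ?(leq_trans mp) //; apply/esym.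
  have := p_dvd_hyp_a p_prime p_gt7 (leq_ltn_trans im mp); rewrite (leq_trans h) => [/(_ isT)|].
    by rewrite (dvdn_pcharf charK) natrM => /eqP.
  by rewrite leq_mul2r orbT.
rewrite -e; have -> : (- 64) ^+ i = (- 4) ^+ i * 4 ^+ (2 * i) :> K.
  by rewrite exprM -exprMn; congr (_ ^+ _); ring.
by ring.
Qed.

End Hasse.

Section Isogeny.
Variables (K : fieldType) (p m : nat).
Hypotheses (charK : p \in [pchar K]) (pE : p = (2 * m).+1) (p_gt7 : (7 < p)%N).

Let p_prime : prime p := pcharf_prime charK.

Let nat_neq0 n : (0 < n < p)%N -> n%:R != 0 :> K := natr_neq0_ltp charK.

Lemma fermat_nat n : (0 < n < p)%N -> n%:R ^+ (2 * m) = 1 :> K.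
Proof.
move=> h; apply: (mulfI (nat_neq0 h)); rewrite mulr1 -exprS -pE.
by rewrite -(pFrobenius_autE charK) pFrobenius_aut_nat.
Qed.

Lemma hasse_X (g : {poly K}) : hasse p m ('X * g) = (g ^+ m)`_m.
Proof.
rewrite /hasse exprMn coefXnM pE succnK.
rewrite (_ : (2 * m < m)%N = false); last by rewrite ltnNge leq_pmull.
by congr nth; rewrite mul2n -addnn addnK.
Qed.

(** Both sides have the same ratio of consecutive terms, as 2 m = -1 in K. *)
Lemma dual_bin k : (k <= m)%N ->
  'C(2 * (m - k), m)%:R * (- 1) ^+ m * (- 4) ^+ k = 'C(m - k, k)%:R :> K.
Proof.
elim: k => [|k IH] km.
  rewrite subn0 bin0 expr0 mulr1 -(central_bin charK pE); last by rewrite pE; move: p_gt7; clear; lia.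
  rewrite binn mul1r -exprMn (_ : -4 * -1 = 2%:R ^+ 2 :> K); last by ring.
  by rewrite -exprM fermat_nat //= (leq_trans _ p_gt7).
have k0 : (k.+1)%:R != 0 :> K by apply: nat_neq0; rewrite pE; move: km; clear; lia.
have mk0 : (m - k)%:R != 0 :> K by apply: nat_neq0; rewrite pE; move: km; clear; lia.
apply: (mulfI mk0); apply: (mulfI k0).
have e1 : (2 * (m - k) * ((2 * (m - k)).-1 * 'C(2 * (m - k.+1), m)) =
           (m - 2 * k) * (m - 2 * k).-1 * 'C(2 * (m - k), m))%N.
  have h1 := mul_bin_down (2 * (m - k)) m; have h2 := mul_bin_down (2 * (m - k)).-1 m.
  have <- : ((2 * (m - k)).-1.-1 = 2 * (m - k.+1))%N by move: km; clear; lia.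
  rewrite h2 mulnCA h1.
  have -> : (2 * (m - k) - m = m - 2 * k)%N by move: km; clear; lia.
  have -> : ((2 * (m - k)).-1 - m = (m - 2 * k).-1)%N by move: km; clear; lia.
  by rewrite mulnA [((m - 2 * k).-1 * _)%N]mulnC.
have e2 : (k.+1 * ((m - k) * 'C(m - k.+1, k.+1)) =
           (m - 2 * k) * (m - 2 * k).-1 * 'C(m - k, k))%N.
  have h1 := mul_bin_down (m - k) k.+1; have h2 := mul_bin_left (m - k) k.
  have <- : ((m - k).-1 = m - k.+1)%N by move: km; clear; lia.
  rewrite h1 mulnCA h2.
  have -> : (m - k - k.+1 = (m - 2 * k).-1)%N by clear; lia.
  have -> : (m - k - k = m - 2 * k)%N by clear; lia.
  by rewrite mulnA [((m - 2 * k).-1 * _)%N]mulnC.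
have e3 : (2 * (m - k)).-1%:R = - (2%:R * k.+1%:R) :> K.
  apply/eqP; rewrite -addr_eq0 -natrM -natrD -(dvdn_pcharf charK).
  by rewrite (_ : _ + _ = p)%N // pE; move: km; clear; lia.
have {e2} := congr1 (fun n => n%:R : K) e2; have {e1} := congr1 (fun n => n%:R : K) e1.
rewrite !natrM -(IH (ltnW km)) e3 exprS => e1 ->.
transitivity (2%:R * (m - k)%:R * (- (2%:R * k.+1%:R) * 'C(2 * (m - k.+1), m)%:R) * ((-1) ^+ m * (-4) ^+ k) : K).
  by ring.
by rewrite e1; ring.
Qed.

(** These two cubics are the ends of the 2-isogeny with kernel the point
    (0, 0), and isogenous curves have the same Hasse invariant. The two
    expansions agree term by term. *)
Lemma hasse_dual (A B : K) :
  hasse p m ('X * ('X^2 - (2%:R * A) *: 'X + (A ^+ 2 - 4%:R * B)%:P)) =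
  hasse p m ('X * ('X^2 + A *: 'X + B%:P)).
Proof.
rewrite !hasse_X.
have -> : 'X^2 - (2%:R * A) *: 'X + (A ^+ 2 - 4%:R * B)%:P =
   ('X - A%:P) ^+ 2 + (- (4%:R * B))%:P.
  by rewrite -!mul_polyC; ring.
have -> : 'X^2 + A *: 'X + B%:P = ('X + A%:P) * 'X + B%:P by rewrite -!mul_polyC; ring.
set Y := ('X - _) ^+ 2.
rewrite !exprDn !coef_sum; apply: eq_bigr => -[k /= km] _; rewrite ltnS in km.
rewrite {}/Y !coefMn -!polyC_exp ![_ * (_ ^+ k)%:P]mulrC !mul_polyC !coefZ.
rewrite -exprM exprMn coefMXn (_ : (m < m - k)%N = false); last by rewrite ltnNge leq_subr.
rewrite subKn //.
have coefXD (c : K) n i : (('X + c%:P) ^+ n)`_i = c ^+ (n - i) * 'C(n, i)%:R.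
  by rewrite -['X]scale1r coef_exp_linear expr1n mul1r.
rewrite -[- A%:P]polyCN !coefXD -(dual_bin km).
have [h|h] := leqP (2 * k) m; last first.
  by rewrite ['C(2 * (m - k), m)]bin_small ?mul0r ?mulr0 //; move: h km; clear; lia.
have -> : (2 * (m - k) - m = m - 2 * k)%N by move: km; clear; lia.
have -> : (m - k - k = m - 2 * k)%N by clear; lia.
rewrite -[- A]mulN1r exprMn.
have -> : (-1) ^+ (m - 2 * k) = (-1) ^+ m :> K.
  by rewrite -signr_odd oddB // oddM /= addbF signr_odd.
rewrite -mulNr exprMn; congr (_ *+ _).
rewrite (_ : - 4%:R = - 4 :> K) //; ring.
Qed.
End Isogeny.

Section HasseCM.
Variables (K : fieldType) (p m : nat).
Hypotheses (charK : p \in [pchar K]) (pE : p = (2 * m).+1) (p_gt7 : (7 < p)%N).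

Let nat_neq0 n : (0 < n < p)%N -> n%:R != 0 :> K := natr_neq0_ltp charK.
Let two_neq0 : 2%:R != 0 :> K. Proof. by apply: nat_neq0; rewrite (leq_trans _ p_gt7). Qed.
Let three_neq0 : 3%:R != 0 :> K. Proof. by apply: nat_neq0; rewrite (leq_trans _ p_gt7). Qed.
Let four_neq0 : 4%:R != 0 :> K. Proof. by apply: nat_neq0; rewrite (leq_trans _ p_gt7). Qed.
Let five_neq0 : 5%:R != 0 :> K. Proof. by apply: nat_neq0; rewrite (leq_trans _ p_gt7). Qed.
Let seven_neq0 : 7%:R != 0 :> K. Proof. by apply: nat_neq0; rewrite (leq_trans _ p_gt7). Qed.

Local Notation f := (weierstrass (- 35%:R) (- 98%:R) : {poly K}).

(** The zeros of f other than 7 are e and its conjugate - 7 - e. With e moved to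
    the origin, hasse_dual leads to the cubic with the conjugate zero at the
    origin, scaled by (e + 4)^2. For s = 2 e + 7, e + 4 is omega = (1 + s) / 2. *)
Lemma hasse_cm_scaled (e : K) : e ^+ 2 = - (7%:R * e) - 14%:R ->
  hasse p m f = (e + 4%:R) ^+ p.-1 * hasse p m f.
Proof.
move=> he.
pose A (x : K) := 3%:R * x; pose B (x : K) := - (21%:R * x) - 77%:R.
pose g a b : {poly K} := 'X * ('X^2 + a *: 'X + b%:P).
have moved (x : K) : x ^+ 2 = - (7%:R * x) - 14%:R -> hasse p m f = hasse p m (g (A x) (B x)).
  move=> hx; rewrite -(hasse_shift charK pE p_gt7 x (eq_leq (size_weierstrass _ _))).
  congr (hasse p m _); rewrite /weierstrass !(comp_polyD, comp_polyZ, comp_polyC) rmorphXn /= comp_polyX.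
  apply/eqP; rewrite -subr_eq0 /g /A /B -!mul_polyC.
  have -> : ('X + x%:P) ^+ 3 + (- 35%:R)%:P * ('X + x%:P) + (- 98%:R)%:P -
      'X * ('X^2 + (3%:R * x)%:P * 'X + (- (21%:R * x) - 77%:R)%:P) =
      (3%:R * 'X + x%:P - 7%:R) * (x ^+ 2 + 7%:R * x + 14%:R)%:P by ring.
  by rewrite hx (_ : _ - _ + _ + _ = 0) ?mulr0 //; ring.
have scaled (u a b : K) : u != 0 -> hasse p m (g (u * a) (u ^+ 2 * b)) = u ^+ m * hasse p m (g a b).
  move=> u0; have -> : g (u * a) (u ^+ 2 * b) = u ^+ 3 *: (g a b \Po (u^-1 *: 'X)).
    rewrite /g comp_polyM !(comp_polyD, comp_polyZ, comp_polyC) rmorphXn /= comp_polyX.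
    rewrite -!mul_polyC.
    have hu : u%:P * u^-1%:P = 1 :> {poly K} by rewrite -polyCM divff.
    transitivity (u%:P * u^-1%:P * 'X * ((u%:P * u^-1%:P) ^+ 2 * 'X ^+2 + (u%:P * u^-1%:P) * (u * a)%:P * 'X + (u ^+ 2 * b)%:P)); last by ring.
    by rewrite hu; ring.
  rewrite hasseZ hasse_scale mulrA; congr (_ * _).
  rewrite pE succnK -exprM exprVn (_ : 3 * m = m + 2 * m)%N; last by clear; lia.
  by rewrite exprD mulfK // expf_neq0.
have he' : (- 7%:R - e) ^+ 2 = - (7%:R * (- 7%:R - e)) - 14%:R :> K.
  have -> : (- 7%:R - e) ^+ 2 = e ^+ 2 + 14%:R * e + 49%:R by ring.
  by rewrite he; ring.
have e4 : (e + 4%:R) ^+ 2 = e + 2%:R.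
  have -> : (e + 4%:R) ^+ 2 = e ^+ 2 + 8%:R * e + 16%:R by ring.
  by rewrite he; ring.
have u0 : e + 2%:R != 0.
  apply/negP => /eqP h; have : (2%:R : K) ^+ 2 = 0.
    transitivity (e ^+ 2 + 7%:R * e + 14%:R - (e + 2%:R) * (e + 5%:R)); first by ring.
    by rewrite he h; ring.
  by move/eqP; rewrite expf_eq0 /= (negPf two_neq0).
rewrite {1}(moved _ he) (moved _ he').
have pm : p.-1 = (2 * m)%N by rewrite pE.
rewrite pm exprM e4 -scaled //.
rewrite /g -(hasse_dual charK pE p_gt7 (A e) (B e)).
rewrite -scaleNr; congr (hasse p m ('X * (_ + _ *: 'X + _%:P))).
  transitivity (- 3%:R * (- (7%:R * e) - 14%:R + 9%:R * e + 14%:R)); first by rewrite /A; ring.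
  by rewrite -he /A; ring.
have -> : A e ^+ 2 - 4%:R * B e = 9%:R * e ^+ 2 + 84%:R * e + 308%:R by rewrite /A /B; ring.
have -> : (e + 2%:R) ^+ 2 * B (- 7%:R - e) =
  (e ^+ 2 + 4%:R * e + 4%:R) * (21%:R * e + 70%:R) by rewrite /B; ring.
rewrite he.
transitivity (- 63%:R * e ^+ 2 - 420%:R * e - 700%:R); last by ring.
by rewrite he; ring.
Qed.

(** Frobenius exchanges omega and its conjugate, so omega^(p - 1) is not 1. *)
Lemma hasse_inert (s : K) : s ^+ 2 = - 7%:R -> s ^+ p = - s -> hasse p m f = 0.
Proof.
move=> hs sp; have s0 : s != 0.
  by apply: contra_eq_neq hs => ->; rewrite expr0n /= eq_sym oppr_eq0.
have he : ((- 7%:R + s) / 2%:R) ^+ 2 = - (7%:R * ((- 7%:R + s) / 2%:R)) - 14%:R :> K.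
  have -> : ((- 7%:R + s) / 2%:R) ^+ 2 = (49%:R - 14%:R * s + s ^+ 2) / 4%:R :> K.
    by field; rewrite four_neq0.
  by rewrite hs; field; rewrite ?four_neq0 ?two_neq0.
have := hasse_cm_scaled he; set e4 := _ + 4%:R => h.
have e4E : e4 * 2%:R = 1 + s by rewrite /e4; field; rewrite two_neq0.
have e4p : e4 ^+ p * 2%:R = 1 - s.
  have -> : 2%:R = 2%:R ^+ p :> K by rewrite -(pFrobenius_autE charK) pFrobenius_aut_nat.
  rewrite -exprMn e4E -(pFrobenius_autE charK) pFrobenius_autD_comm ?pFrobenius_autE ?expr1n ?sp //.
  exact: mulrC.
have := congr1 ( *%R (e4 * 2%:R)) h.
have -> : e4 * 2%:R * (e4 ^+ p.-1 * hasse p m f) = (e4 ^+ p * 2%:R) * hasse p m f.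
  by rewrite [in RHS]pE exprS [in LHS]pE succnK; ring.
rewrite e4p e4E => /eqP; rewrite -subr_eq0 -mulrBl mulf_eq0.
have -> : 1 + s - (1 - s) = 2%:R * s by ring.
by rewrite mulf_eq0 (negPf two_neq0) (negPf s0) /= => /eqP.
Qed.

Lemma fermat_natr n : n%:R != 0 :> K -> n%:R ^+ p.-1 = 1 :> K.
Proof.
move=> n0; apply: (mulfI n0); rewrite mulr1 -exprS prednK; last by rewrite pE.
by rewrite -(pFrobenius_autE charK) pFrobenius_aut_nat.
Qed.

(** For l = (25 - 3 r) / 21600 and mu = - 4 r, the cubic 4 X^3 + X^2 - 4 l is
    4 mu^-3 f(mu (X + 1/12)): the curve of hyp_a_hasse is a twist of y^2 = f(x). *)
Lemma hyp_a_cm (r : K) : r ^+ 2 = 105%:R ->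
  (\sum_(k < p) (hyp_a k)%:R * (25%:R - 3%:R * r) ^+ k * 21600%:R ^+ (p.-1 - k)) ^+ 2
  = 105%:R ^+ m * hasse p m f ^+ 2.
Proof.
move=> hr.
have smooth : [/\ 12%:R != 0 :> K, 105%:R != 0 :> K, 21600%:R != 0 :> K & 5400%:R != 0 :> K].
  by split; [rewrite (_ : 12%:R = 2%:R ^+ 2 * 3%:R) | rewrite (_ : 105%:R = 3%:R * 5%:R * 7%:R)
    | rewrite (_ : 21600%:R = 2%:R ^+ 5 * 3%:R ^+ 3 * 5%:R ^+ 2)
    | rewrite (_ : 5400%:R = 2%:R ^+ 3 * 3%:R ^+ 3 * 5%:R ^+ 2) ];
    try ring; rewrite !mulf_neq0 ?expf_neq0.
have [n12 n105 nw n5400] := smooth.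
have pm : p.-1 = (2 * m)%N by rewrite pE.
pose l := (25%:R - 3%:R * r) / 21600%:R.
have homog (u w : K) : w != 0 -> w ^+ p.-1 = 1 ->
    \sum_(k < p) (hyp_a k)%:R * u ^+ k * w ^+ (p.-1 - k) = \sum_(k < p) (hyp_a k)%:R * (u / w) ^+ k.
  move=> w0 wp; apply: eq_bigr => k _; rewrite -mulrA; congr (_ * _).
  have hk : (k <= p.-1)%N by rewrite -ltnS prednK // pE.
  rewrite exprMn exprVn; congr (_ * _); apply: (mulIf (expf_neq0 k w0)).
  by rewrite -exprD subnK // wp mulVf // expf_neq0.
rewrite (homog _ _ nw (fermat_natr nw)) -/l.
rewrite (hyp_a_hasse charK pE p_gt7).
pose mu := - 4%:R * r; pose t : K := 12%:R^-1.
have hmu : mu ^+ 2 = 1680%:R.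
  by rewrite /mu exprMn hr; ring.
have mu0 : mu != 0.
  have : mu ^+ 2 != 0.
    rewrite hmu (_ : 1680%:R = 2%:R ^+ 4 * 105%:R); last by ring.
    by rewrite mulf_neq0 ?expf_neq0.
  by rewrite expf_eq0.
have E : mu ^+ 3 *: (4%:R *: 'X^3 + 'X^2 - (4%:R * l)%:P) =
         4%:R *: ((f \Po (mu *: 'X)) \Po ('X + t%:P)).
  rewrite /weierstrass !(comp_polyD, comp_polyZ, comp_polyC) !rmorphXn /= !comp_polyX.
  rewrite !comp_polyZ comp_polyX -!mul_polyC; apply/eqP; rewrite eq_sym -subr_eq0.
  set lhs := (X in X == 0).
  have -> : lhs = (mu ^+ 3 * (12%:R * t - 1))%:P * 'X^2
      + (mu * (12%:R * mu ^+ 2 * t ^+ 2 - 140%:R))%:P * 'X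
      + (4%:R * mu ^+ 2 * mu * t ^+ 3 - 140%:R * mu * t - 392%:R + mu ^+ 2 * mu * (4%:R * l))%:P.
    by rewrite /lhs; ring.
  have -> : 12%:R * t - 1 = 0 by rewrite divff // subrr.
  rewrite hmu; have -> : 12%:R * 1680%:R * t ^+ 2 - 140%:R = 0 by rewrite /t; field.
  rewrite !mulr0 !mul0r !add0r /mu /l /t.
  rewrite (_ : _ - _ - _ + _ = 392%:R / 105%:R * (r ^+ 2 - 105%:R)); last first.
    by field; rewrite n105 nw n12.
  by rewrite hr subrr mulr0.
have := congr1 (hasse p m) E; rewrite !hasseZ (hasse_shift charK pE p_gt7); last first.
  apply: leq_trans (size_comp_poly_leq _ _) _; rewrite ltnS.
  apply: (@leq_trans (3 * 1)) => //; apply: leq_mul.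
    by rewrite -subn1 leq_subLR size_weierstrass.
  by rewrite -subn1 leq_subLR (leq_trans (size_scale_leq _ _)) ?size_polyX.
rewrite hasse_scale; move: (hasse p m _) (hasse p m _) => H F e.
have e2 : 1680%:R ^+ m * F ^+ 2 = 16%:R ^+ m * H ^+ 2.
  apply: (mulfI (expf_neq0 (2 * p.-1) mu0)); rewrite -hmu.
  transitivity (((mu ^+ 3) ^+ m * F) ^+ 2).
    rewrite pm -!exprM [in RHS]exprMn -!exprM mulrA -exprD; congr (_ ^+ _ * _); clear; lia.
  rewrite e !exprMn -!exprM (_ : 16%:R = 4%:R ^+ 2); last by ring.
  rewrite -exprM [(m * 2)%N]mulnC [(p.-1 * 2)%N]mulnC; ring.
have e3 : 105%:R ^+ m * F ^+ 2 = H ^+ 2.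
  apply: (mulfI (expf_neq0 m (expf_neq0 4 two_neq0))).
  rewrite mulrA -exprMn (_ : 2%:R ^+ 4 * 105%:R = 1680%:R); last by ring.
  by rewrite e2; congr (_ ^+ _ * _); ring.
by rewrite -e3 mulrA -exprD addnn -mul2n -pm fermat_natr // mul1r.
Qed.

End HasseCM.

(** * Power sums over a finite field *)

Section PowerSums.
Variable F : finFieldType.
Local Notation q := #|F|.

Lemma card_natr_eq0 : q%:R = 0 :> F.
Proof.
have : \sum_(x : F) x = \sum_(x : F) (x + 1).
  by rewrite [LHS](reindex_inj (addIr 1)).
by rewrite big_split /= sumr_const => /eqP; rewrite eq_sym addrC -subr_eq0 addrK => /eqP.
Qed.

Lemma sum_expr_small j : (j < q.-1)%N -> \sum_(x : F) x ^+ j = 0.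
Proof.
have q1 := finNzRing_gt1 F.
case: j => [|j] jq.
  rewrite (eq_bigr (fun _ => 1)) => [|x _]; last by rewrite expr0.
  by rewrite sumr_const card_natr_eq0.
have [a /andP[a0 aj]] : exists a : F, (a != 0) && (a ^+ j.+1 != 1).
  apply/existsP; apply: contraLR jq; rewrite negb_exists -leqNgt => /forallP h.
  have := @max_unity_roots F j.+1 (enum [pred x : F | x != 0]) isT.
  rewrite enum_uniq -cardE; have -> : #|[pred x : F | x != 0]| = q.-1.
    by rewrite cardC1.
  apply=> //; apply/allP => x; rewrite mem_enum inE => x0; apply/unity_rootP.
  by have := h x; rewrite x0 negbK => /eqP.
apply/eqP; have : a ^+ j.+1 * \sum_(x : F) x ^+ j.+1 = \sum_(x : F) x ^+ j.+1.
  rewrite mulr_sumr [RHS](reindex_inj (mulfI a0)); apply: eq_bigr => x _.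
  by rewrite exprMn.
move/eqP; rewrite -subr_eq0 -{2}[\sum_(x : F) _]mul1r -mulrBl mulf_eq0 subr_eq0.
by rewrite (negPf aj).
Qed.

Lemma sum_expr_units : \sum_(x : F) x ^+ q.-1 = -1.
Proof.
have q1 := finNzRing_gt1 F.
rewrite (bigD1 0) //= expr0n -subn1 subn_eq0 leqNgt q1 add0r.
rewrite (eq_bigr (fun _ => 1)) => [|x x0]; last first.
  by apply: (mulfI x0); rewrite -exprS subn1 prednK ?(ltnW q1) // expf_card mulr1.
rewrite sumr_const (eq_card (B := predC1 (0 : F))) // cardC1 -subn1 natrB ?(ltnW q1) //.
by rewrite card_natr_eq0 add0r.
Qed.

Lemma sum_horner (g : {poly F}) : (size g <= 2 * q.-1)%N ->
  \sum_(x : F) g.[x] = - g`_q.-1.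
Proof.
move=> sg; have q1 := finNzRing_gt1 F.
under eq_bigr do rewrite (horner_coef_wide _ sg).
rewrite exchange_big /=; under eq_bigr do rewrite -mulr_sumr.
have h : (q.-1 < 2 * q.-1)%N by rewrite mul2n -addnn -[X in (X < _)%N]addn0 ltn_add2l -ltnS prednK ?(ltnW q1).
rewrite (bigD1 (Ordinal h)) //= sum_expr_units mulrN1 big1 ?addr0 // => i ne.
have [i1|i1] := ltnP i q.-1; first by rewrite sum_expr_small // mulr0.
have i2 : (q.-1 < i)%N by rewrite ltn_neqAle i1 andbT eq_sym.
rewrite (eq_bigr (fun x : F => x ^+ (i - q.-1))) => [|x _].
  by rewrite sum_expr_small ?mulr0 // ltn_subLR // addnn -mul2n ltn_ord.
have [->|x0] := eqVneq x 0; first by rewrite !expr0n subn_eq0 leqNgt i2 eqn0Ngt (leq_ltn_trans _ i2).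
rewrite -{1}(subnK i1) exprD; have -> : x ^+ q.-1 = 1; last by rewrite mulr1.
by apply: (mulfI x0); rewrite -exprS prednK ?(ltnW q1) // expf_card mulr1.
Qed.
End PowerSums.

(** * Quadratic Gauss sums *)

Section GaussSums.
Variables (K : fieldType) (p : nat).
Hypothesis charK : p \in [pchar K].


Lemma prim_root_sum n (z : K) : (1 < n)%N -> n.-primitive_root z ->
  \sum_(i < n) z ^+ i = 0.
Proof.
move=> n1 zn; have : (z - 1) * \sum_(i < n) z ^+ i = 0 by rewrite -subrX1 prim_expr_order // subrr.
move/eqP; rewrite mulf_eq0 subr_eq0 => /orP[/eqP z1|/eqP //].
have := prim_order_dvd zn 1; rewrite z1 expr1n eqxx => /(dvdn_leq (isT : 0 < 1)%N).
by rewrite leqNgt n1.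
Qed.

Definition gauss3 (z : K) := z - z ^+ 2.

(** For each order n, the square of the Gauss sum follows by division by
    1 + z + ... + z^(n-1), and the action of Frobenius by division by z^n - 1,
    one class of p modulo n at a time. *)
Lemma gauss3_sq (z : K) : 3.-primitive_root z -> gauss3 z ^+ 2 = - 3%:R.
Proof.
move=> zn; have h := prim_root_sum (isT : 1 < 3)%N zn.
transitivity ((\sum_(i < 3) z ^+ i) * (z ^+ 2 - 3%:R * z + 3%:R) + (- 3%:R)).
  by rewrite /gauss3 !big_ord_recr big_ord0 /=; ring.
by rewrite h mul0r add0r.
Qed.

Lemma gauss3_frob (z : K) : 3.-primitive_root z -> (p %% 3 != 0)%N ->
  gauss3 z ^+ p = (if (p %% 3)%N \in [:: 1]%N then 1 else -1) * gauss3 z.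
Proof.
move=> zn; have h := prim_expr_order zn.
have -> : gauss3 z ^+ p = gauss3 (z ^+ (p %% 3)).
  rewrite -!(pFrobenius_autE charK) /gauss3 !(rmorphD, rmorphN, rmorphXn) /=.
  by rewrite !pFrobenius_autE expr_mod.
move: (p %% 3)%N (ltn_pmod p (isT : 0 < 3)%N) => r.
case: r => [|[|[|r]]] //= _ _; rewrite ?mulN1r ?mul1r /gauss3 ?expr1 //.
- transitivity ((z ^+ 3 - 1) * (- z) + (- gauss3 z)); first by rewrite /gauss3; ring.
  by rewrite h subrr mul0r add0r.
Qed.

Definition gauss5 (z : K) := z - z ^+ 2 - z ^+ 3 + z ^+ 4.

Lemma gauss5_sq (z : K) : 5.-primitive_root z -> gauss5 z ^+ 2 = 5%:R.
Proof.
move=> zn; have h := prim_root_sum (isT : 1 < 5)%N zn.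
transitivity ((\sum_(i < 5) z ^+ i) * (z ^+ 4 - 3%:R * z ^+ 3 + z ^+ 2 + 5%:R * z - 5%:R) + (5%:R)).
  by rewrite /gauss5 !big_ord_recr big_ord0 /=; ring.
by rewrite h mul0r add0r.
Qed.

Lemma gauss5_frob (z : K) : 5.-primitive_root z -> (p %% 5 != 0)%N ->
  gauss5 z ^+ p = (if (p %% 5)%N \in [:: 1; 4]%N then 1 else -1) * gauss5 z.
Proof.
move=> zn; have h := prim_expr_order zn.
have -> : gauss5 z ^+ p = gauss5 (z ^+ (p %% 5)).
  rewrite -!(pFrobenius_autE charK) /gauss5 !(rmorphD, rmorphN, rmorphXn) /=.
  by rewrite !pFrobenius_autE expr_mod.
move: (p %% 5)%N (ltn_pmod p (isT : 0 < 5)%N) => r.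
case: r => [|[|[|[|[|r]]]]] //= _ _; rewrite ?mulN1r ?mul1r /gauss5 ?expr1 //.
- transitivity ((z ^+ 5 - 1) * (z ^+ 3 - z) + (- gauss5 z)); first by rewrite /gauss5; ring.
  by rewrite h subrr mul0r add0r.
- transitivity ((z ^+ 5 - 1) * (z ^+ 7 - z ^+ 4 + z ^+ 2 - z) + (- gauss5 z)); first by rewrite /gauss5; ring.
  by rewrite h subrr mul0r add0r.
- transitivity ((z ^+ 5 - 1) * (z ^+ 11 - z ^+ 7 + z ^+ 6 - z ^+ 3 - z ^+ 2 + z) + (gauss5 z)); first by rewrite /gauss5; ring.
  by rewrite h subrr mul0r add0r.
Qed.

Definition gauss7 (z : K) := z + z ^+ 2 - z ^+ 3 + z ^+ 4 - z ^+ 5 - z ^+ 6.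

Lemma gauss7_sq (z : K) : 7.-primitive_root z -> gauss7 z ^+ 2 = - 7%:R.
Proof.
move=> zn; have h := prim_root_sum (isT : 1 < 7)%N zn.
transitivity ((\sum_(i < 7) z ^+ i) * (z ^+ 6 + z ^+ 5 - 3%:R * z ^+ 4 + z ^+ 3 + z ^+ 2 - 7%:R * z + 7%:R) + (- 7%:R)).
  by rewrite /gauss7 !big_ord_recr big_ord0 /=; ring.
by rewrite h mul0r add0r.
Qed.

Lemma gauss7_frob (z : K) : 7.-primitive_root z -> (p %% 7 != 0)%N ->
  gauss7 z ^+ p = (if (p %% 7)%N \in [:: 1; 2; 4]%N then 1 else -1) * gauss7 z.
Proof.
move=> zn; have h := prim_expr_order zn.
have -> : gauss7 z ^+ p = gauss7 (z ^+ (p %% 7)).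
  rewrite -!(pFrobenius_autE charK) /gauss7 !(rmorphD, rmorphN, rmorphXn) /=.
  by rewrite !pFrobenius_autE expr_mod.
move: (p %% 7)%N (ltn_pmod p (isT : 0 < 7)%N) => r.
case: r => [|[|[|[|[|[|[|r]]]]]]] //= _ _; rewrite ?mulN1r ?mul1r /gauss7 ?expr1 //.
- transitivity ((z ^+ 7 - 1) * (- z ^+ 5 - z ^+ 3 + z) + (gauss7 z)); first by rewrite /gauss7; ring.
  by rewrite h subrr mul0r add0r.
- transitivity ((z ^+ 7 - 1) * (- z ^+ 11 - z ^+ 8 + z ^+ 5 - z ^+ 4 - z ^+ 2 - z) + (- gauss7 z)); first by rewrite /gauss7; ring.
  by rewrite h subrr mul0r add0r.
- transitivity ((z ^+ 7 - 1) * (- z ^+ 17 - z ^+ 13 - z ^+ 10 + z ^+ 9 - z ^+ 6 - z ^+ 5 - z ^+ 3 + z ^+ 2 + z) + (gauss7 z)); first by rewrite /gauss7; ring.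
  by rewrite h subrr mul0r add0r.
- transitivity ((z ^+ 7 - 1) * (- z ^+ 23 - z ^+ 18 - z ^+ 16 + z ^+ 13 - z ^+ 11 - z ^+ 9 - z ^+ 8 + z ^+ 6 - z ^+ 4 + z ^+ 3 - z ^+ 2 - z) + (- gauss7 z)); first by rewrite /gauss7; ring.
  by rewrite h subrr mul0r add0r.
- transitivity ((z ^+ 7 - 1) * (- z ^+ 29 - z ^+ 23 - z ^+ 22 + z ^+ 17 - z ^+ 16 - z ^+ 15 - z ^+ 11 + z ^+ 10 - z ^+ 9 - z ^+ 8 + z ^+ 5 - z ^+ 4 + z ^+ 3 - z ^+ 2 - z) + (- gauss7 z)); first by rewrite /gauss7; ring.
  by rewrite h subrr mul0r add0r.
Qed.

End GaussSums.

Lemma legendre3 p : (p %% 3 != 0)%N -> legendre p%:Z 3 = if (p %% 3)%N \in [:: 1]%N then 1 else -1.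
Proof.
rewrite /legendre => h; have -> : (3 %| p%:Z)%Z = false by rewrite dvdzE /= /dvdn (negPf h).
under eq_existsb => x do rewrite -rmorphXn /= !modz_nat eqz_nat.
move: h; rewrite -(modn_mod p); move: (p %% 3)%N (ltn_pmod p (isT : 0 < 3)%N).
case=> [|[|[|r]]] //= _ _.
  by case: existsP => // -[]; exists (Ordinal (isT : 1 < 3)%N).
by case: existsP => // -[] [[|[|[|]]]].
Qed.

Lemma legendre5 p : (p %% 5 != 0)%N -> legendre p%:Z 5 = if (p %% 5)%N \in [:: 1; 4]%N then 1 else -1.
Proof.
rewrite /legendre => h; have -> : (5 %| p%:Z)%Z = false by rewrite dvdzE /= /dvdn (negPf h).
under eq_existsb => x do rewrite -rmorphXn /= !modz_nat eqz_nat.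
move: h; rewrite -(modn_mod p); move: (p %% 5)%N (ltn_pmod p (isT : 0 < 5)%N).
case=> [|[|[|[|[|r]]]]] //= _ _.
- by case: existsP => // -[]; exists (Ordinal (isT : 1 < 5)%N).
- by case: existsP => // -[] [[|[|[|[|[|]]]]]].
- by case: existsP => // -[] [[|[|[|[|[|]]]]]].
- by case: existsP => // -[]; exists (Ordinal (isT : 2 < 5)%N).
Qed.

Lemma jacobi15 a : jacobi a 15 = legendre a 3 * legendre a 5.
Proof.
by rewrite /jacobi (_ : prime_decomp 15 = [:: (3, 1); (5, 1)]%N) // !big_cons big_nil !expr1 mulr1.
Qed.

(** * Representation of primes by x^2 + 7 y^2 *)

(** The numbers 0, ..., p - 1 are already p roots of X^p - X. *)
Lemma frob_fixed_natr (K : fieldType) (p : nat) (s : K) : p \in [pchar K] -> s ^+ p = s ->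
  exists n : nat, s = n%:R.
Proof.
move=> charK sp; have p_prime := pcharf_prime charK.
have [|/negP h] := boolP (s \in [seq (n : nat)%:R : K | n <- iota 0 p]).
  by case/mapP => n _ ->; exists n.
exfalso; apply: h; apply/negPn/negP => h.
pose f : {poly K} := 'X^p - 'X.
have sf : size f = p.+1.
  by rewrite size_polyDl ?size_polyXn // size_polyN size_polyX ltnS prime_gt1.
have rs : all (root f) (s :: [seq (n : nat)%:R : K | n <- iota 0 p]).
  apply/allP => x; rewrite inE => /orP[/eqP ->|/mapP[n _ ->]]; rewrite /root !hornerE subr_eq0.
    by rewrite sp.
  by rewrite -(pFrobenius_autE charK) pFrobenius_aut_nat.
have f0 : f != 0 by rewrite -size_poly_eq0 sf.
have := max_poly_roots f0 rs; rewrite /= size_map size_iota sf ltnn => /(_ _)/negP.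
apply=> //; rewrite h map_inj_in_uniq ?iota_uniq // => i j.
wlog ij : i j / (i <= j)%N.
  by move=> H hi hj e; case/orP: (leq_total i j) => l; [|symmetry]; apply: H.
rewrite !mem_iota /= => hi hj /eqP; rewrite eq_sym -subr_eq0 -natrB // -(dvdn_pcharf charK).
case: (posnP (j - i)) => [/eqP|d0 /(dvdn_leq d0)]; first by rewrite subn_eq0 => ji _; apply/eqP; rewrite eqn_leq ij.
by rewrite leqNgt (leq_ltn_trans (leq_subr _ _) hj).
Qed.

(** Pigeonhole on the values a + n b for a and b up to the square root of p. *)
Lemma thue (p n : nat) : prime p ->
  exists x y : int, [/\ (x != 0) || (y != 0), `|x| ^+ 2 < p%:Z, `|y| ^+ 2 < p%:Z
                     & (p%:Z %| x + n%:Z * y)%Z].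
Proof.
move=> p_prime; have p0 := prime_gt0 p_prime.
have ex : exists r, (r * r < p)%N by exists 0%N.
have bd r : (r * r < p)%N -> (r <= p)%N by case: r => // r /ltnW; apply: leq_trans; rewrite leq_pmulr.
case: (ex_maxnP ex bd) => r hr rmax.
have rp : (p < r.+1 * r.+1)%N.
  rewrite ltn_neqAle leqNgt; apply/andP; split; last by apply/negP => /rmax; rewrite ltnn.
  apply/negP => /eqP e; move: p_prime; rewrite e; case: (r) hr => [|q] _; first by [].
  by apply/negP/primePn; right; exists q.+2; rewrite ?dvdn_mulr // ltn_Pmull.
pose g (u : 'I_r.+1 * 'I_r.+1) : 'I_p := Ordinal (ltn_pmod (u.1 + n * u.2) p0).
have [/injectiveP/leq_card|] := boolP (injectiveb g).
  by rewrite card_prod !card_ord leqNgt rp.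
case/injectivePn => -[a b] [[a' b'] ne /(congr1 val) /= e].
exists (a%:Z - a'%:Z), (b%:Z - b'%:Z).
have small (c d : 'I_r.+1) : `|c%:Z - d%:Z| ^+ 2 < p%:Z.
  have h : `|c%:Z - d%:Z| <= r%:Z by have := ltn_ord c; have := ltn_ord d; clear; lia.
  apply: le_lt_trans (_ : r%:Z ^+ 2 < _); last by rewrite expr2 -PoszM ltz_nat.
  by rewrite lerXn2r // ?nnegrE.
split=> //.
  apply: contra_neqT ne; rewrite negb_or !negbK !subr_eq0 !eqz_nat => /andP[/eqP ea /eqP eb].
  by congr (_, _); apply: val_inj.
have -> : a%:Z - a'%:Z + n%:Z * (b%:Z - b'%:Z) = (a + n * b)%N%:Z - (a' + n * b')%N%:Z.
  by rewrite !PoszD !PoszM; ring.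
by rewrite -eqz_mod_dvd !modz_nat e.
Qed.


(** For k = 7, X is a multiple of 7 and dividing by 7 exchanges the roles of X
    and Y; for k = 4 both are even. The other k > 1 are excluded by congruences
    modulo 2, 3 or 5. *)
Lemma multiple_sum_sq_7 (p X Y k : nat) : prime p -> (7 < p)%N -> (0 < k < 8)%N ->
  (X ^ 2 + 7 * Y ^ 2 = k * p)%N -> exists c d : nat, (p = c ^ 2 + 7 * d ^ 2)%N.
Proof.
move=> p_prime p7 kb e.
have nd q : (1 < q < 8)%N -> ~~ (q %| p)%N.
  case/andP=> q1 q8; apply/negP => /(primeP p_prime).2 /orP[] /eqP; move: q1 q8 p7; clear; lia.
have p2 := nd 2 isT; have p3 := nd 3 isT; have p5 := nd 5 isT; have {nd p_prime} p7' := nd 7 isT.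
have : k \in [:: 1; 2; 3; 4; 5; 6; 7]%N by rewrite !inE; move: kb; clear; lia.
rewrite !inE => /or4P[/eqP h|/eqP h|/eqP h|/or4P[] /eqP h].
- by exists X, Y; rewrite e h mul1n.
- exfalso; move: e p2; rewrite {}h; clear.
  rewrite (divn_eq X 2) (divn_eq Y 2) /dvdn -!mulnn.
  move: (X %/ 2)%N (X %% 2)%N (ltn_pmod X (isT : 0 < 2)%N) => a i.
  move: (Y %/ 2)%N (Y %% 2)%N (ltn_pmod Y (isT : 0 < 2)%N) => b j.
  by case: i => [|[|i]] //; case: j => [|[|j]] // _ _; nia.
- exfalso; move: e p3; rewrite {}h; clear.
  rewrite (divn_eq X 3) (divn_eq Y 3) /dvdn -!mulnn.
  move: (X %/ 3)%N (X %% 3)%N (ltn_pmod X (isT : 0 < 3)%N) => a i.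
  move: (Y %/ 3)%N (Y %% 3)%N (ltn_pmod Y (isT : 0 < 3)%N) => b j.
  by case: i => [|[|[|i]]] //; case: j => [|[|[|j]]] // _ _; nia.
- have [i0 j0] : odd X = false /\ odd Y = false.
    (* odd squares are 1 modulo 8, so two odd terms would make 4 * p divisible by 8 *)
    have oddE n : odd n = odd (n %% 4) by rewrite {1}(divn_eq n 4) oddD oddM andbF.
    move: e p2; rewrite {}h (oddE X) (oddE Y); clear.
    rewrite {1}(divn_eq X 4) {1}(divn_eq Y 4) /dvdn -!mulnn.
    move: (X %/ 4)%N (X %% 4)%N (ltn_pmod X (isT : 0 < 4)%N) => a i.
    move: (Y %/ 4)%N (Y %% 4)%N (ltn_pmod Y (isT : 0 < 4)%N) => b j.
    by case: i => [|[|[|[|i]]]] //; case: j => [|[|[|[|j]]]] // _ _ ? ?; exfalso; nia.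
  exists X./2, Y./2; move: e; rewrite h -{1}(odd_double_half X) -{1}(odd_double_half Y) i0 j0.
  by rewrite !add0n; move: (X./2) (Y./2); clear => c d; rewrite -!mulnn; nia.
- exfalso; move: e p5; rewrite {}h; clear.
  rewrite (divn_eq X 5) (divn_eq Y 5) /dvdn -!mulnn.
  move: (X %/ 5)%N (X %% 5)%N (ltn_pmod X (isT : 0 < 5)%N) => a i.
  move: (Y %/ 5)%N (Y %% 5)%N (ltn_pmod Y (isT : 0 < 5)%N) => b j.
  by case: i => [|[|[|[|[|i]]]]] //; case: j => [|[|[|[|[|j]]]]] // _ _; nia.
- exfalso; move: e p3; rewrite {}h; clear.
  rewrite (divn_eq X 3) (divn_eq Y 3) /dvdn -!mulnn.
  move: (X %/ 3)%N (X %% 3)%N (ltn_pmod X (isT : 0 < 3)%N) => a i.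
  move: (Y %/ 3)%N (Y %% 3)%N (ltn_pmod Y (isT : 0 < 3)%N) => b j.
  by case: i => [|[|[|i]]] //; case: j => [|[|[|j]]] // _ _; nia.
- have [c cE] : exists c, X = (7 * c)%N.
    have : (7 %| X ^ 2)%N by rewrite -(dvdn_addl _ (dvdn_mulr (Y ^ 2) (dvdnn 7))) e h dvdn_mulr.
    by rewrite Euclid_dvdX // => /andP[/dvdnP[c ->] _]; exists c; rewrite mulnC.
  exists Y, c; move: e; rewrite h cE; clear; rewrite -!mulnn; nia.
Qed.

Lemma sum_sq_7 (p n : nat) : prime p -> (7 < p)%N -> (p %| n ^ 2 + 7)%N ->
  exists C D : int, p%:Z = C ^+ 2 + 7 * D ^+ 2.
Proof.
move=> p_prime p7 hn; have [x [y [nz xs ys dv]]] := thue n p_prime.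
have : (p%:Z %| x ^+ 2 + 7 * y ^+ 2)%Z.
  have -> : x ^+ 2 + 7 * y ^+ 2 = (x + n%:Z * y) * (x - n%:Z * y) + (n ^ 2 + 7)%N%:Z * y ^+ 2.
    by rewrite PoszD -mulnn PoszM; ring.
  by rewrite rpredD // dvdz_mulr.
rewrite dvdzE /=; have -> : absz (x ^+ 2 + 7 * y ^+ 2) = (absz x ^ 2 + 7 * absz y ^ 2)%N.
  rewrite -[RHS]absz_nat; congr absz; rewrite -!mulnn !(PoszD, PoszM) !abszE -!expr2.
  by rewrite !real_normK ?num_real.
case/dvdnP => k e.
have kb : (0 < k < 8)%N.
  have xs' : (absz x ^ 2 < p)%N by move: xs; rewrite -abszE expr2 -PoszM ltz_nat mulnn.
  have ys' : (absz y ^ 2 < p)%N by move: ys; rewrite -abszE expr2 -PoszM ltz_nat mulnn.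
  rewrite lt0n; apply/andP; split.
    apply: contraL nz => /eqP k0; move/eqP: e; rewrite k0 mul0n addn_eq0 muln_eq0 !expn_eq0 /=.
    by rewrite !absz_eq0 !andbT negb_or !negbK.
  rewrite -(ltn_pmul2r (prime_gt0 p_prime)) -e; move: xs' ys'.
  by move: (absz x ^ 2)%N (absz y ^ 2)%N; clear; lia.
have [c [d pE]] := multiple_sum_sq_7 p_prime p7 kb e.
by exists c%:Z, d%:Z; rewrite pE -!mulnn !(PoszD, PoszM) -!expr2.
Qed.

(** * Clearing denominators *)

Definition cm_num (p : nat) : int :=
  \sum_(k < p) (hyp_c k)%:Z * (- 1) ^+ k * 3375 ^+ (p.-1 - k).

Lemma p_integral_frac (p : nat) (a d : int) : d != 0 -> coprimez d p%:Z ->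
  p_integral p (a%:~R / d%:~R).
Proof.
move=> d0 cd; set x := a%:~R / d%:~R : rat.
have e : numq x * d = a * denq x.
  apply: (@intr_inj rat); rewrite !rmorphM /=.
  have dq0 : (denq x)%:~R != 0 :> rat by rewrite intr_eq0 denq_neq0.
  have d0' : d%:~R != 0 :> rat by rewrite intr_eq0.
  by rewrite -[in RHS](divfK d0' (a%:~R)) -/x -{2}(divq_num_den x) [in RHS]mulrAC divfK.
have : (denq x %| numq x * d)%Z by rewrite e dvdz_mull.
rewrite Gauss_dvdzr; last by rewrite coprimezE coprime_sym coprime_num_den.
rewrite dvdzE => h; apply: coprime_dvdl h _; exact: cd.
Qed.

Lemma eq_mod_frac (p M : nat) (N d y : int) : d != 0 -> coprimez d p%:Z ->
  (M%:Z %| N - y * d)%Z -> eq_mod_p_integral p M (N%:~R / d%:~R) y%:~R.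
Proof.
move=> d0 cd /dvdzP[q e]; have d0' : d%:~R != 0 :> rat by rewrite intr_eq0.
split; first exact: p_integral_frac.
  by rewrite -[y%:~R]divr1; apply: (@p_integral_frac p y 1); rewrite // /coprimez gcd1z.
exists (q%:~R / d%:~R); first exact: p_integral_frac.
apply: (mulIf d0'); rewrite mulrBl divfK // -rmorphM -rmorphB /= e rmorphM /=.
by rewrite -mulrA divfK // mulrC.
Qed.

Lemma divr_expN (F : fieldType) (c w : F) n k : w != 0 -> (k <= n)%N ->
  c / (- w) ^+ k = c * (- 1) ^+ k * w ^+ (n - k) / w ^+ n.
Proof.
move=> w0 kn; apply: (canLR (mulfK _)); first by rewrite expf_neq0 ?oppr_eq0.
have -> : (- w) ^+ k = (- 1) ^+ k * w ^+ k by rewrite -exprMn mulN1r.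
rewrite -{2}(subnK kn) exprD.
have e1 : (-1) ^+ k * (-1) ^+ k = 1 :> F by rewrite -exprD addnn -mul2n exprM sqrrN !expr1n.
transitivity (c * ((-1) ^+ k * (-1) ^+ k) * (w ^+ (n - k) * w ^+ k) / (w ^+ (n - k) * w ^+ k)); last first.
  by move: (_^-1) => v; ring.
by rewrite mulfK ?mulf_neq0 ?expf_neq0 // e1 mulr1.
Qed.

Lemma cm_sumE (p : nat) : (0 < p)%N ->
  \sum_(0 <= k < p) ('C(2 * k, k) * 'C(3 * k, k) * 'C(6 * k, 3 * k))%N%:R / (-15 : rat) ^+ (3 * k)
  = (cm_num p)%:~R / (3375 ^+ p.-1)%:~R.
Proof.
move=> p0; rewrite big_mkord /cm_num rmorph_sum mulr_suml; apply: eq_bigr => k _.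
have hk : (k <= p.-1)%N by rewrite -ltnS prednK.
have cube (F : fieldType) : (-15) ^+ 3 = - 3375%:R :> F by ring.
have toZ (n : nat) : n%:R = n%:Z%:~R :> rat by [].
rewrite exprM cube (toZ 3375) (natz 3375).
have : (3375%:Z)%:~R != 0 :> rat by rewrite intr_eq0.
rewrite -/(hyp_c k); move: (hyp_c k) 3375%:Z => c w w0.
by rewrite !rmorphM !rmorphXn /= rmorphN rmorph1 -divr_expN.
Qed.

(** The group of units of the field with p^12 elements is cyclic, and its order
    is divisible by 3, 5 and 7 because 2, 4 and 6 divide 12. *)
Lemma has_105th_root (p : nat) : prime p -> (7 < p)%N ->
  exists (K : finFieldType) (z : K), (p \in [pchar K]) /\ 105.-primitive_root z.
Proof.
move=> pp p7; have [K charK cardK] := pPrimePowerField pp (isT : 0 < 12)%N.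
exists K.
have q1 : (0 < #|K|.-1)%N by rewrite -ltnS prednK ?finNzRing_gt1 // (ltnW (finNzRing_gt1 K)).
have /hasP[x _ xn] : has (#|K|.-1).-primitive_root (enum [pred x : K | x != 0]).
  apply: has_prim_root => //; last by rewrite -cardE cardC1.
    apply/allP => x; rewrite mem_enum inE => x0; apply/unity_rootP.
    apply: (mulfI x0); rewrite mulr1 -exprS prednK ?expf_card //.
    exact: ltnW (finNzRing_gt1 K).
  exact: enum_uniq.
exists (x ^+ (#|K|.-1 %/ 105)); split=> //; apply: dvdn_prim_root => //.
rewrite cardK -subn1 -eqn_mod_dvd ?expn_gt0 ?prime_gt0 //.
have E q r : prime q -> (q <= 7)%N -> (12 = totient q * r)%N -> p ^ 12 == 1 %[mod q].
  move=> pq q7 ->; rewrite expnM -modnXm Euler_exp_totient ?modnXm ?exp1n //.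
  rewrite coprime_sym prime_coprime //; apply/negP => /(primeP pp).2 /orP[] /eqP h.
    by move: pq; rewrite h.
  by move: p7; rewrite -h ltnNge q7.
rewrite (_ : 105 = 3 * 5 * 7)%N // !chinese_remainder //.
by rewrite (E 3 6) // (E 5 3) // (E 7 2).
Qed.

(** * The two congruences *)

Section Congruence.
Variable p : nat.
Hypotheses (p_prime : prime p) (p_gt7 : (7 < p)%N).
Let m := p./2.

Let pE : p = (2 * m).+1.
Proof.
case: (even_prime p_prime) => [p2|op]; first by move: p_gt7; rewrite p2.
by rewrite -[LHS](odd_double_half p) op add1n mul2n.
Qed.

Lemma prime_mod_neq0 q : (1 < q <= 7)%N -> (p %% q != 0)%N.
Proof.
case/andP=> q1 q7; apply/negP => /(primeP p_prime).2 /orP[] /eqP h.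
  by move: q1; rewrite h.
by move: p_gt7; rewrite -h ltnNge q7.
Qed.

Lemma gauss_sums : exists (K : finFieldType) (s g3 g5 : K),
  [/\ p \in [pchar K],
      s ^+ 2 = - 7%:R /\ s ^+ p = (if (p %% 7)%N \in [:: 1; 2; 4]%N then 1 else -1) * s,
      g3 ^+ 2 = - 3%:R /\ g3 ^+ p = (legendre p 3)%:~R * g3
    & g5 ^+ 2 = 5%:R /\ g5 ^+ p = (legendre p 5)%:~R * g5].
Proof.
have [K [z [charK zn]]] := has_105th_root p_prime p_gt7.
exists K, (gauss7 (z ^+ 15)), (gauss3 (z ^+ 35)), (gauss5 (z ^+ 21)).
have z7 : 7.-primitive_root (z ^+ 15) by rewrite -[15%N]/(105 %/ 7)%N dvdn_prim_root.
have z3 : 3.-primitive_root (z ^+ 35) by rewrite -[35%N]/(105 %/ 3)%N dvdn_prim_root.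
have z5 : 5.-primitive_root (z ^+ 21) by rewrite -[21%N]/(105 %/ 5)%N dvdn_prim_root.
rewrite !gauss7_sq ?gauss3_sq ?gauss5_sq //.
rewrite (gauss7_frob charK) ?(gauss3_frob charK) ?(gauss5_frob charK) ?prime_mod_neq0 //.
rewrite legendre3 ?legendre5 ?prime_mod_neq0 //.
by split=> //; split=> //; congr (_ * _); case: ifP.
Qed.

(** An integral lift of the Hasse invariant compares its values in different
    fields of characteristic p. *)
Definition hasse_int : int := ((weierstrass (- 35%:R) (- 98%:R) : {poly int}) ^+ m)`_p.-1.

Lemma hasse_intE (K : fieldType) :
  hasse p m (weierstrass (- 35%:R) (- 98%:R) : {poly K}) = hasse_int%:~R.
Proof.
rewrite /hasse /hasse_int -(coef_map (intmul 1)) rmorphXn /=; congr ((polyseq (_ ^+ m))`_ _).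
rewrite /weierstrass !rmorphD rmorphXn /= map_polyX map_polyZ map_polyX map_polyC /=.
by rewrite !rmorphN !rmorph_nat.
Qed.

Lemma hasse_int_split (C D : int) : p%:Z = C ^+ 2 + 7 * D ^+ 2 ->
  (p%:Z %| hasse_int ^+ 2 - 4 * C ^+ 2)%Z.
Proof.
move=> e; rewrite (dvdz_pcharf (pchar_Fp p_prime)) rmorphB /= rmorphXn /= -hasse_intE.
rewrite -(sum_legendre_Fp p_prime p_gt7 e) subr_eq0.
have -> : \sum_(x : 'F_p) (weierstrass (- 35%:R) (- 98%:R) : {poly 'F_p}).[x] ^+ p./2 =
   - hasse p m (weierstrass (- 35%:R) (- 98%:R) : {poly 'F_p}).
  under eq_bigr do rewrite -horner_exp.
  rewrite sum_horner card_Fp // (leq_trans (size_poly_exp_leq _ _)) //.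
  have := eq_leq (size_weierstrass (- 35%:R : 'F_p) (- 98%:R)); move: (size _) => n hn.
  apply: (@leq_trans (3 * m).+1); first by rewrite ltnS leq_mul2r -subn1 leq_subLR hn orbT.
  by rewrite -/m [in X in (_ <= X)%N]pE; move: pE p_gt7; clear; lia.
by rewrite sqrrN.
Qed.

(** The truncated series at (25 - 3 r) / 21600, cleared of denominators. *)
Definition hyp_a_sum (A : comNzRingType) (r : A) : A :=
  \sum_(k < p) (hyp_a k)%:R * (25%:R - 3%:R * r) ^+ k * 21600%:R ^+ (p.-1 - k).

Lemma hyp_c_homog (A : comNzRingType) (M L : int) :
  \sum_(k < p) (hyp_c k)%:R * (- M%:~R) ^+ k * (M%:~R * L%:~R) ^+ (p.-1 - k) =
  (M ^+ p.-1 * \sum_(k < p) (hyp_c k)%:Z * (- 1) ^+ k * L ^+ (p.-1 - k))%:~R :> A.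
Proof.
rewrite rmorphM rmorph_sum mulr_sumr /=; apply: eq_bigr => k _.
have hk : (k <= p.-1)%N by rewrite -ltnS prednK // prime_gt0.
move: (hyp_c k) => c; rewrite -{2}(subnK hk) !rmorphM !rmorphXn /= rmorphN rmorph1.
have -> : (- M%:~R) ^+ k = (- 1) ^+ k * M%:~R ^+ k :> A by rewrite -exprMn mulN1r.
by rewrite exprMn exprD -[c%:Z%:~R]/(c%:R); ring.
Qed.

Lemma hyp_c_shift (A : comNzRingType) (x w d e : A) (M L : int) :
  x = - M%:~R + d * e -> w ^+ 2 = M%:~R * L%:~R -> exists Q : A,
  (M ^+ p.-1 * \sum_(k < p) (hyp_c k)%:Z * (- 1) ^+ k * L ^+ (p.-1 - k))%:~R + d * Q =
  \sum_(k < p) (hyp_c k)%:R * x ^+ k * w ^+ (2 * (p.-1 - k)).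
Proof.
rewrite -hyp_c_homog; move: M%:~R L%:~R => {}M {}L xE wE.
pose Q := \sum_(k < p) (hyp_c k)%:R * (e * \sum_(i < k) x ^+ (k.-1 - i) * (- M) ^+ i) * (M * L) ^+ (p.-1 - k).
exists Q; rewrite /Q mulr_sumr -big_split; apply: eq_bigr => k _ /=.
rewrite exprM wE.
have -> : x ^+ k = (- M) ^+ k + (x - - M) * \sum_(i < k) x ^+ (k.-1 - i) * (- M) ^+ i.
  by rewrite -subrXX addrC subrK.
set S := \sum_(i < k) _; rewrite {1}xE [- M + _]addrC addrK; ring.
Qed.

(** With u = 25 - 3 r, w = 21600 and M = 240 * 576, one has
    u (w - 432 u) = - M - 3888 (r^2 - 105) and w^2 = 3375 M. So for r^2 = 105
    the argument u (w - 432 u) / w^2 of the longer series is -1 / 15^3. *)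
Lemma hyp_a_sum_sq (A : comNzRingType) (r : A) : exists Q z : A,
  ((240 * 576) ^+ p.-1 * cm_num p)%:~R + (r ^+ 2 - 105%:R) * Q =
  hyp_a_sum r ^+ 2 + (p ^ 2)%:R * z.
Proof.
pose u : A := 25%:R - 3%:R * r; pose w : A := 21600%:R.
have [z hz] := truncated_clausen u w p_prime p_gt7.
have xE : u * (w - 432%:R * u) = - (240 * 576)%:~R + (r ^+ 2 - 105%:R) * (- 3888%:R).
  by rewrite /u /w; ring.
have wE : w ^+ 2 = (240 * 576)%:~R * 3375%:~R by rewrite /w; ring.
have [Q hQ] := hyp_c_shift xE wE.
by exists Q, z; rewrite hQ.
Qed.

Lemma reduce_sqrt105 (P : {poly int}) : exists (a b : int) (Q : {poly int}),
  P = a%:P + b%:P * 'X + ('X ^+ 2 - 105%:R) * Q.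
Proof.
elim/poly_ind: P => [|P c [a [b [Q ->]]]].
  by exists 0, 0, 0; rewrite polyC0 !(mul0r, mulr0, addr0).
exists (c + 105%:R * b), a, (b%:P + Q * 'X).
rewrite polyCD polyCM [(105%:R)%:P]polyC_natr; move: (105%:R : {poly int}) => h; ring.
Qed.

Lemma smooth_neq0 (K : fieldType) (charK : p \in [pchar K]) :
  [/\ 2%:R != 0 :> K, 3%:R != 0 :> K, 5%:R != 0 :> K & 105%:R != 0 :> K].
Proof.
have nz q : (0 < q <= 7)%N -> q%:R != 0 :> K.
  by case/andP=> q0 q7; apply: (natr_neq0_ltp charK); rewrite q0 (leq_ltn_trans q7).
have -> : 105%:R = 3%:R * 5%:R * 7%:R :> K by ring.
by split; rewrite ?mulf_neq0 ?nz.
Qed.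

Lemma cm_num_field (K : fieldType) (r : K) : p \in [pchar K] -> r ^+ 2 = 105%:R ->
  (cm_num p)%:~R = 105%:R ^+ m * hasse_int%:~R ^+ 2 :> K.
Proof.
move=> charK hr; have [n2 n3 n5 n105] := smooth_neq0 charK.
rewrite -hasse_intE -(hyp_a_cm charK pE p_gt7 hr).
have [Q [z]] := hyp_a_sum_sq r; rewrite hr subrr mul0r addr0 natrX (pcharf0 charK).
rewrite expr0n mul0r addr0 => <-; rewrite rmorphM rmorphXn /=.
have -> : (240 * 576)%:~R = (240 * 576)%N%:R :> K by rewrite rmorphM natrM.
rewrite (fermat_natr charK pE) ?mul1r //.
rewrite (_ : _%:R = 2%:R ^+ 10 * 3%:R ^+ 3 * 5%:R); last by rewrite natrM; ring.
by rewrite !mulf_neq0 ?expf_neq0.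
Qed.

(** The truncated series vanishes in characteristic p at both square roots of
    105. Modulo X^2 - 105 over the integers it is thus a + b X with p dividing a
    and b, and its square is divisible by p^2. *)
Lemma p2_dvd_cm_num : (p %% 7)%N \in [:: 3; 5; 6]%N -> ((p ^ 2)%N%:Z %| cm_num p)%Z.
Proof.
move=> p7; have [K [s [g3 [g5 [charK [hs sp] [h3 _] [h5 _]]]]]] := gauss_sums.
have [n2 n3 n5 n105] := smooth_neq0 charK.
have H0 : hasse p m (weierstrass (- 35%:R) (- 98%:R) : {poly K}) = 0.
  apply: (hasse_inert charK pE p_gt7 hs); rewrite sp.
  by move: p7; rewrite !inE => /or3P[] /eqP ->; rewrite mulN1r.
pose r := s * g3 * g5.
have hr : r ^+ 2 = 105%:R by rewrite /r !exprMn hs h3 h5; ring.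
have r0 : r != 0 by move: n105; rewrite -hr expf_eq0.
have vanish (x : K) : x ^+ 2 = 105%:R -> hyp_a_sum x = 0.
  move=> hx; have := hyp_a_cm charK pE p_gt7 hx; rewrite H0 expr0n mulr0.
  by move/eqP; rewrite expf_eq0 => /eqP.
have [a [b [Q PE]]] := reduce_sqrt105 (hyp_a_sum 'X).
have evab (x : K) : x ^+ 2 = 105%:R -> a%:~R + b%:~R * x = 0.
  have [ev evX evC] : exists2 ev : {rmorphism {poly int} -> K},
      ev 'X = x & forall c, ev c%:P = c%:~R.
    exists (GRing.RMorphism.clone _ _ (horner_eval x \o map_poly intr) _).
      by rewrite /= map_polyX /horner_eval hornerX.
    by move=> c; rewrite /= map_polyC /horner_eval hornerC.
  move=> hx; rewrite -(vanish x hx); transitivity (ev (hyp_a_sum 'X)).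
    rewrite PE rmorphD rmorphM rmorphB rmorphXn [ev (105%:R)]rmorph_nat evX hx.
    by rewrite subrr mul0r addr0 rmorphD rmorphM evX !evC.
  rewrite /hyp_a_sum rmorph_sum; apply: eq_bigr => k _.
  move: (hyp_a k) 21600%N => c w.
  by rewrite [LHS]rmorphM [X in X * _]rmorphM !rmorphXn /= rmorphB rmorphM !rmorph_nat evX.
have [a0 b0] : (p%:Z %| a)%Z /\ (p%:Z %| b)%Z.
  have e1 := evab r hr; have e2 := evab (- r); rewrite sqrrN mulrN in e2.
  have {}e2 := e2 hr; rewrite !(dvdz_pcharf charK).
  have a0 : 2%:R * a%:~R = 0 :> K.
    transitivity (a%:~R + b%:~R * r + (a%:~R - b%:~R * r)); first by ring.
    by rewrite e1 e2 addr0.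
  move/eqP: a0; rewrite mulf_eq0 (negPf n2) /= => /eqP a0; move/eqP: e1.
  by rewrite a0 add0r mulf_eq0 (negPf r0) orbF.
have [Q1 [z hz]] := hyp_a_sum_sq ('X : {poly int}).
have [a' [b' [Q2 zE]]] := reduce_sqrt105 z.
pose c := (240 * 576) ^+ p.-1 * cm_num p.
have const : c = a ^+ 2 + 105%:R * b ^+ 2 + (p ^ 2)%N%:Z * a'.
  pose d := c - (a ^+ 2 + 105%:R * b ^+ 2 + (p ^ 2)%N%:Z * a').
  pose d1 := 2%:R * a * b + (p ^ 2)%N%:Z * b'.
  have E : d%:P - d1%:P * 'X = ('X ^+ 2 - 105%:R%:P) *
      (2%:R%:P * (a%:P + b%:P * 'X) * Q + ('X ^+ 2 - 105%:R%:P) * Q ^+ 2 + (b ^+ 2)%:P + (p ^ 2)%N%:Z%:P * Q2 - Q1).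
    have hz' : c%:P + ('X ^+ 2 - 105%:R%:P) * Q1 = (a%:P + b%:P * 'X + ('X ^+ 2 - 105%:R%:P) * Q) ^+ 2 +
        (p ^ 2)%N%:Z%:P * (a'%:P + b'%:P * 'X + ('X ^+ 2 - 105%:R%:P) * Q2).
      have cE : c%:P = c%:~R :> {poly int} by move: (c) => i; rewrite -{1}[i]intz [LHS]rmorph_int.
      have pE' : (p ^ 2)%N%:Z%:P = (p ^ 2)%N%:R :> {poly int} by rewrite -polyC_natr natz.
      by rewrite cE pE' polyC_natr hz PE zE.
    rewrite /d /d1; move: ((p ^ 2)%N%:Z) hz' => q hz'.
    apply: (addIr (('X ^+ 2 - 105%:R%:P) * Q1)).
    rewrite !polyCB; transitivity (c%:P + ('X ^+ 2 - 105%:R%:P) * Q1 - (a ^+ 2 + 105%:R * b ^+ 2 + q * a')%:P - (2%:R * a * b + q * b')%:P * 'X).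
      by ring.
    by rewrite hz'; ring.
  apply/eqP; rewrite -subr_eq0 -/d; move: E; set R := (X in _ = _ * X) => E.
  have [R0|R0] := eqVneq R 0.
    by move/(congr1 (fun f : {poly int} => f`_0)): E; rewrite /= R0 mulr0 coefB coefC coefMX subr0 coef0 => ->.
  have := congr1 (fun f : {poly int} => size f) E.
  rewrite /= [(_ - _) * R]mulrC size_Mmonic ?monicXnsubC // size_XnsubC // addn3.
  move=> sz; have : (size (d%:P - d1%:P * 'X)%R <= 2)%N.
    apply: leq_trans (size_polyD _ _) _; rewrite geq_max size_polyN mul_polyC.
    rewrite (leq_trans (size_polyC_leq1 _)) // (leq_trans (size_scale_leq _ _)) ?size_polyX //.
  by rewrite sz; move: R0; rewrite -size_poly_gt0; case: (size R).
have : ((p ^ 2)%N%:Z %| c)%Z.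
  rewrite const; case/dvdzP: a0 => x ->; case/dvdzP: b0 => y ->.
  rewrite rpredD ?dvdz_mulr //.
  have -> : (x * p%:Z) ^+ 2 + 105%:R * (y * p%:Z) ^+ 2 = (p ^ 2)%N%:Z * (x ^+ 2 + 105%:R * y ^+ 2).
    by rewrite -mulnn PoszM; ring.
  exact: dvdz_mulr.
rewrite Gauss_dvdzr // coprimezXr //.
have cop q : (1 < q <= 7)%N -> coprimez (p ^ 2)%N%:Z q%:Z.
  move=> hq; rewrite coprimezE /= coprimeXl // prime_coprime //.
  by rewrite gtnNdvd // ?(leq_ltn_trans _ p_gt7) //; case/andP: hq => // /ltnW.
rewrite (_ : 240 * 576 = 2%:Z ^+ 10 * 3%:Z ^+ 3 * 5%:Z) //.
by rewrite 2!coprimezMr !coprimezXr ?cop.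
Qed.

(** The product r of the three Gauss sums is a square root of 105, and
    105^m = r^(p - 1) is the sign by which Frobenius acts on r. As s is fixed,
    this is the product of the Legendre symbols of p at 3 and 5. *)
Lemma p_dvd_cm_num (C D : int) : (p %% 7)%N \in [:: 1; 2; 4]%N -> p%:Z = C ^+ 2 + 7 * D ^+ 2 ->
  (p%:Z %| cm_num p - jacobi p%:Z 15 * (4 * C ^+ 2) * 3375 ^+ p.-1)%Z.
Proof.
move=> p7 e; have [K [s [g3 [g5 [charK [hs sp] [h3 p3] [h5 p5]]]]]] := gauss_sums.
have [n2 n3 n5 n105] := smooth_neq0 charK.
pose r := s * g3 * g5.
have hr : r ^+ 2 = 105%:R by rewrite /r !exprMn hs h3 h5; ring.
have r0 : r != 0 by move: n105; rewrite -hr expf_eq0.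
have jE : 105%:R ^+ m = (jacobi p%:Z 15)%:~R :> K.
  apply: (mulIf r0); rewrite -hr -exprM mulrC -exprS -pE.
  rewrite [in LHS]/r !exprMn sp p7 p3 p5 jacobi15 rmorphM /= /r; ring.
have n3375 : (3375 ^+ p.-1)%:~R = 1 :> K.
  rewrite rmorphXn /= -[3375%:~R]/(3375%:R) (fermat_natr charK pE) //.
  by rewrite (_ : 3375%:R = (3%:R * 5%:R) ^+ 3) ?expf_neq0 ?mulf_neq0 //; ring.
have := hasse_int_split e; rewrite !(dvdz_pcharf charK) !rmorphB /= !subr_eq0 => /eqP h.
rewrite (cm_num_field charK hr) jE -rmorphXn /= h.
by rewrite [X in _ == X]rmorphM /= n3375 mulr1 [X in _ == X]rmorphM.
Qed.

Lemma prime_field_sqrt : (p %% 7)%N \in [:: 1; 2; 4]%N -> exists n : nat, (p %| n ^ 2 + 7)%N.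
Proof.
move=> p7; have [K [s [g3 [g5 [charK [hs sp] _ _]]]]] := gauss_sums.
have [|n sn] := frob_fixed_natr (s := s) charK; first by rewrite sp p7 mul1r.
by exists n; rewrite (dvdn_pcharf charK) natrD natrX -sn hs addNr.
Qed.
End Congruence.

Theorem theorem4p8 (p : nat) (p_prime : prime p) (p_gt7 : (7 < p)%N) :
  ((p %% 7)%N \in [:: 3; 5; 6]%N ->
     eq_mod_p_integral p (p ^ 2)
       (\sum_(0 <= k < p)
          ('C(2 * k, k) * 'C(3 * k, k) * 'C(6 * k, 3 * k))%N%:R
            / (-15 : rat) ^+ (3 * k))
       0)
  /\
  ((p %% 7)%N \in [:: 1; 2; 4]%N ->
     (exists C D : int, p%:Z = C ^+ 2 + 7 * D ^+ 2)
     /\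
     (forall C D : int, p%:Z = C ^+ 2 + 7 * D ^+ 2 ->
        eq_mod_p_integral p p
          (\sum_(0 <= k < p)
             ('C(2 * k, k) * 'C(3 * k, k) * 'C(6 * k, 3 * k))%N%:R
               / (-15 : rat) ^+ (3 * k))
          (jacobi p%:Z 15 * (4 * C ^+ 2))%:~R)).
Proof.
have w0 : (3375 : int) ^+ p.-1 != 0 by rewrite expf_neq0.
have wp : coprimez (3375 ^+ p.-1) p%:Z.
  have cop q : (1 < q <= 7)%N -> coprimez q%:Z p%:Z.
    move=> hq; rewrite coprimezE /= coprime_sym prime_coprime //.
    by rewrite gtnNdvd // ?(leq_ltn_trans _ p_gt7) //; case/andP: hq => // /ltnW.
  apply: coprimezXl; rewrite (_ : 3375 = 3%:Z ^+ 3 * 5%:Z ^+ 3) //.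
  by rewrite coprimezMl !coprimezXl ?cop.
rewrite cm_sumE ?prime_gt0 //; split=> p7.
  rewrite -[0 : rat]/((0 : int)%:~R); apply: eq_mod_frac => //.
  by rewrite mul0r subr0 p2_dvd_cm_num.
split=> [|C D e].
  have [n hn] := prime_field_sqrt p_prime p_gt7 p7.
  exact: sum_sq_7 hn.
by apply: eq_mod_frac => //; apply: p_dvd_cm_num e.
Qed.
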